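(* Let $d\ge2$ be a fixed integer, and let $m=m_n$ be integers with $1\le m\le n$ and $m=o\bigl(n^{(d-1)/d}\bigr)$ as $n\to\infty$. Let $X^{(n)}:=|\widehat D_{n,m}|$ be the number of descendants of vertex $n$ in the random $d$-dag $D_{n,m}$ started with $m$ roots. Then, as $n\to\infty$, $$\frac{X^{(n)}}{n^{(d-1)/d}}\ \overset{\mathrm d}{\longrightarrow}\ \frac{\pi(d-1)^{1/d}}{d\sin(\pi/d)}\,\gamma^{1/d},$$ with convergence of all moments, where $\gamma$ has the Gamma distribution $\Gamma\bigl(\frac d{d-1}\bigr)$; hence, for every fixed $r>0$, $$\mathbb E\bigl(X^{(n)}\bigr)^r\sim\left(\frac{(d-1)^{1/d}\pi}{d\sin(\pi/d)}\right)^r\frac{\Gamma\bigl(\frac d{d-1}+\frac rd\bigr)}{\Gamma\bigl(\frac d{d-1}\bigr)}\,n^{r(d-1)/d}.$$ In particular, for $d=2$, $X^{(n)}/\sqrt n\overset{\mathrm d}{\longrightarrow}\frac{\pi}{2\sqrt2}\chi_4$ with convergence of all moments, $\mathbb E(X^{(n)})^r\sim(\pi/2)^r\,\Gamma(\frac r2+2)\,n^{r/2}$ for every fixed $r>0$, and $\mathbb E X^{(n)}\sim\frac{3\pi^{3/2}}8\sqrt n$.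
   Context: For $1\le m\le n$, the random $d$-dag $D_{n,m}$ with $m$ roots is the random directed acyclic multigraph on the vertex set $\{1,\dots,n\}$ in which the vertices $1,\dots,m$ are roots (outdegree $0$) and each vertex $k=m+1,\dots,n$ has exactly $d$ outgoing edges, whose endpoints are chosen uniformly at random from $\{1,\dots,k-1\}$, all choices being independent (multiple edges are allowed). $\widehat D_{n,m}$ is the subdigraph of $D_{n,m}$ consisting of all vertices and edges that can be reached by a directed path from vertex $n$ (including $n$ itself), and $|\widehat D_{n,m}|$ is its number of vertices. The Gamma distribution $\Gamma(s)$, $s>0$, has density $\Gamma(s)^{-1}x^{s-1}e^{-x}$, $x>0$; in the moment formulas $\Gamma$ is the Gamma function. $\chi_4$ has the $\chi(4)$ distribution, i.e. the distribution of $|\eta|$ with $\eta$ a standard normal random vector in $\mathbb R^4$. *)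

(* Defs.v *)
From HB Require Import structures.
From mathcomp Require Import all_boot all_order all_algebra.
From mathcomp Require Import all_classical all_reals all_analysis.

Set Implicit Arguments.
Unset Strict Implicit.
Unset Printing Implicit Defensive.

Import Order.TTheory GRing.Theory Num.Theory.
Import numFieldNormedType.Exports.

Local Open Scope classical_set_scope.
Local Open Scope ring_scope.

(* Mutual independence of the family (X i), i \in D: the product rule for
   every finite subfamily. *)
Definition independent_RVs (disp disp' : measure_display)
    (T : measurableType disp) (T' : measurableType disp') (R : realType)
    (P : probability T R) (I : eqType) (D : {pred I})
    (X : I -> {RV P >-> T'}) : Prop :=
  forall (s : seq I) (A : I -> set T'),
    uniq s -> {subset s <= D} -> (forall i, measurable (A i)) ->
    P (\bigcap_(i in [set` s]) (X i @^-1` A i)) =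
    (\prod_(i <- s) P (X i @^-1` A i))%E.

(* A d-dag on the vertices 1, ..., n with roots 1, ..., m is encoded by the map
   [head] giving the endpoint of the j-th edge leaving k, for m < k <= n and
   j < d; the values of [head] at the other pairs (k, j) are irrelevant.
   Parallel edges are pairs (k, j), (k, j') with the same head. *)
Section ddag.
Variables (d n m : nat) (head : nat * 'I_d -> nat).

(* The vertices are the nonzero elements of 'I_n.+1, so that each vertex has
   its own label as value; [ord_max] is the vertex n. *)
Definition ddag_adj : rel 'I_n.+1 :=
  fun k l => (m < k)%N && [exists j : 'I_d, head (val k, j) == l].

Definition descendants : {set 'I_n.+1} :=
  [set v : 'I_n.+1 | (0 < v)%N && connect ddag_adj ord_max v].

End ddag.

(* The edges are indexed by the pairs (k, j) with m < k <= n, and the heads are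
   independent, the head of (k, j) being uniform on {1, ..., k-1}. *)
Definition random_ddag (d : nat) (disp : measure_display)
    (T : measurableType disp) (R : realType) (P : probability T R) (n m : nat)
    (head : nat * 'I_d -> {RV P >-> nat}) : Prop :=
  (forall (k : nat) (j : 'I_d) (i : nat), (m < k <= n)%N -> (1 <= i < k)%N ->
     P (head (k, j) @^-1` [set i]) = (k.-1%:R^-1)%:E) /\
  independent_RVs [pred e : nat * 'I_d | (m < e.1 <= n)%N] head.

Definition num_descendants (d : nat) (disp : measure_display)
    (T : measurableType disp) (R : realType) (P : probability T R) (n m : nat)
    (head : nat * 'I_d -> {RV P >-> nat}) : T -> R :=
  fun t => #|descendants n m (fun e => head e t)|%:R.

Definition cvg_distribution (R : realType) (disp : nat -> measure_display)
    (T : forall n, measurableType (disp n)) (P : forall n, probability (T n) R)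
    (X : forall n, T n -> R) (disp' : measure_display)
    (T' : measurableType disp') (Q : probability T' R) (Z : T' -> R) : Prop :=
  [/\ forall n, measurable_fun [set: T n] (X n),
      measurable_fun [set: T'] Z &
      forall f : R -> R, continuous f -> bounded_fun f ->
        ('E_(P n)[f \o X n] @[n --> \oo] --> 'E_Q[f \o Z])%E].

(* Convergence of all moments, for nonnegative random variables. *)
Definition cvg_moments (R : realType) (disp : nat -> measure_display)
    (T : forall n, measurableType (disp n)) (P : forall n, probability (T n) R)
    (X : forall n, T n -> R) (disp' : measure_display)
    (T' : measurableType disp') (Q : probability T' R) (Z : T' -> R) : Prop :=
  forall r : R, 0 < r ->
    ('E_Q[fun t => (Z t `^ r)%R] < +oo)%E /\
    ('E_(P n)[fun t => (X n t `^ r)%R] @[n --> \oo] -->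
      'E_Q[fun t => (Z t `^ r)%R])%E.

Definition Gamma (R : realType) (s : R) : R :=
  \int[lebesgue_measure]_(x in `]0, +oo[) (x `^ (s - 1) * expR (- x)).

Definition gamma_pdf (R : realType) (s x : R) : R :=
  if 0 < x then (Gamma s)^-1 * x `^ (s - 1) * expR (- x) else 0.

Definition gamma_prob (R : realType) (s : R) : set R -> \bar R :=
  fun A => (\int[lebesgue_measure]_(x in A) (gamma_pdf s x)%:E)%E.

Definition gamma_distributed (R : realType) (disp : measure_display)
    (T : measurableType disp) (P : probability T R) (s : R)
    (Y : {RV P >-> R}) : Prop :=
  forall A : set R, measurable A -> distribution P Y A = gamma_prob s A.

Definition standard_normal_vector (R : realType) (disp : measure_display)
    (T : measurableType disp) (P : probability T R) (k : nat)
    (eta : 'I_k -> {RV P >-> R}) : Prop :=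
  (forall (i : 'I_k) (A : set R), measurable A ->
     distribution P (eta i) A = normal_prob 0 1 A) /\
  independent_RVs predT eta.

Definition euclidean_norm (R : realType) (disp : measure_display)
    (T : measurableType disp) (P : probability T R) (k : nat)
    (eta : 'I_k -> {RV P >-> R}) : T -> R :=
  fun t => Num.sqrt (\sum_(i < k) eta i t ^+ 2).

(* Main.v *)
Require Import Defs.
From HB Require Import structures.
From mathcomp Require Import all_boot all_order all_algebra.
From mathcomp Require Import all_classical all_reals all_analysis.
From mathcomp Require Import measurable_realfun.
From mathcomp Require Import ring lra zify.

(** The descendants of n are found by going through the vertices k = n, n - 1,
    n - 2, ... and by looking at the edges of those vertices only that are
    already known to be descendants. Suppose that x descendants have been found
    above k, and that y of the edges leaving them end at k or below. Given the
    past, the heads of these y pending edges are independent and uniform on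
    {1, ..., k}. Hence the number z of heads equal to k is binomial, and (x, y)
    becomes (x + 1, y - z + d) if z > 0 and stays the same if z = 0: the
    exploration is a Markov chain started at (1, d). The number of descendants
    is the value of x when the roots are reached, plus the number of distinct
    roots among the remaining heads ([explore_descendants], [unifs_avgx],
    [expectation_law]). The latter is at most m, which is negligible on the
    scale n^((d-1)/d).

    Above K = A n^((d-1)/d), with A large, the pending edges hardly ever meet.
    They behave like a branching process in which every edge splits into d with
    probability 1/k, so the mean of s^y is almost w^d, where w comes from s by a
    deterministic recursion. In the coordinate s^-(d-1) - 1 this recursion is
    nearly multiplication by (1 + 1/k)^(d-1), and K^(d-1) y / n^(d-1) turns out
    to be close to (d - 1) gamma in law ([chain_pow]).

    Below K many pending edges are present, and a law of large numbers holds: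
    y / k follows the differential equation u' = - d (1 - exp (- u)) / k, with
    solution ln (1 + C / k^d), where C = K^(d-1) y is given by the state at K.
    Vertex k is then found with probability C / (k^d + C). The sum over k of
    these probabilities is almost C^(1/d) times the integral of 1 / (1 + x^d)
    over the half-line, which is pi / (d sin (pi / d)) ([window_approx],
    [sum_fluid_rate]). As C / n^(d-1) is close to (d - 1) gamma, this explains
    the limit.

    Both phases are combined on Laplace transforms of the d-th power: for every
    t > 0 the mean of exp (- t (X / n^((d-1)/d))^d) converges to
    (1 + (d - 1) t (pi / (d sin (pi / d)))^d)^(-d/(d-1)) ([law_laplace]), which
    is the transform of the asserted limit ([gamma_laplace]). Since polynomials
    in exp (- x^d) approximate the continuous functions that vanish outside a
    segment, the values t = 1, 2, 3, ... and a bound on the mean give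
    convergence in distribution ([weak_convergence]). All moments of the chain
    are bounded on the right scale, because rising factorials of x grow at an
    explicit rate ([moment_rising]); by truncation the moments converge
    as well ([slaw_moment_cvg]). For d = 2 the Gamma law of the limit is that of
    half the squared norm of a normal vector in dimension 4
    ([normal_vector_laplace]). *)

Import Order.TTheory GRing.Theory Num.Theory.
Import numFieldNormedType.Exports.

Set Implicit Arguments.
Unset Strict Implicit.
Unset Printing Implicit Defensive.

Local Open Scope classical_set_scope.
Local Open Scope ring_scope.

Ltac nneg := intros; repeat first
  [ by [] | by apply: ltW | apply: sqr_ge0 | apply: mulr_ge0
  | apply: exprn_ge0 | rewrite invr_ge0 | apply: addr_ge0 ].

(** * Binomial expectations *)

Section BinomialExpectation.
Variable R : realType.
Implicit Types (p : R) (y : nat) (phi psi : nat -> R).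

(** Conditioning on the first of the y trials, instead of summing against
    binomial coefficients, makes the identities below inductions on y. *)
Fixpoint binexp p y phi : R :=
  if y is y'.+1 then p * binexp p y' (fun z => phi z.+1) + (1 - p) * binexp p y' phi
  else phi 0%N.

Lemma eq_binexp p y phi psi :
  (forall z, (z <= y)%N -> phi z = psi z) -> binexp p y phi = binexp p y psi.
Proof.
elim: y phi psi => [|y IH] phi psi h /=; first exact: h.
congr (_ * _ + _ * _); apply: IH => z zy; apply: h => //.
exact: leqW.
Qed.

Lemma binexp_cst p y (a : R) : binexp p y (fun=> a) = a.
Proof. by elim: y => //= y ->; ring. Qed.

Lemma binexpD p y phi psi :
  binexp p y (fun z => phi z + psi z) = binexp p y phi + binexp p y psi.
Proof.
by elim: y phi psi => //= y IH phi psi; rewrite 2!IH; ring.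
Qed.

Lemma binexpZ p y (a : R) phi : binexp p y (fun z => a * phi z) = a * binexp p y phi.
Proof.
by elim: y phi => //= y IH phi; rewrite 2!IH; ring.
Qed.

Lemma le_binexp p y phi psi : 0 <= p <= 1 ->
  (forall z, (z <= y)%N -> phi z <= psi z) -> binexp p y phi <= binexp p y psi.
Proof.
move=> /andP[p0 p1]; elim: y phi psi => [|y IH] phi psi h /=; first exact: h.
apply: lerD; apply: ler_wpM2l => //; rewrite ?subr_ge0//; apply: IH => z zy;
  apply: h => //; exact: leqW.
Qed.

Lemma binexpB p y phi psi :
  binexp p y (fun z => phi z - psi z) = binexp p y phi - binexp p y psi.
Proof.
rewrite -[- binexp p y psi]mulN1r -binexpZ -binexpD.
by apply: eq_binexp => z _; rewrite mulN1r.
Qed.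

(** The bound eps may depend on the outcome, so that errors are averaged
    rather than maximized. *)
Lemma binexp_dist p y phi psi eps : 0 <= p <= 1 ->
  (forall z, (z <= y)%N -> `|phi z - psi z| <= eps z) ->
  `|binexp p y phi - binexp p y psi| <= binexp p y eps.
Proof.
move=> p01 h; rewrite -binexpB ler_norml; apply/andP; split.
  rewrite -[- binexp p y eps]mulN1r -binexpZ; apply: le_binexp => // z /h.
  by rewrite ler_norml mulN1r => /andP[].
by apply: le_binexp => // z /h; rewrite ler_norml => /andP[].
Qed.

Lemma binexp_id p y : binexp p y (fun z => z%:R) = p * y%:R.
Proof.
elim: y => [|y IH] /=; first by rewrite mulr0.
under eq_binexp do rewrite -natr1.
by rewrite binexpD binexp_cst IH -natr1; ring.
Qed.

Lemma binexp_sqr p y :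
  binexp p y (fun z => z%:R ^+ 2) = p * (1 - p) * y%:R + (p * y%:R) ^+ 2.
Proof.
elim: y => [|y IH] /=; first by ring.
transitivity (p * (binexp p y (fun z => z%:R ^+ 2) + 2 * binexp p y (fun z => z%:R)
  + 1) + (1 - p) * binexp p y (fun z => z%:R ^+ 2)).
  congr (p * _ + _); rewrite -binexpZ -[X in _ + X](binexp_cst p y) -!binexpD.
  by apply: eq_binexp => z _; rewrite -natr1; ring.
by rewrite IH binexp_id -natr1; ring.
Qed.

Lemma binexp_var p y (u : R) :
  binexp p y (fun z => (z%:R - u) ^+ 2) =
  p * (1 - p) * y%:R + (p * y%:R - u) ^+ 2.
Proof.
transitivity (binexp p y (fun z => z%:R ^+ 2) + (- 2 * u) * binexp p y (fun z => z%:R)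
  + u ^+ 2).
  rewrite -binexpZ -[X in _ + X](binexp_cst p y) -!binexpD.
  by apply: eq_binexp => z _; ring.
by rewrite binexp_sqr binexp_id; ring.
Qed.

Lemma binexp_hit p y : binexp p y (fun z => (0 < z)%N%:R) = 1 - (1 - p) ^+ y.
Proof.
elim: y => [|y IH] /=; first by rewrite expr0 subrr.
by rewrite binexp_cst IH exprS; ring.
Qed.

End BinomialExpectation.

(** * The exploration chain *)

Section Chain.
Variables (R : realType) (d : nat).
Hypothesis d_gt0 : (0 < d)%N.
Implicit Types (phi psi : nat -> nat -> R) (x y k l : nat).

(** One vertex of the exploration of the dag from n downwards. At vertex k, x
    descendants have been found above k, and y of the edges leaving them are
    pending: their heads are independent and uniform on {1, ..., k}. If z of
    the y heads are equal to k, then z pending edges disappear, and if z > 0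
    then k is one more descendant and its d edges become pending. *)
Definition step k phi x y : R :=
  binexp k%:R^-1 y (fun z => phi (x + (0 < z)%N)%N (y - z + d * (0 < z)%N)%N).

Fixpoint steps l j phi : nat -> nat -> R :=
  if j is j'.+1 then step (l + j'.+1) (steps l j' phi) else phi.

(** Expectation of phi (x, y) after the vertices k, k - 1, ..., l + 1 have
    been treated, as a function of the state before k. *)
Definition chain k l phi := steps l (k - l) phi.

Lemma chain_id k phi : chain k k phi = phi.
Proof. by rewrite /chain subnn. Qed.

Lemma chainS k l phi : (l <= k)%N ->
  chain k.+1 l phi = step k.+1 (chain k l phi).
Proof. by move=> lk; rewrite /chain subSn//= addnS subnKC. Qed.

Lemma chain_comp k j l phi : (l <= j <= k)%N ->
  chain k l phi = chain k j (chain j l phi).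
Proof.
move=> /andP[lj]; elim: k => [|k IH].
  by rewrite leqn0 => /eqP ->; rewrite chain_id.
rewrite leq_eqVlt => /predU1P[->|]; first by rewrite chain_id.
rewrite ltnS => jk; rewrite !chainS// ?IH//; exact: leq_trans jk.
Qed.

Lemma chainSr k l phi : (l < k)%N -> chain k l phi = chain k l.+1 (step l.+1 phi).
Proof.
move=> lk; rewrite (@chain_comp k l.+1 l) ?leqnSn//.
by rewrite (@chainS l l) // chain_id.
Qed.

(** Every discovery removes at least one pending edge and adds d of them, so y
    grows at most by d - 1 when x grows by 1. This invariant of the start (1,
    d) controls y by x. *)
Definition reachable x y := (y <= d.-1 * x + 1)%N.

Lemma reachableS x y z : (z <= y)%N -> reachable x y ->
  reachable (x + (0 < z)%N) (y - z + d * (0 < z)%N).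
Proof.
case: z => [|z] zy; first by rewrite /= muln0 !addn0 subn0.
rewrite /reachable muln1 /= mulnDr muln1.
by case: d d_gt0 => // d' _ /=; lia.
Qed.

Lemma pinv_itv k : 0 <= (k.+1%:R : R)^-1 <= 1.
Proof. by rewrite invr_ge0 ler0n invf_le1 ?ltr0Sn// ler1n. Qed.

Lemma le_step k phi psi x y : reachable x y ->
  (forall x y, reachable x y -> phi x y <= psi x y) ->
  step k.+1 phi x y <= step k.+1 psi x y.
Proof.
move=> xy h; apply: le_binexp; first exact: pinv_itv.
by move=> z zy; apply: h; exact: reachableS.
Qed.

Lemma le_chain k l phi psi x y : reachable x y ->
  (forall x y, reachable x y -> phi x y <= psi x y) ->
  chain k l phi x y <= chain k l psi x y.
Proof.
rewrite /chain; elim: (k - l)%N x y => [|j IH] x y xy h /=; first exact: h.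
by rewrite addnS; apply: le_step => // x' y' xy'; exact: IH.
Qed.

Lemma stepD k phi psi x y :
  step k (fun x y => phi x y + psi x y) x y = step k phi x y + step k psi x y.
Proof. exact: binexpD. Qed.

Lemma stepZ k (a : R) phi x y :
  step k (fun x y => a * phi x y) x y = a * step k phi x y.
Proof. exact: binexpZ. Qed.

Lemma step_cst k (a : R) x y : step k (fun _ _ => a) x y = a.
Proof. exact: binexp_cst. Qed.

Lemma eq_step k phi psi x y : (forall x y, phi x y = psi x y) ->
  step k phi x y = step k psi x y.
Proof. by move=> h; apply: eq_binexp => z _; exact: h. Qed.

Lemma eq_chain k l phi psi x y : (forall x y, phi x y = psi x y) ->
  chain k l phi x y = chain k l psi x y.
Proof.
move=> h; rewrite /chain; elim: (k - l)%N x y => [|j IH] x y //=.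
exact: eq_step.
Qed.

Lemma chainD k l phi psi x y :
  chain k l (fun x y => phi x y + psi x y) x y =
  chain k l phi x y + chain k l psi x y.
Proof.
rewrite /chain; elim: (k - l)%N x y => [//|j IH] x y /=.
by rewrite -stepD; exact: eq_step.
Qed.

Lemma chainZ k l (a : R) phi x y :
  chain k l (fun x y => a * phi x y) x y = a * chain k l phi x y.
Proof.
rewrite /chain; elim: (k - l)%N x y => [//|j IH] x y /=.
by rewrite -stepZ; exact: eq_step.
Qed.

Lemma chain_cst k l (a : R) x y : chain k l (fun _ _ => a) x y = a.
Proof.
rewrite /chain; elim: (k - l)%N x y => [//|j IH] x y /=.
by rewrite -[RHS](step_cst (l + j.+1) a x y); exact: eq_step.
Qed.

Lemma chainB k l phi psi x y :
  chain k l (fun x y => phi x y - psi x y) x y =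
  chain k l phi x y - chain k l psi x y.
Proof.
rewrite -mulN1r -chainZ -chainD; apply: eq_chain => x' y'; ring.
Qed.

Lemma chain_dist k l phi psi eps x y : reachable x y ->
  (forall x y, reachable x y -> `|phi x y - psi x y| <= eps x y) ->
  `|chain k l phi x y - chain k l psi x y| <= chain k l eps x y.
Proof.
move=> xy h; rewrite -chainB ler_norml; apply/andP; split.
  rewrite -mulN1r -chainZ; apply: le_chain => // x' y' /h.
  by rewrite ler_norml mulN1r => /andP[].
by apply: le_chain => // x' y' /h; rewrite ler_norml => /andP[].
Qed.

End Chain.

(** * Elementary inequalities on powers *)

Section PowerBounds.
Variable R : realType.
Implicit Types (p x w lam : R) (n y : nat).

Lemma bernoulli_le p y : 0 <= p <= 1 -> 1 - p * y%:R <= (1 - p) ^+ y.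
Proof.
move=> /andP[p0 p1]; elim: y => [|y IH]; first by rewrite expr0; lra.
rewrite exprS -natr1.
have := ler0n R y; have : 0 <= (1 - p) ^+ y by rewrite exprn_ge0//; lra.
nra.
Qed.

Lemma pow_onem_le p y : 0 <= p <= 1 ->
  (1 - p) ^+ y <= 1 - p * y%:R + (p * y%:R) ^+ 2.
Proof.
move=> /andP[p0 p1]; elim: y => [|y IH]; first by rewrite expr0; lra.
rewrite exprS -natr1.
have := ler0n R y; have : 0 <= (1 - p) ^+ y by rewrite exprn_ge0//; lra.
have : (1 - p) ^+ y <= 1 by rewrite exprn_ile1//; lra.
nra.
Qed.

Lemma bernoulli_ge x n : 0 <= x -> 1 + n%:R * x <= (1 + x) ^+ n.
Proof.
move=> x0; elim: n => [|n IH]; first by rewrite expr0; lra.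
by rewrite exprS -natr1; have := ler0n R n; nra.
Qed.

(** As a function of lam in [0, 1] the left-hand side is convex, so it lies
    below its chord. *)
Lemma pow_chord lam w n : 0 <= lam <= 1 -> 0 <= w ->
  (1 + lam * w) ^+ n <= 1 + lam * ((1 + w) ^+ n - 1).
Proof.
move=> /andP[l0 l1] w0; elim: n => [|n IH]; first by rewrite !expr0; lra.
rewrite !exprS.
have P1 : 1 <= (1 + w) ^+ n by rewrite exprn_ege1//; lra.
set P := (1 + w) ^+ n in IH P1 *; set Q := _ ^+ n in IH *.
have : (1 + lam * w) * Q <= (1 + lam * w) * (1 + lam * (P - 1)).
  by apply: ler_wpM2l => //; nra.
move=> /le_trans; apply.
have : 0 <= (1 - lam) * (lam * (w * (P - 1))).
  by rewrite !mulr_ge0//; lra.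
lra.
Qed.

Lemma pow_exp_diff_le (s : R) a b : 0 <= s <= 1 -> (a <= b)%N ->
  0 <= s ^+ a - s ^+ b <= (1 - s) * (b - a)%:R.
Proof.
move=> /andP[s0 s1] ab; rewrite -(subnKC ab) exprD addKn.
set j := (b - a)%N.
have h : 1 - (1 - s) * j%:R <= s ^+ j.
  have := @bernoulli_le (1 - s) j; rewrite opprB addrCA subrr addr0; apply.
  by apply/andP; split; lra.
have sj1 : s ^+ j <= 1 by rewrite exprn_ile1.
have sa1 : s ^+ a <= 1 by rewrite exprn_ile1.
have sa0 : 0 <= s ^+ a by rewrite exprn_ge0.
by apply/andP; split; nra.
Qed.

(** Each term is at most 1 / k - 1 / (k + 1), and these telescope. *)
Lemma sum_invsq_le (K N : nat) : (0 < K)%N ->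
  \sum_(K <= k < N) (k.+1%:R ^- 2) <= (K%:R^-1 : R).
Proof.
move=> K0; have [KN|NK] := leqP K N; last first.
  by rewrite big_geq ?invr_ge0 1?ltnW.
suff : \sum_(K <= k < N) (k.+1%:R ^- 2) <= (K%:R^-1 - N%:R^-1 : R).
  by move=> /le_trans; apply; rewrite gerBl invr_ge0.
rewrite -[leRHS]opprB -(telescope_sumr (fun k => k%:R^-1))//.
rewrite -sumrN big_nat [leRHS]big_nat.
apply: ler_sum => k /andP[Kk _].
have k0 : (0 : R) < k%:R by rewrite ltr0n (leq_trans K0).
rewrite -natr1; set x := k%:R in k0 *.
rewrite opprB -subr_ge0.
have -> : x^-1 - (x + 1)^-1 - (x + 1) ^- 2 = (x * (x + 1) ^+ 2)^-1.
  by field; rewrite !gt_eqF//; lra.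
by rewrite invr_ge0 mulr_ge0// ?exprn_ge0//; lra.
Qed.

End PowerBounds.

(** * Moments of the chain *)

Section Moments.
Variables (R : realType) (d : nat).
Hypothesis d_gt1 : (1 < d)%N.
Let d_gt0 : (0 < d)%N := ltnW d_gt1.
Local Notation chain := (@chain R d).
Local Notation step := (@step R d).
Local Notation D := d.-1.

Lemma binexp_hit_le (k y : nat) :
  0 <= 1 - (1 - k.+1%:R^-1 : R) ^+ y <= k.+1%:R^-1 * y%:R.
Proof.
have := bernoulli_le y (pinv_itv R k); have := pinv_itv R k.
move: (k.+1%:R^-1) => p /andP[p0 p1] h.
have : (1 - p) ^+ y <= 1 by rewrite exprn_ile1//; lra.
by move=> ?; apply/andP; split; lra.
Qed.

(** The rising factorial replaces the power (x + 1) ^+ r because its increment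
    in x is exactly r / (x + 1) times itself. *)
Definition rising r x : R := \prod_(i < r) (x + 1 + i)%:R.

Lemma rising_gt0 r x : 0 < rising r x.
Proof. by rewrite prodr_gt0// => i _; rewrite ltr0n addn1. Qed.

Lemma rising_step r x :
  (x + 1)%:R * (rising r x.+1 - rising r x) = r%:R * rising r x.
Proof.
suff : (x + 1)%:R * rising r x.+1 = (x + 1 + r)%:R * rising r x.
  by move=> h; rewrite mulrBr h natrD; ring.
transitivity (rising r.+1 x); last by rewrite /rising big_ord_recr mulrC.
rewrite /rising big_ord_recl addn0; congr (_ * _); apply: eq_bigr => i _.
by congr (_%:R); rewrite /= /bump; lia.
Qed.

Lemma pow_le_rising r x : (x + 1)%:R ^+ r <= rising r x.
Proof.
rewrite /rising -[X in _ ^+ X]card_ord -prodr_const.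
by apply: ler_prod => i _; rewrite ler0n ler_nat; lia.
Qed.

Lemma reachable_le x y : reachable d x y -> (y <= D * (x + 1))%N.
Proof. by rewrite /reachable mulnDr; lia. Qed.

(** Vertex k + 1 is found with probability at most y / (k + 1), which is at
    most (d - 1) (x + 1) / (k + 1), and finding it multiplies the rising
    factorial by 1 + r / (x + 1): the factors x + 1 cancel. *)
Lemma step_rising r k x y : reachable d x y ->
  step k.+1 (fun x _ => rising r x) x y <=
  (1 + k.+1%:R^-1) ^+ (r * D) * rising r x.
Proof.
move=> xy.
have -> : step k.+1 (fun x _ => rising r x) x y =
    rising r x + (rising r x.+1 - rising r x) * (1 - (1 - k.+1%:R^-1) ^+ y).
  rewrite -binexp_hit -binexpZ -[X in X + _](binexp_cst k.+1%:R^-1 y) -binexpD.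
  by apply: eq_binexp => -[|z] _ /=; rewrite ?addn0 ?addn1; ring.
have /andP[p0 p1] := pinv_itv R k.
apply: (@le_trans _ _ ((1 + (r * D)%:R * k.+1%:R^-1) * rising r x)); last first.
  by apply: ler_wpM2r; [exact/ltW/rising_gt0|exact: bernoulli_ge].
rewrite [leRHS]mulrDl mul1r lerD2l.
have /andP[_ h] := binexp_hit_le k y.
have hr : 0 <= rising r x.+1 - rising r x.
  rewrite -(@pmulr_rge0 _ (x + 1)%:R); last by rewrite ltr0n addn1.
  rewrite rising_step.
  by rewrite mulr_ge0//; exact/ltW/rising_gt0.
apply: (le_trans (ler_wpM2l hr h)).
apply: (@le_trans _ _ ((rising r x.+1 - rising r x) *
   (k.+1%:R^-1 * (D * (x + 1))%:R))).
  by apply: ler_wpM2l => //; apply: ler_wpM2l => //; rewrite ler_nat reachable_le.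
have -> : (rising r x.+1 - rising r x) * (k.+1%:R^-1 * (D * (x + 1))%:R) =
    k.+1%:R^-1 * D%:R * ((x + 1)%:R * (rising r x.+1 - rising r x)).
  by rewrite natrM; ring.
by rewrite rising_step natrM le_eqVlt; apply/orP; left; apply/eqP; ring.
Qed.

Lemma reachable_start : reachable d 1 d.
Proof. by rewrite /reachable; case: d d_gt0 => //= *; lia. Qed.

(** The growth factors of step_rising telescope to a power of (N + 1) / (k +
    1). *)
Lemma moment_rising r N k : (k <= N)%N ->
  chain N k (fun x _ => rising r x) 1 d <=
  (N.+1%:R / k.+1%:R) ^+ (r * D) * rising r 1.
Proof.
move=> kN; rewrite -(subKn kN); elim: (N - k)%N (leq_subr k N) => {k kN} [|j IH] jN.
  by rewrite subn0 chain_id divff ?pnatr_eq0// expr1n mul1r.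
rewrite chainSr; last by lia.
have -> : (N - j.+1).+1 = (N - j)%N by lia.
apply: (@le_trans _ _ (chain N (N - j) (fun x y =>
    (1 + (N - j)%:R^-1) ^+ (r * D) * rising r x) 1 d)).
  apply: le_chain => //; first exact: reachable_start.
  have [k ->] : exists k, (N - j = k.+1)%N by exists (N - j).-1; lia.
  by move=> x y xy; exact: step_rising.
rewrite chainZ; have {}IH := IH (ltnW jN).
have p0 : 0 <= (1 + (N - j)%:R^-1 : R) ^+ (r * D).
  by rewrite exprn_ge0// addr_ge0// invr_ge0.
apply: (le_trans (ler_wpM2l p0 IH)).
rewrite mulrA -exprMn; apply: ler_wpM2r; first exact/ltW/rising_gt0.
have k0 : (0 : R) < (N - j)%:R by rewrite ltr0n; lia.
rewrite -[(N - j).+1%:R]natr1; set u := (N - j)%:R in k0 *.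
rewrite le_eqVlt; apply/orP; left; apply/eqP; congr (_ ^+ _).
by field; rewrite !gt_eqF//; lra.
Qed.

Definition momc r : R := D%:R ^+ r * rising r 1.

Lemma momc_ge0 r : 0 <= momc r.
Proof. by rewrite mulr_ge0 ?exprn_ge0//; exact/ltW/rising_gt0. Qed.

Lemma moment_pending r N k : (k <= N)%N ->
  chain N k (fun _ y => y%:R ^+ r) 1 d <=
  momc r * (N.+1%:R / k.+1%:R) ^+ (r * D).
Proof.
move=> kN; have h0 : (0 : R) <= D%:R ^+ r by rewrite exprn_ge0.
apply: (@le_trans _ _ (chain N k (fun x _ => D%:R ^+ r * rising r x) 1 d)).
  apply: le_chain => //; first exact: reachable_start.
  move=> x y /reachable_le xy; apply: le_trans (ler_wpM2l h0 (pow_le_rising r x)).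
  by rewrite -exprMn -natrM; apply: lerXn2r; rewrite ?nnegrE// ler_nat.
rewrite chainZ; apply: (le_trans (ler_wpM2l h0 (moment_rising r kN))).
by rewrite mulrCA [leLHS]mulrC.
Qed.

Lemma moment_found r N k : (k <= N)%N ->
  chain N k (fun x _ => (x + 1)%:R ^+ r) 1 d <=
  rising r 1 * (N.+1%:R / k.+1%:R) ^+ (r * D).
Proof.
move=> kN; rewrite mulrC; apply: le_trans (moment_rising r kN).
apply: le_chain => //; first exact: reachable_start.
by move=> x y _; exact: pow_le_rising.
Qed.

(** The errors of a one-step approximation add up along the chain, each one
    averaged over the state in which it is made. *)
Lemma chain_telescope K N (phi eps : nat -> nat -> nat -> R) x y :
  (K <= N)%N -> reachable d x y ->
  (forall k x y, (K <= k < N)%N -> reachable d x y ->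
     `|step k.+1 (phi k) x y - phi k.+1 x y| <= eps k.+1 x y) ->
  `|chain N K (phi K) x y - phi N x y| <=
  \sum_(K <= k < N) chain N k.+1 (eps k.+1) x y.
Proof.
move=> KN xy h; rewrite -(subKn KN).
have : forall j, (j <= N - K)%N ->
    `|chain N (N - j) (phi (N - j)%N) x y - phi N x y| <=
    \sum_(N - j <= k < N) chain N k.+1 (eps k.+1) x y; last first.
  by move=> /(_ _ (leqnn _)).
elim=> [|j IH] jN; first by rewrite subn0 chain_id subrr normr0 big_geq.
rewrite big_ltn; last by lia.
have e : (N - j.+1).+1 = (N - j)%N by lia.
rewrite chainSr ?e; last by lia.
set A := chain _ _ _ _ _; set B := phi N x y.
have -> : A - B = (A - chain N (N - j) (phi (N - j)%N) x y) +
   (chain N (N - j) (phi (N - j)%N) x y - B) by ring.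
apply: (le_trans (ler_normD _ _)); apply: lerD; last by apply: IH; lia.
apply: chain_dist => // x' y' x'y'; rewrite -e; apply: h => //; lia.
Qed.

End Moments.

(** * The branching phase *)

Section Yule.
Variables (R : realType) (d : nat).
Hypothesis d_gt1 : (1 < d)%N.
Let d_gt0 : (0 < d)%N := ltnW d_gt1.
Local Notation chain := (@chain R d).
Local Notation step := (@step R d).
Local Notation D := d.-1.
Implicit Types (s : R).

(** If pending edges never met, each of them would independently end at k + 1
    with probability 1 / (k + 1) and be replaced by d edges, so that the mean
    of s ^+ y would be nextw k s ^+ y. *)
Definition nextw k s := s * (1 - (1 - s ^+ D) * k.+1%:R^-1).

(** The comparison with independent splitting fails only if two edges end at
    the same vertex, hence the square. The factor 1 - s is essential, as s
    will be close to 1 when y is large. *)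
Lemma step_pow k x y s : 0 <= s <= 1 ->
  `|step k.+1 (fun _ y => s ^+ y) x y - nextw k s ^+ y| <=
  (2 * d%:R) * (1 - s) * (k.+1%:R^-1 * y%:R) ^+ 2.
Proof.
move=> s01; have /andP[s0 s1] := s01; have p01 := pinv_itv R k.
rewrite /step /nextw; move: (k.+1%:R^-1) p01 => p p01.
have /andP[p0 p1] := p01.
set a := 1 - s ^+ D.
have /andP[a0 aD] : 0 <= a <= D%:R * (1 - s).
  by have := pow_exp_diff_le s01 (leq0n D); rewrite expr0 subn0 mulrC.
have a1 : a <= 1 by rewrite gerBl exprn_ge0.
have dD : d%:R = 1 + D%:R :> R by rewrite -(natrD _ 1%N) add1n prednK.
have D0 : 0 <= D%:R :> R by [].
have y0 : 0 <= y%:R :> R by [].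
pose eta := p * y%:R - (1 - (1 - p) ^+ y).
have eta_le : eta <= (p * y%:R) ^+ 2.
  by rewrite /eta; have := pow_onem_le y p01; lra.
have sy0 : 0 <= s ^+ y by rewrite exprn_ge0.
have sy1 : s ^+ y <= 1 by rewrite exprn_ile1.
pose Mn := s ^+ y * (1 - a * (1 - (1 - p) ^+ y)).
have h1 : `|binexp p y (fun z => s ^+ (y - z + d * (0 < z)%N)) - Mn| <=
    (1 - s) * eta.
  have eMn : Mn = binexp p y (fun z => s ^+ y * (1 - a * (0 < z)%N%:R)).
    rewrite binexpZ; congr (_ * _).
    transitivity (binexp p y (fun z => 1 + - a * (0 < z)%N%:R)).
      by rewrite binexpD binexpZ binexp_cst binexp_hit; ring.
    by apply: eq_binexp => z _; ring.
  have ee : (1 - s) * eta = binexp p y (fun z => (1 - s) * (z%:R - (0 < z)%N%:R)).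
    rewrite binexpZ; congr (_ * _).
    transitivity (binexp p y (fun z => z%:R + -1 * (0 < z)%N%:R)).
      by rewrite binexpD binexpZ binexp_id binexp_hit /eta; ring.
    by apply: eq_binexp => z _; ring.
  have pw z : (z <= y)%N ->
      `|s ^+ (y - z + d * (0 < z)%N) - s ^+ y * (1 - a * (0 < z)%N%:R)| <=
      (1 - s) * (z%:R - (0 < z)%N%:R).
    case: z => [|z] zy.
      by rewrite muln0 addn0 subn0 mulr0 !subr0 mulr1 subrr normr0 mulr0.
    rewrite muln1 mulr1 /a opprB addrCA subrr addr0 -exprD -natr1 addrK.
    have -> : (y + D = (y - z.+1 + d) + z)%N by lia.
    have := pow_exp_diff_le s01 (leq_addr z (y - z.+1 + d)).
    by rewrite addKn => /andP[u v]; rewrite ger0_norm.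
  by rewrite eMn ee; exact: binexp_dist.
have ap01 : 0 <= a * p <= 1 by apply/andP; split; nra.
have h2 : `|Mn - (s * (1 - a * p)) ^+ y| <= 2 * a * (p * y%:R) ^+ 2.
  rewrite exprMn -mulrBr normrM ger0_norm//.
  apply: le_trans (ler_piMl _ sy1) _; first exact: normr_ge0.
  have l1 := bernoulli_le y ap01; have l2 := pow_onem_le y ap01.
  have eta0 : 0 <= eta by rewrite /eta; have := bernoulli_le y p01; lra.
  have q0 : 0 <= (p * y%:R) ^+ 2 by rewrite sqr_ge0.
  have e1 : (a * p * y%:R) ^+ 2 = a * a * (p * y%:R) ^+ 2 by ring.
  have e2 : a * p * y%:R = a * (p * y%:R) by ring.
  have e3 : 1 - (1 - p) ^+ y = p * y%:R - eta by rewrite /eta; ring.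
  rewrite e1 e2 in l2; rewrite e2 in l1; rewrite e3.
  move: (p * y%:R) eta_le eta0 q0 l1 l2 => w.
  move: (w ^+ 2) ((1 - a * p) ^+ y) => q Q eta_le eta0 q0 l1 l2.
  have f1 : 0 <= a * (q - eta) by rewrite mulr_ge0//; lra.
  have f4 : 0 <= a * q by rewrite mulr_ge0.
  have f2 : 0 <= a * eta by rewrite mulr_ge0.
  have f3 : 0 <= a * (1 - a) * q by rewrite !mulr_ge0//; lra.
  by rewrite ler_norml; apply/andP; split; lra.
set A := binexp _ _ _ in h1 *; set B := (s * _) ^+ y in h2 *.
have -> : A - B = (A - Mn) + (Mn - B) by ring.
apply: (le_trans (ler_normD _ _)); apply: (le_trans (lerD h1 h2)).
have q0 : 0 <= (p * y%:R) ^+ 2 by rewrite sqr_ge0.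
rewrite dD; move: ((p * y%:R) ^+ 2) eta_le q0 => q eta_le q0.
have l1 : (1 - s) * eta <= (1 - s) * q by apply: ler_wpM2l => //; lra.
have l2 : 2 * a * q <= 2 * (D%:R * (1 - s)) * q.
  by apply: ler_wpM2r => //; lra.
have : 0 <= (1 - s) * q by rewrite mulr_ge0//; lra.
by move=> ?; apply: le_trans (lerD l1 l2) _; lra.
Qed.

Fixpoint wt K s j := if j is j'.+1 then nextw (K + j') (wt K s j') else s.

Lemma nextw_itv k s : 0 < s <= 1 -> 0 < nextw k s <= 1.
Proof.
move=> /andP[s0 s1]; rewrite /nextw; have /andP[p0 p1] := pinv_itv R k.
move: (k.+1%:R^-1) p0 p1 => p p0 p1.
have u0 : 0 < s ^+ D by rewrite exprn_gt0.
have u1 : s ^+ D <= 1 by rewrite exprn_ile1// ltW.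
move: (s ^+ D) u0 u1 => u u0 u1.
have w0 : u <= 1 - (1 - u) * p by nra.
have w1 : 1 - (1 - u) * p <= 1 by nra.
move: (1 - _) w0 w1 => w w0 w1.
by apply/andP; split; nra.
Qed.

Lemma wt_itv K s j : 0 < s <= 1 -> 0 < wt K s j <= 1.
Proof. by move=> s01; elim: j => //= j; exact: nextw_itv. Qed.

(** In this coordinate the recursion nextw is almost linear: for the
    corresponding differential equation s' = - s (1 - s^(d-1)) / k, the
    quantity s^-(d-1) - 1 is proportional to k^(d-1). *)
Definition odds s := s ^- D - 1.

(** The bound by a linear map comes from the convexity inequality pow_chord,
    with 1 - s^(d-1) as the interpolation parameter. *)
Lemma odds_nextw_le k s : (0 < k)%N -> 0 < s <= 1 ->
  odds (nextw k s) <= (k.+1%:R / k%:R) ^+ D * odds s.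
Proof.
move=> k0 /andP[s0 s1]; rewrite /odds /nextw.
set q := s ^+ D.
have q0 : 0 < q by rewrite exprn_gt0.
have q1 : q <= 1 by rewrite exprn_ile1// ltW.
have k0' : (0 : R) < k%:R by rewrite ltr0n.
rewrite -[in k.+1%:R]addn1 natrD; move: (k%:R) k0' => u u0.
have c1 : 0 < 1 - (1 - q) * (u + 1)^-1.
  have : (1 - q) * (u + 1)^-1 < 1 by rewrite ltr_pdivrMr; lra.
  lra.
have B0 : 0 < 1 + (1 - q) * u^-1.
  by rewrite ltr_wpDr// mulr_ge0 ?invr_ge0//; lra.
have h1 : (1 - (1 - q) * (u + 1)^-1)^-1 <= 1 + (1 - q) * u^-1.
  rewrite -[leRHS]invrK lef_pV2 ?posrE ?invr_gt0//.
  have -> : (1 + (1 - q) * u^-1)^-1 = u / (u + (1 - q)).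
    by field; rewrite !gt_eqF//; lra.
  have -> : 1 - (1 - q) * (u + 1)^-1 = (u + q) / (u + 1) by field; rewrite gt_eqF//; lra.
  rewrite ler_pdivrMr; last lra.
  rewrite mulrAC ler_pdivlMr; last lra.
  nra.
have h2 : ((1 - (1 - q) * (u + 1)^-1) ^+ D)^-1 <= 1 + (1 - q) * ((1 + u^-1) ^+ D - 1).
  have l01 : 0 <= 1 - q <= 1 by apply/andP; split; lra.
  have iu0 : 0 <= u^-1 by rewrite invr_ge0 ltW.
  rewrite -exprVn; apply: le_trans (pow_chord D l01 iu0).
  by apply: lerXn2r => //; rewrite nnegrE ?invr_ge0; exact: ltW.
rewrite exprMn invfM -/q.
have -> : (u + 1) / u = 1 + u^-1 by field; rewrite gt_eqF.
have iq : 0 <= q^-1 by rewrite invr_ge0 ltW.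
have := ler_wpM2l iq h2; set W := (1 + u^-1) ^+ D.
have -> : q^-1 * (1 + (1 - q) * (W - 1)) = W * (q^-1 - 1) + 1 by field; rewrite gt_eqF.
lra.
Qed.

Lemma odds_nextw_ge k s : 0 < s <= 1 ->
  ((k.+1 + D)%:R / (k + D)%:R) ^+ D * odds s <= odds (nextw k s).
Proof.
move=> /andP[s0 s1]; rewrite /odds /nextw.
set q := s ^+ D.
have q0 : 0 < q by rewrite exprn_gt0.
have q1 : q <= 1 by rewrite exprn_ile1// ltW.
have D1 : 1 <= D%:R :> R by rewrite ler1n; case: d d_gt1 => [|[]].
have h3 : ((k.+1 + D)%:R / (k + D)%:R) ^+ D <= 1 + D%:R / k.+1%:R :> R.
  have := bernoulli_le D (pinv_itv R (k + D)).
  rewrite addSn -[(k + D).+1%:R]natr1 -[k.+1%:R]natr1 natrD => h.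
  have u0 : (0 : R) <= k%:R by [].
  move: (k%:R) (D%:R) u0 D1 h => u v u0 v1 h.
  have -> : (u + v + 1) / (u + v) = (1 - (u + v + 1)^-1)^-1.
    by field; rewrite !gt_eqF//; lra.
  rewrite exprVn -[leRHS]invrK lef_pV2 ?posrE; last 2 first.
  - rewrite exprn_gt0// subr_gt0 invf_lt1; lra.
  - by rewrite invr_gt0 ltr_pwDl// divr_ge0; lra.
  apply: le_trans h; rewrite le_eqVlt; apply/orP; left; apply/eqP.
  by field; rewrite !gt_eqF//; lra.
have o0 : 0 <= q^-1 - 1 by rewrite subr_ge0 invf_ge1.
apply: (le_trans (ler_wpM2r o0 h3)).
rewrite exprMn invfM -/q.
have [p0 p1] : 0 <= k.+1%:R^-1 :> R /\ k.+1%:R^-1 <= 1 :> R.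
  by have /andP[] := pinv_itv R k.
move: (k.+1%:R^-1) p0 p1 => p p0 p1.
have w1 : 0 < 1 - (1 - q) * p by nra.
have h4 : 1 + D%:R * ((1 - q) * p) <= ((1 - (1 - q) * p) ^+ D)^-1.
  have x0 : 0 <= (1 - (1 - q) * p)^-1 - 1.
    by rewrite subr_ge0 invf_ge1//; nra.
  have := bernoulli_ge D x0; rewrite [1 + (_ - 1)]addrC subrK exprVn.
  apply: le_trans; rewrite lerD2l; apply: ler_wpM2l; first lra.
  rewrite lerBrDl -(ler_pM2r w1) mulVf ?gt_eqF//.
  have : 0 <= ((1 - q) * p) ^+ 2 by rewrite sqr_ge0.
  lra.
have iq : 0 <= q^-1 by rewrite invr_ge0 ltW.
rewrite lerBrDr; apply: le_trans (ler_wpM2l iq h4).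
rewrite le_eqVlt; apply/orP; left; apply/eqP; field; rewrite gt_eqF//.
Qed.

Lemma odds_ge0 s : 0 < s <= 1 -> 0 <= odds s.
Proof.
move=> /andP[s0 s1]; rewrite subr_ge0 -exprVn exprn_ege1//.
by rewrite invf_ge1.
Qed.

Lemma odds_wt_le K s j : (0 < K)%N -> 0 < s <= 1 ->
  odds (wt K s j) <= ((K + j)%:R / K%:R) ^+ D * odds s.
Proof.
move=> K0 s01; elim: j => [|j IH] /=.
  by rewrite addn0 divff ?expr1n ?mul1r// pnatr_eq0 -lt0n.
have Kj : (0 < K + j)%N by rewrite addn_gt0 K0.
apply: (le_trans (odds_nextw_le Kj (wt_itv K j s01))).
rewrite addnS; set u := (K + j).+1%:R.
have h0 : 0 <= (u / (K + j)%:R) ^+ D by rewrite exprn_ge0// divr_ge0.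
apply: le_trans (ler_wpM2l h0 IH) _.
rewrite mulrA -exprMn mulrA divfK// pnatr_eq0 -lt0n//.
Qed.

Lemma odds_wt_ge K s j : (0 < K)%N -> 0 < s <= 1 ->
  ((K + j + D)%:R / (K + D)%:R) ^+ D * odds s <= odds (wt K s j).
Proof.
move=> K0 s01; elim: j => [|j IH] /=.
  rewrite addn0 divff ?expr1n ?mul1r// pnatr_eq0 -lt0n addn_gt0 K0//.
apply: le_trans (odds_nextw_ge (K + j) (wt_itv K j s01)).
rewrite addnS; set u := ((K + j).+1 + D)%:R.
have h0 : 0 <= (u / (K + j + D)%:R) ^+ D by rewrite exprn_ge0// divr_ge0.
apply: le_trans (ler_wpM2l h0 IH).
by rewrite mulrA -exprMn mulrA divfK// pnatr_eq0 -lt0n !addn_gt0 K0.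
Qed.

Lemma onem_le_odds s : 0 < s <= 1 -> 1 - s <= odds s.
Proof.
move=> /andP[s0 s1]; rewrite /odds.
have D1 : (0 < D)%N by case: d d_gt1 => [|[]].
have h : s^-1 <= s ^- D.
  rewrite lef_pV2 ?posrE ?exprn_gt0//; case: D D1 => // n _.
  by rewrite exprS ler_piMr ?exprn_ile1// ltW.
apply: (@le_trans _ _ (s^-1 - 1)); last by rewrite lerD2r.
rewrite -subr_ge0 (_ : _ - _ = (1 - s) ^+ 2 / s); last by field; rewrite gt_eqF.
by rewrite divr_ge0 ?sqr_ge0// ltW.
Qed.

(** The collision errors of step_pow, with the second moment of y taken from
    moment_pending, are summed by chain_telescope. *)
Lemma chain_pow K N s : (0 < K <= N)%N -> 0 < s <= 1 ->
  `|chain N K (fun _ y => s ^+ y) 1 d - wt K s (N - K) ^+ d| <=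
  (2 * d%:R * momc R d 2) * odds s * N.+1%:R ^+ (2 * D) / K%:R ^+ (2 * D).+1.
Proof.
move=> /andP[K0 KN] s01.
(* The weight is transported from K up to k, so that phi K is the function to
   average and phi N 1 d is its approximation. *)
pose phi k (x y : nat) := wt K s (k - K) ^+ y.
pose eps k (x y : nat) : R :=
  (2 * d%:R) * (1 - wt K s (k.-1 - K)) * (k%:R^-1 * y%:R) ^+ 2.
have -> : chain N K (fun _ y => s ^+ y) 1 d = chain N K (phi K) 1 d.
  by apply: eq_chain => x y; rewrite /phi subnn.
have xy0 := reachable_start d_gt1.
apply: le_trans (chain_telescope d_gt1 (eps := eps) KN xy0 _) _.
  move=> k x y /andP[Kk kN] xy; rewrite /phi /eps subSn//= subnKC//.
  by apply: step_pow; have /andP[w0 w1] := wt_itv K (k - K) s01; rewrite ltW.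
have K0' : (0 : R) < K%:R by rewrite ltr0n.
have m0 := momc_ge0 R d 2.
have o0 := odds_ge0 s01.
set C := 2 * d%:R * momc R d 2 * odds s * N.+1%:R ^+ (2 * D) / K%:R ^+ (2 * D).
have C0 : 0 <= C.
  by rewrite /C; nneg.
apply: (@le_trans _ _ (\sum_(K <= k < N) C * k.+1%:R ^- 2)); last first.
  rewrite -mulr_sumr.
  have hs := ler_wpM2l C0 (@sum_invsq_le R K N K0); apply: (le_trans hs).
  by rewrite /C [K%:R ^+ _.+1]exprSr invfM !mulrA.
rewrite big_nat [leRHS]big_nat; apply: ler_sum => k /andP[Kk kN].
rewrite /eps /=; set w := wt _ _ _.
have w01 : 0 < w <= 1 by exact: wt_itv.
have k0 : (0 : R) < k.+1%:R by rewrite ltr0n.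
have -> : chain N k.+1 (fun _ y => 2 * d%:R * (1 - w) * (k.+1%:R^-1 * y%:R) ^+ 2) 1 d
   = 2 * d%:R * (1 - w) * k.+1%:R ^- 2 * chain N k.+1 (fun _ y => y%:R ^+ 2) 1 d.
  by rewrite -chainZ; apply: eq_chain => x y; rewrite exprMn exprVn mulrA.
have hw : 1 - w <= (k.+1%:R / K%:R) ^+ D * odds s.
  apply: (le_trans (onem_le_odds w01)); apply: (le_trans (odds_wt_le _ K0 s01)).
  apply: ler_wpM2r => //; apply: lerXn2r; rewrite ?nnegrE ?divr_ge0//.
  by rewrite ler_pM2r ?invr_gt0// subnKC// ler_nat.
have hm : chain N k.+1 (fun _ y => y%:R ^+ 2) 1 d <=
    momc R d 2 * (N.+1%:R / k.+1%:R) ^+ (2 * D).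
  have hmp := @moment_pending R d d_gt1 2 _ _ kN.
  apply: (le_trans hmp); apply: ler_wpM2l => //.
  apply: lerXn2r; rewrite ?nnegrE ?divr_ge0//.
  by rewrite ler_pM2l ?ltr0n// lef_pV2 ?posrE ?ltr0n// ler_nat.
have mch0 : 0 <= chain N k.+1 (fun _ y => y%:R ^+ 2) 1 d.
  rewrite -(chain_cst d N k.+1 0 1 d); apply: le_chain => // x y _; nneg.
have w10 : 0 <= 1 - w by rewrite subr_ge0; case/andP: w01.
have i2 : 0 <= k.+1%:R ^- 2 :> R by rewrite invr_ge0 exprn_ge0.
apply: (@le_trans _ _ (2 * d%:R * ((k.+1%:R / K%:R) ^+ D * odds s) *
   k.+1%:R ^- 2 * (momc R d 2 * (N.+1%:R / k.+1%:R) ^+ (2 * D)))).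
  apply: ler_pM => //; [by nneg|].
  by apply: ler_wpM2r => //; apply: ler_wpM2l => //; rewrite mulr_ge0.
have hk : K%:R ^+ D <= k.+1%:R ^+ D :> R.
  by apply: lerXn2r; rewrite ?nnegrE// ler_nat; exact: leqW.
have KD : 0 < K%:R ^+ D :> R by rewrite exprn_gt0.
have kD : 0 < k.+1%:R ^+ D :> R by rewrite exprn_gt0.
rewrite /C !exprMn !exprVn mul2n -addnn !exprD.
have c0 : 0 <= N.+1%:R ^+ D :> R by rewrite exprn_ge0.
move: (K%:R ^+ D) (k.+1%:R ^+ D) (N.+1%:R ^+ D) (k.+1%:R ^- 2) hk KD kD i2 c0 => a b c e ab a0 b0 e0 c0.
have -> : 2 * d%:R * (b / a * odds s) * e * (momc R d 2 * (c * c * (b * b)^-1)) =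
   (2 * d%:R * momc R d 2 * odds s * (c * c) * e / a) * b^-1.
  by field; rewrite !gt_eqF.
have -> : 2 * d%:R * momc R d 2 * odds s * (c * c) / (a * a) * e =
   (2 * d%:R * momc R d 2 * odds s * (c * c) * e / a) * a^-1.
  by field; rewrite !gt_eqF.
apply: ler_wpM2l; last by rewrite lef_pV2 ?posrE.
by nneg.
Qed.

End Yule.

(** * The fluid phase *)

Section Fluid.
Variables (R : realType) (d : nat).
Hypothesis d_gt1 : (1 < d)%N.
Let d_gt0 : (0 < d)%N := ltnW d_gt1.
Local Notation chain := (@chain R d).
Local Notation step := (@step R d).
Local Notation D := d.-1.
Implicit Types (C : R) (k : nat).

(** The solutions of u' = - d (1 - exp (- u)) / k. This is the law of large
    numbers for u = y / k: about u of the pending edges end at k, and k is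
    found with probability 1 - exp (- u). The constant of integration is C. *)
Definition fluid C k : R := ln (1 + C / k%:R ^+ d).
(** The value of 1 - exp (- u) along the fluid solution, that is, the
    probability that k is found. *)
Definition fluid_rate C k : R := C / (k%:R ^+ d + C).

Lemma ln1D_le (t : R) : 0 <= t -> ln (1 + t) <= t.
Proof.
move=> t0; rewrite -[leRHS]expRK ler_ln ?posrE ?expR_gt0//; last lra.
exact: expR_ge1Dx.
Qed.

Lemma ln1D_ge (t : R) : 0 <= t -> t - t ^+ 2 <= ln (1 + t).
Proof.
move=> t0; have := expR_ge1Dx (- ln (1 + t)).
rewrite expRN lnK ?posrE; last lra.
have : (1 + t)^-1 <= 1 - t + t ^+ 2.
  have t1 : 0 < 1 + t by lra.
  rewrite -(ler_pM2r t1) mulVf ?gt_eqF//.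
  have : 0 <= t ^+ 3 by rewrite exprn_ge0.
  rewrite !exprS expr0; lra.
lra.
Qed.

Lemma pow1D_le (h : R) n : 0 <= h <= 1 ->
  (1 + h) ^+ n <= 1 + n%:R * h + 3 ^+ n * h ^+ 2.
Proof.
move=> /andP[h0 h1]; elim: n => [|n IH].
  by rewrite !expr0 mul0r; have := sqr_ge0 h; lra.
have n3 : n%:R <= 3 ^+ n :> R.
  by rewrite -natrX ler_nat ltnW// ltn_expl.
rewrite !exprS -natr1; move: (3 ^+ n) (n%:R) ((1 + h) ^+ n) IH n3 (ler0n R n).
move=> a b c IH ab b0.
have h20 : 0 <= h ^+ 2 by rewrite sqr_ge0.
have : (1 + h) * c <= (1 + h) * (1 + b * h + a * h ^+ 2) by apply: ler_wpM2l => //; lra.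
move=> /le_trans; apply.
have : 0 <= a * h ^+ 2 * (1 - h) by rewrite !mulr_ge0//; lra.
have : 0 <= (a - b) * h ^+ 2 by rewrite mulr_ge0//; lra.
rewrite expr0 mulr1; lra.
Qed.

Lemma fluid_rate_itv C k : 0 <= C -> (0 < k)%N -> 0 <= fluid_rate C k <= 1.
Proof.
move=> C0 k0; have k0' : 0 < k%:R ^+ d :> R by rewrite exprn_gt0// ltr0n.
rewrite /fluid_rate divr_ge0//=; last lra.
by rewrite ler_pdivrMr; lra.
Qed.

Lemma expRN_fluid C k : 0 <= C -> (0 < k)%N ->
  expR (- fluid C k) = 1 - fluid_rate C k.
Proof.
move=> C0 k0; have k0' : 0 < k%:R ^+ d :> R by rewrite exprn_gt0// ltr0n.
have p0 : 0 < 1 + C / k%:R ^+ d by rewrite ltr_pwDl// divr_ge0// ltW.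
rewrite /fluid expRN lnK ?posrE// /fluid_rate.
by field; rewrite !gt_eqF//; lra.
Qed.

Lemma fluid_ge0 C k : 0 <= C -> 0 <= fluid C k.
Proof.
by move=> C0; rewrite ln_ge0// lerDl divr_ge0// exprn_ge0.
Qed.

Definition slopec : R := 2 * 3 ^+ d.
Definition curvec : R := slopec ^+ 2.

(** One Euler step of the differential equation, with its second-order error.
    *)
Lemma fluid_step C k : 0 <= C -> (0 < k)%N ->
  `|fluid C k - fluid C k.+1 - d%:R * fluid_rate C k.+1 * k%:R^-1| <=
    curvec * k%:R ^- 2 /\
  0 <= fluid C k - fluid C k.+1 <= slopec * k%:R^-1.
Proof.
move=> C0 k0; have k0' : 0 < k%:R :> R by rewrite ltr0n.
have h01 : 0 <= (k%:R^-1 : R) <= 1.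
  by rewrite invr_ge0 ler0n invf_le1// ler1n.
have /andP[a0 a1] := @fluid_rate_itv C k.+1 C0 isT.
set a := fluid_rate C k.+1 in a0 a1 *.
set t := a * ((1 + k%:R^-1) ^+ d - 1).
have kd : 0 < k%:R ^+ d :> R by rewrite exprn_gt0.
have kd1 : 0 < k.+1%:R ^+ d :> R by rewrite exprn_gt0.
have -> : fluid C k - fluid C k.+1 = ln (1 + t).
  have p1 : 0 < 1 + C / k.+1%:R ^+ d by rewrite ltr_pwDl// divr_ge0// ltW.
  have p0 : 0 < 1 + C / k%:R ^+ d by rewrite ltr_pwDl// divr_ge0// ltW.
  rewrite /fluid -ln_div ?posrE//; congr ln; rewrite /t.
  have -> : 1 + k%:R^-1 = k.+1%:R / k%:R :> R.
    by rewrite -natr1; field; rewrite gt_eqF.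
  rewrite /a /fluid_rate exprMn exprVn; field.
  by rewrite !gt_eqF//; lra.
have := bernoulli_ge d (proj1 (andP h01)); have := pow1D_le d h01.
have d3 : d%:R <= 3 ^+ d :> R by rewrite -natrX ler_nat ltnW// ltn_expl.
rewrite -exprVn; move: (k%:R^-1) h01 @t => h /andP[h0 h1] t w1 w2.
have h20 : 0 <= h ^+ 2 by rewrite sqr_ge0.
have h2h : h ^+ 2 <= h by rewrite expr2; nra.
have d0 : 0 <= d%:R :> R by [].
have t_ge : a * (d%:R * h) <= t by rewrite /t; apply: ler_wpM2l => //; lra.
have t_le : t <= a * (d%:R * h + 3 ^+ d * h ^+ 2).
  by rewrite /t; apply: ler_wpM2l => //; lra.
have t_le1 : a * (d%:R * h + 3 ^+ d * h ^+ 2) <= a * (d%:R * h) + 3 ^+ d * h ^+ 2.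
  rewrite mulrDr lerD2l; apply: ler_piMl => //; nneg.
have t0 : 0 <= t by apply: le_trans t_ge; nneg.
have t_les : t <= slopec * h.
  rewrite /slopec; apply: (le_trans t_le); apply: (@le_trans _ _ (d%:R * h + 3 ^+ d * h ^+ 2)).
    by apply: ler_piMl => //; nneg.
  have : d%:R * h <= 3 ^+ d * h by apply: ler_wpM2r.
  have : 3 ^+ d * h ^+ 2 <= 3 ^+ d * h by apply: ler_wpM2l => //; nneg.
  lra.
have l1 := ln1D_le t0; have l2 := ln1D_ge t0.
have t2 : t ^+ 2 <= curvec * h ^+ 2.
  rewrite /curvec -exprMn; apply: lerXn2r; rewrite ?nnegrE//.
  by apply: le_trans t_les.
have c3 : 3 ^+ d * h ^+ 2 <= curvec * h ^+ 2.
  apply: ler_wpM2r => //; rewrite /curvec /slopec.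
  have : 1 <= 3 ^+ d :> R by rewrite exprn_ege1//; lra.
  by move: (3 ^+ d) => q q1; rewrite expr2; nra.
split.
  rewrite mulrAC -mulrA [h * a]mulrC mulrCA.
  by rewrite ler_norml; apply/andP; split; lra.
apply/andP; split; last exact: le_trans l1 t_les.
by rewrite ln_ge0//; lra.
Qed.

(** Poisson approximation of the probability that no pending edge ends at k +
    1. *)
Lemma miss_prob k y (u := k.+1%:R^-1 * y%:R : R) : (0 < k)%N ->
  0 <= expR (- u) - (1 - k.+1%:R^-1) ^+ y <= u * k%:R^-1.
Proof.
move=> k0; have k0' : 0 < k%:R :> R by rewrite ltr0n.
have u0 : 0 <= u by rewrite mulr_ge0.
have [p0 p1] : 0 <= k.+1%:R^-1 :> R /\ k.+1%:R^-1 <= 1 :> R.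
  by have /andP[] := pinv_itv R k.
have q0 : 0 <= 1 - k.+1%:R^-1 :> R by rewrite subr_ge0.
apply/andP; split.
  rewrite subr_ge0 /u -mulNr expRM_natr; apply: lerXn2r; rewrite ?nnegrE ?expR_ge0//.
  exact: expR_ge1Dx.
have h1 : expR (- (u + u * k%:R^-1)) <= (1 - k.+1%:R^-1) ^+ y.
  have -> : - (u + u * k%:R^-1) = - k%:R^-1 * y%:R.
    by rewrite /u -natr1; field; rewrite !gt_eqF//; lra.
  rewrite expRM_natr; apply: lerXn2r; rewrite ?nnegrE ?expR_ge0//.
  rewrite expRN -[leRHS]invrK lef_pV2 ?posrE ?expR_gt0 ?invr_gt0//; last first.
    rewrite subr_gt0 invf_lt1// ?ltr1n//.
  apply: le_trans (expR_ge1Dx _); rewrite -natr1 le_eqVlt; apply/orP; left; apply/eqP.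
  by field; rewrite !gt_eqF//; lra.
have h2 : expR (- u) - expR (- (u + u * k%:R^-1)) <= u * k%:R^-1.
  rewrite opprD expRD -[X in X - _]mulr1 -mulrBr.
  have x0 : 0 <= u * k%:R^-1 by rewrite mulr_ge0// invr_ge0.
  have := expR_ge1Dx (- (u * k%:R^-1)).
  have : 0 <= expR (- u) <= 1 by rewrite expR_ge0 expR_le1 oppr_le0.
  have : expR (- (u * k%:R^-1)) <= 1 by rewrite expR_le1 oppr_le0.
  move: (expR (- u)) (u / k%:R) x0 (expR _) => A x x0 B B1 /andP[A0 A1] Bx; nra.
lra.
Qed.

Lemma expRN_lip (u v : R) : 0 <= u -> 0 <= v ->
  `|expR (- u) - expR (- v)| <= `|u - v|.
Proof.
wlog uv : u v / u <= v => [H|u0 v0].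
  have [uv|vu] := leP u v; first exact: H.
  by move=> u0 v0; rewrite distrC [leRHS]distrC; apply: H => //; exact: ltW.
have e : expR (- v) = expR (- u) * expR (- (v - u)).
  by rewrite -expRD; congr expR; ring.
rewrite [leRHS]distrC ger0_norm ?subr_ge0 ?ler_expR ?lerN2//.
rewrite ger0_norm ?subr_ge0// e.
have := expR_ge1Dx (- (v - u)).
have : 0 <= expR (- u) <= 1 by rewrite expR_ge0 expR_le1 oppr_le0.
have : expR (- (v - u)) <= 1 by rewrite expR_le1 oppr_le0 subr_ge0.
by move: (expR _) (expR _) => B A B1 /andP[A0 A1] h; nra.
Qed.

Lemma hit_rate C k y : 0 <= C -> (0 < k)%N ->
  `|1 - (1 - k.+1%:R^-1) ^+ y - fluid_rate C k.+1| <=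
  `|k.+1%:R^-1 * y%:R - fluid C k.+1| + k.+1%:R^-1 * y%:R * k%:R^-1.
Proof.
move=> C0 k0; have /andP[m0 m1] := miss_prob y k0.
have u0 : 0 <= k.+1%:R^-1 * y%:R :> R by rewrite mulr_ge0.
have := expRN_lip u0 (fluid_ge0 k.+1 C0); rewrite expRN_fluid//.
move: (expR _) (fluid_rate _ _) ((1 - _) ^+ y) m0 m1 => e a q m0 m1 h.
have -> : 1 - q - a = (1 - a - e) + (e - q) by ring.
apply: (le_trans (ler_normD _ _)); rewrite distrC; apply: lerD => //.
by rewrite ger0_norm.
Qed.

Definition noisec : R := 5 * d%:R ^+ 2 + 2 * curvec ^+ 2 + 3 * slopec ^+ 2 + 3.

Lemma noisec_ge0 : 0 <= noisec.
Proof. by rewrite /noisec /curvec /slopec; nneg. Qed.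

(** The drift of y / k depends on y / k in a Lipschitz way, so one vertex
    multiplies the squared distance to the fluid solution by 1 + O(1 / k). The
    variance of y / k and the discretization contribute O(1 / k^2). *)
Lemma step_fluid C k x y : 0 <= C -> (0 < k)%N ->
  step k.+1 (fun _ y => (k%:R^-1 * y%:R - fluid C k) ^+ 2) x y <=
  (1 + (2 * d + 1)%:R * k%:R^-1) * (k.+1%:R^-1 * y%:R - fluid C k.+1) ^+ 2 +
  noisec * (1 + (k.+1%:R^-1 * y%:R) ^+ 2) * k%:R ^- 2.
Proof.
move=> C0 k0; have k0' : 0 < k%:R :> R by rewrite ltr0n.
have [f1 /andP[f2 f3]] := fluid_step C0 k0; have f4 := hit_rate y C0 k0.
have u0 : 0 <= k.+1%:R^-1 * y%:R :> R by rewrite mulr_ge0.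
have h01 : 0 <= (k%:R^-1 : R) <= 1 by rewrite invr_ge0 ler0n invf_le1// ler1n.
have /andP[p0 p1] := pinv_itv R k.
set u := k.+1%:R^-1 * y%:R in f4 u0 *.
set v := fluid C k.+1 in f1 f2 f3 f4 *.
set dl := fluid C k - v in f1 f2 f3.
set a := fluid_rate C k.+1 in f1 f4.
pose G z := k%:R^-1 * (d%:R * (0 < z)%N%:R - (z%:R - u)) - dl.
have -> : step k.+1 (fun _ y => (k%:R^-1 * y%:R - fluid C k) ^+ 2) x y =
    binexp k.+1%:R^-1 y (fun z => (u - v + G z) ^+ 2).
  apply: eq_binexp => z zy; congr (_ ^+ 2).
  rewrite natrD natrM natrB// /G /dl /u -[k.+1%:R]natr1; field.
  by rewrite !gt_eqF//; lra.
apply: (@le_trans _ _ (binexp k.+1%:R^-1 y (fun z => (u - v) ^+ 2 +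
   2 * (u - v) * (k%:R^-1 * d%:R * (0 < z)%N%:R + (- k%:R^-1 * (z%:R - u) - dl)) +
   (3 * k%:R ^- 2 * d%:R ^+ 2 + 3 * k%:R ^- 2 * (z%:R - u) ^+ 2 + 3 * dl ^+ 2)))).
  apply: le_binexp; first exact: pinv_itv.
  move=> z _; rewrite /G -exprVn; move: (k%:R^-1) h01 (z%:R - u) => h /andP[h0 h1] w.
  set b := (0 < z)%N%:R.
  have b01 : b ^+ 2 <= 1 by rewrite /b; case: (0 < z)%N; rewrite ?expr1n ?expr0n.
  have q1 := sqr_ge0 (h * d%:R * b + h * w).
  have q2 := sqr_ge0 (h * d%:R * b + dl).
  have q3 := sqr_ge0 (h * w - dl).
  have q4 : 0 <= (h * d%:R) ^+ 2 * (1 - b ^+ 2).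
    by rewrite mulr_ge0 ?sqr_ge0//; lra.
  lra.
rewrite !binexpD !binexp_cst !binexpZ !binexpD !binexpZ !binexp_cst binexp_hit binexp_var.
rewrite binexpB binexp_id binexp_cst -/u subrr expr0n/= addr0 mulr0 add0r.
have var_le : k.+1%:R^-1 * (1 - k.+1%:R^-1) * y%:R <= u.
  by rewrite mulrAC -/u ler_piMr//; lra.
set pi0 := 1 - _ ^+ y in f4 *.
rewrite -exprVn in f1 *.
move: (k%:R^-1) h01 f1 f3 f4 => h /andP[h0 h1] f1 f3 f4.
set e := u - v in f4 *.
have d0 : 0 <= d%:R :> R by [].
have B0 : 0 <= curvec by rewrite /curvec sqr_ge0.
have S0 : 0 <= slopec by rewrite /slopec; nneg.
have drift : `|h * d%:R * pi0 - dl| <= h * d%:R * `|e| + h ^+ 2 * (d%:R * u + curvec).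
  have -> : h * d%:R * pi0 - dl = h * d%:R * (pi0 - a) - (dl - d%:R * a * h) by ring.
  apply: (le_trans (ler_normB _ _)); rewrite normrM (ger0_norm (mulr_ge0 h0 d0)).
  apply: (le_trans (lerD (ler_wpM2l (mulr_ge0 h0 d0) f4) f1)).
  by rewrite le_eqVlt; apply/orP; left; apply/eqP; ring.
have dl2 : dl ^+ 2 <= slopec ^+ 2 * h ^+ 2.
  by rewrite -exprMn; apply: lerXn2r; rewrite ?nnegrE ?mulr_ge0.
have main : 2 * e * (h * d%:R * pi0 - dl) <=
    (2 * d%:R + 1) * h * e ^+ 2 + h ^+ 2 * (d%:R * u + curvec) ^+ 2.
  apply: (@le_trans _ _ (2 * `|e| * `|h * d%:R * pi0 - dl|)).
    by rewrite -!mulrA ler_pM2l// -normrM ler_norm.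
  apply: (@le_trans _ _ (2 * `|e| * (h * d%:R * `|e| + h ^+ 2 * (d%:R * u + curvec)))).
    by apply: ler_wpM2l => //; nneg.
  rewrite -[e ^+ 2]real_normK ?num_real//.
  move: `|e| (normr_ge0 e) (d%:R * u + curvec) => n n0 q.
  have := sqr_ge0 (n - h * q).
  have : 0 <= (1 - h) * (h ^+ 2 * q ^+ 2).
    by apply: mulr_ge0; [lra|apply: mulr_ge0; exact: sqr_ge0].
  move=> g1 g2; have := mulr_ge0 h0 g2; lra.
have h20 : 0 <= h ^+ 2 by rewrite sqr_ge0.
have x1 := ler_wpM2l (mulr_ge0 (ler0n _ 3) h20) var_le.
have x2 : h ^+ 2 * (d%:R * u + curvec) ^+ 2 <=
    h ^+ 2 * (2 * d%:R ^+ 2 * u ^+ 2 + 2 * curvec ^+ 2).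
  by apply: ler_wpM2l => //; have := sqr_ge0 (d%:R * u - curvec); lra.
have x3 : 3 * h ^+ 2 * u <= h ^+ 2 * (3 + 3 * u ^+ 2).
  rewrite mulrAC mulrC; apply: ler_wpM2l => //; have := sqr_ge0 (u - 1); lra.
have x4 : 0 <= h ^+ 2 * (u ^+ 2 * (3 * d%:R ^+ 2 + 2 * curvec ^+ 2 + 3 * slopec ^+ 2)).
  by nneg.
have x5 : 0 <= h ^+ 2 * (2 * d%:R ^+ 2) by nneg.
rewrite /noisec natrD natrM.
move: (k.+1%:R^-1 * (1 - k.+1%:R^-1) * y%:R) x1 var_le => vr x1 var_le.
clearbody e u dl pi0; lra.
Qed.

End Fluid.

(** * Comparison with the fluid solution *)

Section Coupling.
Variables (R : realType) (d : nat).
Hypothesis d_gt1 : (1 < d)%N.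
Let d_gt0 : (0 < d)%N := ltnW d_gt1.
Local Notation chain := (@chain R d).
Local Notation step := (@step R d).
Local Notation D := d.-1.
Implicit Types (F G : nat -> nat -> nat -> nat -> R).

(** Joint expectation over the state (x0, y0) at level K and the state (x, y)
    at the lower level k. Both are needed since the fluid solution followed
    below K is chosen according to y0. *)
Definition chain2 N K k F : R :=
  chain N K (fun x0 y0 => chain K k (F x0 y0) x0 y0) 1 d.

Lemma le_chain2 N K k F G :
  (forall x0 y0 x y, reachable d x0 y0 -> reachable d x y ->
     F x0 y0 x y <= G x0 y0 x y) -> chain2 N K k F <= chain2 N K k G.
Proof.
move=> h; apply: le_chain => //; first exact: reachable_start.
by move=> x0 y0 xy0; apply: le_chain => // x y; exact: h.
Qed.

Lemma chain2_step N K k F : (k < K)%N ->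
  chain2 N K k F = chain2 N K k.+1 (fun x0 y0 => step k.+1 (F x0 y0)).
Proof. by move=> kK; apply: eq_chain => x0 y0; rewrite chainSr. Qed.

Lemma chain2D N K k F G : chain2 N K k (fun x0 y0 x y => F x0 y0 x y + G x0 y0 x y) =
  chain2 N K k F + chain2 N K k G.
Proof. by rewrite -chainD; apply: eq_chain => x0 y0; rewrite chainD. Qed.

Lemma chain2Z N K k (a : R) F : chain2 N K k (fun x0 y0 x y => a * F x0 y0 x y) =
  a * chain2 N K k F.
Proof. by rewrite -chainZ; apply: eq_chain => x0 y0; rewrite chainZ. Qed.

Lemma chain2_marg N K k (phi : nat -> nat -> R) : (k <= K <= N)%N ->
  chain2 N K k (fun _ _ => phi) = chain N k phi 1 d.
Proof. by move=> kKN; rewrite (@chain_comp _ _ _ K). Qed.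

Lemma chain2_cst N K k (a : R) : chain2 N K k (fun _ _ _ _ => a) = a.
Proof.
by rewrite -[RHS](chain_cst d N K a 1 d); apply: eq_chain => x y; rewrite chain_cst.
Qed.

Lemma moment_ratio r N k : (0 < k <= N)%N ->
  chain N k (fun _ y => (k%:R^-1 * y%:R) ^+ r) 1 d <=
  momc R d r * (N.+1%:R ^+ D / k%:R ^+ d) ^+ r.
Proof.
move=> /andP[k0 kN]; have k0' : 0 < k%:R :> R by rewrite ltr0n.
have -> : chain N k (fun _ y => (k%:R^-1 * y%:R) ^+ r) 1 d =
    k%:R^-1 ^+ r * chain N k (fun _ y => y%:R ^+ r) 1 d.
  by rewrite -chainZ; apply: eq_chain => x y; rewrite exprMn.
have i0 : 0 <= k%:R^-1 ^+ r :> R by nneg.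
have hm := @moment_pending R d d_gt1 r _ _ kN.
apply: (le_trans (ler_wpM2l i0 hm)).
rewrite mulrCA; apply: ler_wpM2l; first exact: momc_ge0.
rewrite mulnC exprM -exprMn; apply: lerXn2r; rewrite ?nnegrE; [nneg|nneg|].
rewrite mulrC -[in leRHS](prednK d_gt0) exprSr invfM mulrA.
apply: ler_wpM2r; first nneg.
rewrite -expr_div_n; apply: lerXn2r; rewrite ?nnegrE; [nneg|nneg|].
by rewrite ler_pM2l ?ltr0n// lef_pV2 ?posrE ?ltr0n// ler_nat.
Qed.

Lemma ler_momc_ratio r N k z : (0 < z <= k)%N ->
  momc R d r * (N.+1%:R ^+ D / k%:R ^+ d) ^+ r <=
  momc R d r * (N.+1%:R ^+ D / z%:R ^+ d) ^+ r.
Proof.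
move=> /andP[z0 zk]; apply: ler_wpM2l; first exact: momc_ge0.
have k0 := leq_trans z0 zk.
apply: lerXn2r; rewrite ?nnegrE; [nneg|nneg|].
rewrite ler_pM2l ?exprn_gt0// lef_pV2 ?posrE ?exprn_gt0 ?ltr0n//.
by apply: lerXn2r; rewrite ?nnegrE// ler_nat.
Qed.

Section Window.
Variables (N K z : nat).
Hypotheses (z_gt0 : (0 < z)%N) (zK : (z <= K)%N) (KN : (K <= N)%N).

Let K_gt0 : (0 < K)%N := leq_trans z_gt0 zK.

(** The constant C of the fluid solution that starts near y0 / K: there y0 / K
    is small, and ln (1 + C / K^d) is about C / K^d. *)
Definition charge y : R := K%:R ^+ D * y%:R.

Lemma charge_ge0 y : 0 <= charge y.
Proof. by rewrite /charge; nneg. Qed.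

Let M2 : R := momc R d 2 * (N.+1%:R ^+ D / z%:R ^+ d) ^+ 2.
Let M4 : R := momc R d 4 * (N.+1%:R ^+ D / K%:R ^+ d) ^+ 4.

Let M2_ge0 : 0 <= M2. Proof. by rewrite /M2; have := momc_ge0 R d 2; nneg. Qed.
Let M4_ge0 : 0 <= M4. Proof. by rewrite /M4; have := momc_ge0 R d 4; nneg. Qed.

Definition gap k : R :=
  chain2 N K k (fun _ y0 _ y => (k%:R^-1 * y%:R - fluid d (charge y0) k) ^+ 2).

(** ln (1 + v) differs from v by at most v ^+ 2, hence the fourth moment. *)
Lemma gap_start : gap K <= M4.
Proof.
have KK : (0 < K <= N)%N by rewrite K_gt0.
apply: le_trans (moment_ratio 4 KK).
apply: le_chain => //; first exact: reachable_start.
move=> x y _; rewrite chain_id /fluid.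
have -> : charge y / K%:R ^+ d = K%:R^-1 * y%:R.
  rewrite /charge -[in X in _ / X](prednK d_gt0) exprSr.
  by field; rewrite !gt_eqF ?exprn_gt0 ?ltr0n.
have : 0 <= K%:R^-1 * y%:R :> R by rewrite mulr_ge0 ?invr_ge0.
move: (K%:R^-1 * _) => u u0; have l1 := ln1D_le u0; have l2 := ln1D_ge u0.
rewrite -[4%N]/(2 * 2)%N exprM; apply: lerXn2r; rewrite ?nnegrE ?sqr_ge0//; lra.
Qed.

Lemma sqmom_le k : (z <= k <= K)%N ->
  chain2 N K k (fun _ _ _ y => (k%:R^-1 * y%:R) ^+ 2) <= M2.
Proof.
move=> /andP[zk kK]; rewrite chain2_marg ?kK//.
have k0 := leq_trans z_gt0 zk.
apply: (le_trans (@moment_ratio 2 N k _)); first by rewrite k0 (leq_trans kK).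
by apply: ler_momc_ratio; rewrite z_gt0.
Qed.

Lemma gap_step k : (z <= k < K)%N ->
  gap k <= (1 + (2 * d + 1)%:R * k%:R^-1) * gap k.+1 +
    noisec R d * (1 + M2) * k%:R ^- 2.
Proof.
move=> /andP[zk kK]; have k0 := leq_trans z_gt0 zk.
rewrite {1}/gap chain2_step//.
apply: le_trans (le_chain2 _ _ _ (G := fun _ y0 _ y =>
  (1 + (2 * d + 1)%:R * k%:R^-1) *
    (k.+1%:R^-1 * y%:R - fluid d (charge y0) k.+1) ^+ 2 +
  (noisec R d * k%:R ^- 2) * (1 + (k.+1%:R^-1 * y%:R) ^+ 2)) _) _.
  move=> x0 y0 x y _ _.
  have hs := @step_fluid R d _ k x y (charge_ge0 y0) k0.
  by apply: (le_trans hs); rewrite mulrAC.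
rewrite chain2D !chain2Z chain2D chain2_cst -/(gap _) lerD2l mulrAC.
apply: ler_wpM2r; first nneg.
apply: ler_wpM2l; first exact: noisec_ge0.
by rewrite lerD2l sqmom_le// (leq_trans zk).
Qed.

Definition gapc : R := (K%:R / z%:R) ^+ (2 * d + 1) *
  (M4 + 4 * noisec R d * (1 + M2) / z%:R).

(** Discrete Gronwall inequality from K down to k. *)
Lemma gap_le k : (z <= k <= K)%N -> gap k <= gapc.
Proof.
move=> /andP[zk kK]; have z0' : 0 < z%:R :> R by rewrite ltr0n.
set c := (2 * d + 1)%N; set B := 4 * noisec R d * (1 + M2).
have B0 : 0 <= B by rewrite /B; have := noisec_ge0 R d; nneg.
have K0' : 0 < K%:R :> R by rewrite ltr0n.
suff H : gap k <= (K%:R / k%:R) ^+ c * (M4 + B * \sum_(k <= j < K) j.+1%:R ^- 2).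
  apply: (le_trans H); rewrite /gapc -/B -/c; apply: ler_pM; first nneg.
  - apply: addr_ge0 => //; apply: mulr_ge0 => //.
    by apply: sumr_ge0 => j _; nneg.
  - apply: lerXn2r; rewrite ?nnegrE; [nneg|nneg|].
    rewrite ler_pM2l// lef_pV2 ?posrE ?ltr0n// ?ler_nat//.
    exact: leq_trans zk.
  - rewrite lerD2l; apply: ler_wpM2l => //.
    apply: le_trans (@sum_invsq_le R k K (leq_trans z_gt0 zk)) _.
    rewrite lef_pV2 ?posrE ?ltr0n// ?ler_nat//; exact: leq_trans zk.
rewrite -(subKn kK); elim: (K - k)%N (leq_sub2l K zk) => {k zk kK} [|j IH] jK.
  by rewrite subn0 divff ?gt_eqF// expr1n mul1r big_geq// mulr0 addr0 gap_start.
have e : (K - j.+1).+1 = (K - j)%N by lia.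
set k := (K - j.+1)%N in e *.
have zk : (z <= k)%N by rewrite /k; lia.
have kK : (k < K)%N by rewrite /k; lia.
have k0 : 0 < k%:R :> R by rewrite ltr0n (leq_trans z_gt0).
have k10 : 0 < k.+1%:R :> R by rewrite ltr0n.
apply: (le_trans (@gap_step k _)); first by rewrite zk.
have {IH} := IH (ltnW jK); rewrite -e => IH.
rewrite (big_ltn kK) /=.
set S := \sum_(_ <= _ < _) _ in IH *.
have h0 : 0 <= k%:R^-1 :> R by rewrite invr_ge0 ltW.
have hB := @bernoulli_ge R k%:R^-1 c h0.
have g0 : 0 <= gap k.+1.
  rewrite -(chain2_cst N K k.+1 0); apply: le_chain2 => *; exact: sqr_ge0.
apply: (@le_trans _ _ ((1 + k%:R^-1) ^+ c *
    ((K%:R / k.+1%:R) ^+ c * (M4 + B * S)) + B * k.+1%:R ^- 2)).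
  apply: lerD.
    apply: ler_pM => //; apply: addr_ge0 => //; nneg.
  rewrite /B [X in _ <= X](_ : _ = (noisec R d * (1 + M2)) * (4 * k.+1%:R ^- 2)).
    apply: ler_wpM2l; first by have := noisec_ge0 R d; nneg.
    rewrite -!exprVn -[4]/(2 * 2)%:R natrM -expr2 -exprMn.
    apply: lerXn2r; rewrite ?nnegrE; [nneg|nneg|].
    rewrite ler_pdivlMr// mulrC ler_pdivrMr// -natr1.
    have : 1 <= k%:R :> R by rewrite ler1n -(ltr0n R).
    lra.
  by ring.
have -> : (1 + k%:R^-1) ^+ c * ((K%:R / k.+1%:R) ^+ c * (M4 + B * S)) =
    (K%:R / k%:R) ^+ c * (M4 + B * S).
  rewrite mulrA -exprMn; congr (_ ^+ _ * _).
  by rewrite -natr1; field; rewrite !gt_eqF//; lra.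
have X1 : 1 <= (K%:R / k%:R) ^+ c :> R.
  by rewrite exprn_ege1// ler_pdivlMr// mul1r ler_nat ltnW.
move: (_ ^+ c) X1 => X X1.
have : 0 <= B * k.+1%:R ^- 2 by nneg.
rewrite [B * (_ + S)]mulrDr; move: (B * k.+1%:R ^- 2) (B * S) => Y Z Y0; nra.
Qed.

Definition count_error k (x0 y0 x y : nat) : R :=
  x%:R - x0%:R - \sum_(k <= j < K) fluid_rate d (charge y0) j.+1.

Definition cerr k : R := chain2 N K k (fun x0 y0 x y => count_error k x0 y0 x y ^+ 2).

(** The increment of count_error is the indicator that k + 1 is found minus
    its fluid prediction. The cross term of the square only involves the
    conditional mean of this increment; Young's inequality with weight 1 / K
    keeps the growth factor bounded over K vertices. *)
Lemma step_count_error k x0 y0 x y : (z <= k < K)%N ->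
  step k.+1 (fun x y => count_error k x0 y0 x y ^+ 2) x y <=
  (1 + K%:R^-1) * count_error k.+1 x0 y0 x y ^+ 2 +
  (2 * K%:R * (k.+1%:R^-1 * y%:R - fluid d (charge y0) k.+1) ^+ 2 +
  (2 * K%:R / z%:R ^+ 2 * (k.+1%:R^-1 * y%:R) ^+ 2 + 1)).
Proof.
move=> /andP[zk kK]; have k0 := leq_trans z_gt0 zk.
have K0' : 0 < K%:R :> R by rewrite ltr0n.
have := @hit_rate R d _ k y (charge_ge0 y0) k0.
have /andP[a0 a1] := @fluid_rate_itv R d _ k.+1 (charge_ge0 y0) isT.
have -> : step k.+1 (fun x y => count_error k x0 y0 x y ^+ 2) x y =
   binexp k.+1%:R^-1 y (fun w => (count_error k.+1 x0 y0 x y + ((0 < w)%N%:R -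
     fluid_rate d (charge y0) k.+1)) ^+ 2).
  apply: eq_binexp => w _; congr (_ ^+ 2).
  by rewrite /count_error (big_ltn kK) natrD; ring.
set a := fluid_rate _ _ _ in a0 a1 *; set g := count_error _ _ _ _ _.
move=> hr; apply: (@le_trans _ _ (binexp k.+1%:R^-1 y (fun w =>
   (g ^+ 2 + 1 - 2 * g * a) + 2 * g * (0 < w)%N%:R))).
  apply: le_binexp; first exact: pinv_itv.
  move=> w _; have : ((0 < w)%N%:R - a) ^+ 2 <= 1.
    by case: (0 < w)%N; rewrite /= ?mulr1n ?mulr0n expr2; nra.
  lra.
rewrite binexpD binexp_cst binexpZ binexp_hit.
set pi0 := 1 - _ ^+ y in hr *.
set u := k.+1%:R^-1 * y%:R in hr *.
set e := u - _ in hr *.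
have u0 : 0 <= u by rewrite /u; nneg.
have h1 : u * k%:R^-1 <= u * z%:R^-1.
  by apply: ler_wpM2l => //; rewrite lef_pV2 ?posrE ?ltr0n// ler_nat.
have {h1}hr : `|pi0 - a| <= `|e| + u * z%:R^-1 by lra.
have key : 2 * g * (pi0 - a) <= K%:R^-1 * g ^+ 2 + K%:R * (pi0 - a) ^+ 2.
  have i0 : 0 <= K%:R^-1 :> R by rewrite invr_ge0 ltW.
  have := mulr_ge0 i0 (sqr_ge0 (g - K%:R * (pi0 - a))).
  have -> : K%:R^-1 * (g - K%:R * (pi0 - a)) ^+ 2 =
    K%:R^-1 * g ^+ 2 + K%:R * (pi0 - a) ^+ 2 - 2 * g * (pi0 - a).
    by field; rewrite gt_eqF.
  lra.
have sq : (pi0 - a) ^+ 2 <= 2 * e ^+ 2 + 2 * (u * z%:R^-1) ^+ 2.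
  rewrite -[(_ - a) ^+ 2]real_normK ?num_real// -[e ^+ 2]real_normK ?num_real//.
  have n0 := normr_ge0 (pi0 - a); have n1 := normr_ge0 e.
  have : `|pi0 - a| ^+ 2 <= (`|e| + u / z%:R) ^+ 2.
    by apply: lerXn2r; rewrite ?nnegrE//; nneg.
  have := sqr_ge0 (`|e| - u / z%:R); lra.
have := ler_wpM2l (ltW K0') sq.
have -> : 2 * K%:R / z%:R ^+ 2 * u ^+ 2 = 2 * K%:R * (u * z%:R^-1) ^+ 2.
  by field; rewrite gt_eqF ?ltr0n.
clearbody e u g pi0 a; move: (K%:R^-1 : R) key ((u * z%:R^-1) ^+ 2) => iK key q sq'.
lra.
Qed.

Lemma cerr_le : cerr z <=
  expR 1 * K%:R * (2 * K%:R * gapc + (2 * K%:R / z%:R ^+ 2 * M2 + 1)).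
Proof.
have K0' : 0 < K%:R :> R by rewrite ltr0n.
have z0' : 0 < z%:R :> R by rewrite ltr0n.
set Q := 2 * K%:R * gapc + _.
have gapc0 : 0 <= gapc.
  apply: le_trans (@gap_le z _); last by rewrite leqnn.
  rewrite -(chain2_cst N K z 0); apply: le_chain2 => *; exact: sqr_ge0.
have Q0 : 0 <= Q by rewrite /Q; nneg.
have i0 : 0 <= K%:R^-1 :> R by rewrite invr_ge0 ltW.
have H j : (j <= K - z)%N -> cerr (K - j) <= (1 + K%:R^-1) ^+ j * (j%:R * Q).
  elim: j => [|j IH] jK.
    rewrite subn0 mul0r mulr0 /cerr -(chain2_cst N K K 0).
    apply: le_chain => //; first exact: reachable_start.
    move=> x y _; rewrite !chain_id /count_error big_geq// subr0 subrr expr0n//.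
  have e : (K - j.+1).+1 = (K - j)%N by lia.
  set k := (K - j.+1)%N in e *.
  have zk : (z <= k)%N by rewrite /k; lia.
  have kK : (k < K)%N by rewrite /k; lia.
  have {IH} := IH (ltnW jK); rewrite -e => IH.
  rewrite {1}/cerr chain2_step//.
  apply: (le_trans (le_chain2 _ _ _ (fun x0 y0 x y _ _ =>
    @step_count_error k x0 y0 x y _))); first by rewrite zk.
  rewrite !(chain2D, chain2Z) chain2_cst -/(cerr _) -/(gap _).
  have g1 : gap k.+1 <= gapc by apply: gap_le; rewrite kK (leq_trans zk).
  have g2 := @sqmom_le k.+1; rewrite kK (leq_trans zk) in g2 => //.
  have {}g2 := g2 isT.
  apply: (@le_trans _ _ ((1 + K%:R^-1) * ((1 + K%:R^-1) ^+ j * (j%:R * Q)) + Q)).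
    apply: lerD; first by apply: ler_wpM2l => //; nneg.
    apply: lerD; first by apply: ler_wpM2l => //; nneg.
    by rewrite lerD2r; apply: ler_wpM2l => //; nneg.
  rewrite mulrA -exprS; have X1 : 1 <= (1 + K%:R^-1) ^+ j.+1 :> R.
    by rewrite exprn_ege1// lerDl.
  rewrite -[j.+1%:R]natr1; move: (_ ^+ j.+1) X1 => X X1.
  have -> : X * ((j%:R + 1) * Q) = X * (j%:R * Q) + X * Q by ring.
  by rewrite lerD2l ler_peMl.
have := H (K - z)%N (leqnn _); rewrite subKn// => /le_trans; apply.
rewrite -mulrA; apply: ler_pM; [nneg|nneg| |].
  apply: (@le_trans _ _ ((1 + K%:R^-1) ^+ K)).
    by rewrite ler_weXn2l ?lerDl// leq_subr.
  apply: (@le_trans _ _ (expR K%:R^-1 ^+ K)).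
    by apply: lerXn2r; rewrite ?nnegrE ?expR_ge0 ?expR_ge1Dx//; nneg.
  by rewrite -expRM_natr mulVf ?gt_eqF.
by apply: ler_wpM2r => //; rewrite ler_nat leq_subr.
Qed.

End Window.
End Coupling.

(** * The integral of 1 / (1 + x^d) *)

Section Reflection.
Variable R : realType.
Implicit Types (x t : R) (j d : nat).

Lemma mvt_from (f df : R -> R) (a b : R) :
  (forall x, a <= x -> is_derive x 1 f (df x)) -> a < b ->
  exists2 c, a < c < b & f b - f a = df c * (b - a).
Proof.
move=> h ab.
have [||c cab e] := @MVT R f df a b ab.
- by move=> x; rewrite in_itv/= => /andP[ax _]; apply: h; exact: ltW.
- apply: derivable_within_continuous => x; rewrite in_itv/= => /andP[ax _].
  by have [] := h x ax.
- by exists c => //; move: cab; rewrite in_itv.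
Qed.

Lemma is_derive_pow n x : is_derive x 1 (fun y => y ^+ n) (n%:R * x ^+ n.-1).
Proof.
have -> : (fun y : R => y ^+ n) = (id : R -> R) ^+ n by rewrite exprfctE.
by apply: is_derive_eq; rewrite /GRing.scale /= mulr1.
Qed.

Definition polarden t x : R := (x - cos t) ^+ 2 + sin t ^+ 2.

(** An antiderivative of (1 - x cos t) / (x^2 - 2 x cos t + 1), the real part
    of 1 / (1 - x exp (- i t)). *)
Definition polarprim t x : R :=
  - cos t / 2 * ln (polarden t x) + sin t * atan ((x - cos t) / sin t).

Lemma polarden_gt0 t x : (sin t != 0) || (cos t == -1) -> 0 <= x ->
  0 < polarden t x.
Proof.
move=> + x0; rewrite /polarden => /orP[st|/eqP ct].
  rewrite ltr_wpDl ?sqr_ge0// lt0r sqr_ge0 andbT expf_neq0//.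
rewrite ct opprK ltr_pwDl ?sqr_ge0// exprn_gt0//; lra.
Qed.

Lemma is_derive_polarprim t x : (sin t != 0) || (cos t == -1) -> 0 <= x ->
  is_derive x 1 (polarprim t) ((1 - x * cos t) / polarden t x).
Proof.
move=> ht x0; have p0 := polarden_gt0 ht x0.
have dden : is_derive x 1 (polarden t) (2 * (x - cos t)).
  rewrite /polarden; apply: is_derive_eq.
  by rewrite /GRing.scale /=; ring.
have dln : is_derive x 1 (fun x => ln (polarden t x))
    ((polarden t x)^-1 * (2 * (x - cos t))).
  apply: is_derive1_comp; exact: is_derive1_ln.
have dlin : is_derive x 1 (fun x => (x - cos t) / sin t) (sin t)^-1.
  by apply: is_derive_eq; rewrite /GRing.scale /=; ring.
have dat : is_derive x 1 (fun x => atan ((x - cos t) / sin t))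
    ((1 + ((x - cos t) / sin t) ^+ 2)^-1 * (sin t)^-1).
  by apply: is_derive1_comp.
rewrite /polarprim; apply: is_derive_eq.
rewrite /GRing.scale /= ?(mulr0, addr0).
have cs := cos2Dsin2 t.
have [s0|s0] := eqVneq (sin t) 0.
  move: ht; rewrite s0 eqxx/= => /eqP ct.
  rewrite mul0r addr0 /polarden s0 ct expr0n/= addr0 opprK.
  by field; rewrite gt_eqF//; lra.
have e : 1 + ((x - cos t) / sin t) ^+ 2 = polarden t x / sin t ^+ 2.
  by rewrite /polarden; field.
rewrite e; move: (polarden t x) p0 => p p0.
have -> : 1 - x * cos t = - cos t * (x - cos t) + sin t ^+ 2.
  by rewrite -cs; ring.
by field; rewrite s0 gt_eqF.
Qed.

Lemma tan_cofun t u : sin u = cos t -> cos u = sin t -> tan u = cos t / sin t.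
Proof. by rewrite /tan => -> ->. Qed.

Lemma atan_cot t : 0 < t < pi *+ 2 -> sin t != 0 ->
  sin t * atan (cos t / sin t) = sin t * (pi - t) - `|sin t| * (pi / 2).
Proof.
move=> /andP[t0 t2] st.
have pp := @pi_gt0 R.
have [tp|tp|tp] := ltgtP t pi.
- have s0 : 0 < sin t by apply: sin_gt0_pi; rewrite t0.
  have <- : tan (pi / 2 - t) = cos t / sin t.
    by apply: tan_cofun; rewrite ?sinB ?cosB ?sin_pihalf ?cos_pihalf; ring.
  rewrite tanK; last by rewrite in_itv/=; apply/andP; split; lra.
  by rewrite gtr0_norm//; field.
- have s0 : sin t < 0.
    rewrite -[t](subrK pi) sinDpi oppr_lt0; apply: sin_gt0_pi.
    by move: t2; rewrite mulr2n => ?; apply/andP; split; lra.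
  have <- : tan (pi / 2 + pi - t) = cos t / sin t.
    have -> : cos t / sin t = - cos t / (- sin t) by field.
    rewrite /tan sinB cosB sinDpi cosDpi sin_pihalf cos_pihalf.
    by congr (_ / _); ring.
  rewrite tanK; last first.
    by move: t2; rewrite mulr2n in_itv/= => ?; apply/andP; split; lra.
  by rewrite ltr0_norm//; field.
- by move: st; rewrite tp sinpi eqxx.
Qed.

(** The logarithm diverges at infinity, but these terms will cancel in the sum
    over the roots of -1. *)
Lemma cvg_polarprim t : (sin t != 0) || (cos t == -1) -> 0 < t < pi *+ 2 ->
  polarprim t x + cos t * ln x @[x --> +oo] --> sin t * (pi - t) + polarprim t 0.
Proof.
move=> ht t02.
have inv0 : (x^-1 : R) @[x --> +oo] --> (0 : R).
  apply/(@gtr0_cvgV0 _ _ _ _ id) => //.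
  exact: nbhs_pinfty_gt.
have cs := cos2Dsin2 t.
have -> : sin t * (pi - t) + polarprim t 0 =
    - cos t / 2 * ln ((1 - cos t * 0) ^+ 2 + (sin t * 0) ^+ 2) +
    `|sin t| * (pi / 2).
  rewrite /polarprim /polarden sub0r sqrrN cs !mulr0 subr0 expr1n expr0n addr0 ln1 !mulr0 !add0r.
  have [->|st] := eqVneq (sin t) 0; first by rewrite normr0 !mul0r addr0.
  by rewrite mulNr atanN mulrN atan_cot//; ring.
have E : {near (+oo : set_system R), (fun x => - cos t / 2 * ln ((1 - cos t * x^-1) ^+ 2 + (sin t * x^-1) ^+ 2) +
    `|sin t| * atan ((x - cos t) / `|sin t|)) =1 (fun x => polarprim t x + cos t * ln x)}.
  near=> x.
  have x0 : 0 < x by near: x; exact: nbhs_pinfty_gt.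
  have p0 := polarden_gt0 ht (ltW x0).
  have -> : (1 - cos t * x^-1) ^+ 2 + (sin t * x^-1) ^+ 2 = polarden t x / (x ^+ 2).
    by rewrite /polarden; field; rewrite gt_eqF.
  rewrite /polarprim ln_div ?posrE ?exprn_gt0// lnXn// mulr2n.
  have -> : `|sin t| * atan ((x - cos t) / `|sin t|) = sin t * atan ((x - cos t) / sin t).
    have [s0|s0] := leP 0 (sin t); first by rewrite ger0_norm.
    by rewrite ltr0_norm// invrN mulrN atanN mulrNN.
  by field.
apply: cvg_trans; first exact: near_eq_cvg E.
apply: cvgD.
  apply: cvgMr.
  apply: (@cvg_comp _ _ _ (fun x : R => (1 - cos t * x^-1) ^+ 2 + (sin t * x^-1) ^+ 2)
    (@ln R) _ (nbhs ((1 - cos t * 0 : R) ^+ 2 + (sin t * 0) ^+ 2))); last first.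
    by apply: continuous_ln; rewrite !mulr0 subr0 expr0n addr0 expr1n.
  apply: cvgD.
    rewrite !expr2; apply: cvgM; (apply: cvgB; [exact: cvg_cst|exact: cvgMr]).
  by rewrite !expr2; apply: cvgM; exact: cvgMr.
have [s0|s0] := eqVneq (sin t) 0.
  by rewrite s0 normr0 mul0r; under eq_fun do rewrite mul0r; exact: cvg_cst.
apply: cvgMr; apply: (@cvg_comp _ _ _ (fun x => (x - cos t) / `|sin t|) (@atan R) _ (+oo : set_system R)); last exact: cvgy_atan.
apply: gt0_cvgMly; first by rewrite invr_gt0 normr_gt0.
exact: cvg_addrr.
Unshelve. all: by end_near. Qed.

Lemma cos_sin_nat2pi j : cos (j%:R * (pi *+ 2)) = 1 :> R /\ sin (j%:R * (pi *+ 2)) = 0 :> R.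
Proof.
elim: j => [|j [IHc IHs]]; first by rewrite mul0r cos0 sin0.
by rewrite -natr1 mulrDl mul1r cosD2pi sinD2pi.
Qed.

(** The real part of the geometric sum of the powers of x exp (i t),
    multiplied by the square modulus polarden of 1 - x exp (i t). *)
Lemma sum_pow_cos x t M :
  (\sum_(m < M) x ^+ m * cos (m%:R * t)) * polarden t x =
  1 - x * cos t - x ^+ M * cos (M%:R * t) +
  x ^+ M.+1 * (cos (M%:R * t) * cos t + sin (M%:R * t) * sin t).
Proof.
have cs := cos2Dsin2 t.
have -> : polarden t x = (cos t ^+ 2 + sin t ^+ 2) - 2 * x * cos t + x ^+ 2.
  by rewrite /polarden; ring.
rewrite cs.
elim: M => [|M IH].
  have t0 : 0%:R * t = 0 by rewrite mul0r.
  by rewrite t0 cos0 sin0 big_ord0 expr0 expr1; ring.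
have e : M.+1%:R * t = M%:R * t + t by rewrite -natr1; ring.
rewrite big_ord_recr/= mulrDl IH e cosD sinD.
set C := cos (M%:R * t); set S := sin (M%:R * t).
have -> : (C * cos t - S * sin t) * cos t + (S * cos t + C * sin t) * sin t =
  C * (cos t ^+ 2 + sin t ^+ 2) by ring.
by rewrite cs !exprS; ring.
Qed.

Section Degree.
Variable d : nat.
Hypothesis d_gt1 : (1 < d)%N.

Let phi : R := pi / d%:R.
(** The arguments of the d-th roots of -1. *)
Let th j : R := (2 * j + 1)%:R * phi.

Let d0 : 0 < d%:R :> R. Proof. by rewrite ltr0n ltnW. Qed.

Let dphi : d%:R * phi = pi. Proof. by rewrite /phi; field; rewrite gt_eqF. Qed.

Let sin_mul_phi m : (0 < m < d)%N -> 0 < sin (m%:R * phi).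
Proof.
move=> /andP[m0 md]; apply: sin_gt0_pi.
rewrite mulr_gt0 ?ltr0n ?divr_gt0 ?pi_gt0//= -dphi ltr_pM2r ?ltr_nat//.
by rewrite divr_gt0 ?pi_gt0.
Qed.

Let sin_cos_th m j :
  2 * sin (m%:R * phi) * cos (m%:R * th j) =
  sin (j.+1%:R * (m%:R * phi *+ 2)) - sin (j%:R * (m%:R * phi *+ 2)).
Proof.
have e1 : j.+1%:R * (m%:R * phi *+ 2) = m%:R * th j + m%:R * phi.
  by rewrite /th natrD natrM -natr1 mulr2n; ring.
have e2 : j%:R * (m%:R * phi *+ 2) = m%:R * th j - m%:R * phi.
  by rewrite /th natrD natrM mulr2n; ring.
by rewrite e1 e2 sinD sinB; ring.
Qed.

Let sum_cos_th m : (0 < m < d)%N -> \sum_(j < d) cos (m%:R * th j) = 0.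
Proof.
move=> md; have s0 := sin_mul_phi md.
have s20 : 2 * sin (m%:R * phi) != 0 by rewrite gt_eqF// mulr_gt0.
apply: (mulfI s20); rewrite mulr0 mulr_sumr.
under eq_bigr do rewrite sin_cos_th.
rewrite -(big_mkord xpredT (fun j => sin (j.+1%:R * (m%:R * phi *+ 2)) -
  sin (j%:R * (m%:R * phi *+ 2)))) (telescope_sumr (fun j => sin (j%:R * _)))//.
rewrite mul0r sin0 subr0.
have -> : d%:R * (m%:R * phi *+ 2) = m%:R * (pi *+ 2).
  by rewrite -dphi !mulr2n; ring.
by have [] := cos_sin_nat2pi m.
Qed.

Let e_ j := cos (j%:R * (phi *+ 2)).

Let sin_th j : 2 * sin phi * sin (th j) = e_ j - e_ j.+1.
Proof.
have e1 : j.+1%:R * (phi *+ 2) = th j + phi.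
  by rewrite /th natrD natrM -natr1 mulr2n; ring.
have e2 : j%:R * (phi *+ 2) = th j - phi.
  by rewrite /th natrD natrM mulr2n; ring.
by rewrite /e_ e1 e2 cosB cosD; ring.
Qed.

Let e_d : e_ d = 1.
Proof.
rewrite /e_; have -> : d%:R * (phi *+ 2) = 1 * (pi *+ 2) by rewrite -dphi !mulr2n; ring.
by have [] := cos_sin_nat2pi 1.
Qed.

Let sin_phi : 0 < sin phi.
Proof. by have := @sin_mul_phi 1; rewrite mul1r => ->. Qed.

Let sum_sin_th : \sum_(j < d) sin (th j) = 0.
Proof.
have s20 : 2 * sin phi != 0 by rewrite gt_eqF// mulr_gt0.
apply: (mulfI s20); rewrite mulr0 mulr_sumr.
under eq_bigr do rewrite sin_th -opprB.
rewrite sumrN -(big_mkord xpredT (fun j => e_ j.+1 - e_ j)) telescope_sumr//.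
by rewrite e_d /e_ mul0r cos0 subrr oppr0.
Qed.

Let sum_e : \sum_(j < d) e_ j.+1 = 0.
Proof.
have s20 : 2 * sin phi != 0 by rewrite gt_eqF// mulr_gt0.
apply: (mulfI s20); rewrite mulr0 mulr_sumr.
have E j : 2 * sin phi * e_ j.+1 = sin (j.+1%:R * (phi *+ 2) + phi) - sin (j%:R * (phi *+ 2) + phi).
  have e1 : j%:R * (phi *+ 2) + phi = j.+1%:R * (phi *+ 2) - phi.
    by rewrite -natr1 mulr2n; ring.
  by rewrite e1 /e_ sinD sinB; ring.
under eq_bigr do rewrite E.
rewrite -(big_mkord xpredT (fun j => sin (j.+1%:R * (phi *+ 2) + phi) -
  sin (j%:R * (phi *+ 2) + phi))) (telescope_sumr (fun j => sin (j%:R * _ + phi)))//.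
have -> : d%:R * (phi *+ 2) = 0 + pi *+ 2 by rewrite -dphi !mulr2n; ring.
by rewrite mul0r -addrA [_ *+ 2 + _]addrC addrA sinD2pi subrr.
Qed.

Let sum_j_sin_th : 2 * sin phi * (\sum_(j < d) j%:R * sin (th j)) = - d%:R.
Proof.
rewrite mulr_sumr.
transitivity (\sum_(j < d) (e_ j.+1 - (j.+1%:R * e_ j.+1 - j%:R * e_ j))).
  by apply: eq_bigr => j _; rewrite mulrCA sin_th -natr1; ring.
rewrite sumrB sum_e sub0r -(big_mkord xpredT (fun j => j.+1%:R * e_ j.+1 - j%:R * e_ j)).
by rewrite (telescope_sumr (fun j => j%:R * e_ j))// e_d mul0r subr0 mulr1.
Qed.

(** Euler's value of the integral of 1 / (1 + x^d) over the half-line. *)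
Definition reflc : R := pi / (d%:R * sin (pi / d%:R)).

Let sum_value : d%:R^-1 * (\sum_(j < d) sin (th j) * (pi - th j)) = reflc.
Proof.
have -> : \sum_(j < d) sin (th j) * (pi - th j) =
    (pi - phi) * (\sum_(j < d) sin (th j)) - 2 * phi * (\sum_(j < d) j%:R * sin (th j)).
  rewrite !mulr_sumr -sumrB; apply: eq_bigr => j _.
  have e : pi - th j = pi - phi - 2 * phi * j%:R by rewrite /th natrD natrM; ring.
  by rewrite e; ring.
rewrite sum_sin_th mulr0 sub0r /reflc -/phi.
have -> : \sum_(j < d) j%:R * sin (th j) = - d%:R / (2 * sin phi).
  by rewrite -sum_j_sin_th; field; rewrite gt_eqF.
by rewrite -dphi; field; rewrite !gt_eqF.
Qed.

Let th_itv j : (j < d)%N -> 0 < th j < pi *+ 2.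
Proof.
move=> jd; have p0 : 0 < phi by rewrite divr_gt0 ?pi_gt0.
rewrite /th mulr_gt0 ?ltr0n ?addn1//=.
have -> : pi *+ 2 = (d * 2)%:R * phi by rewrite -dphi natrM mulr2n; ring.
rewrite ltr_pM2r// ltr_nat; lia.
Qed.

Let th_ok j : (j < d)%N -> (sin (th j) != 0) || (cos (th j) == -1).
Proof.
move=> jd; have /andP[t0 t2] := th_itv jd.
have [tp|tp|->] := ltgtP (th j) pi; last by rewrite cospi eqxx orbT.
  by rewrite gt_eqF// sin_gt0_pi// t0.
rewrite lt_eqF// -[th j](subrK pi) sinDpi oppr_lt0; apply: sin_gt0_pi.
by move: t2; rewrite mulr2n => ?; apply/andP; split; lra.
Qed.

Let cos_sin_d_th j : cos (d%:R * th j) = -1 /\ sin (d%:R * th j) = 0.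
Proof.
have -> : d%:R * th j = j%:R * (pi *+ 2) + pi.
  by rewrite /th -dphi natrD natrM mulr2n; ring.
by have [c s] := cos_sin_nat2pi j; rewrite cosDpi sinDpi c s oppr0.
Qed.

(** Decomposition of 1 / (1 + x^d) over the d-th roots of -1, real parts only.
    In the sum over the roots of the geometric sums of sum_pow_cos, the powers
    0 < m < d cancel by sum_cos_th. *)
Let partial_fractions x : 0 <= x ->
  d%:R^-1 * (\sum_(j < d) (1 - x * cos (th j)) / polarden (th j) x) = (1 + x ^+ d)^-1.
Proof.
move=> x0; have xd : 0 < 1 + x ^+ d by rewrite ltr_pwDl// exprn_ge0.
have E (j : 'I_d) : (1 - x * cos (th j)) / polarden (th j) x =
    (1 + x ^+ d)^-1 * (\sum_(m < d) x ^+ m * cos (m%:R * th j)).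
  have p0 := polarden_gt0 (th_ok (ltn_ord j)) x0.
  have [c s] := cos_sin_d_th j.
  have := sum_pow_cos x (th j) d; rewrite c s mul0r addr0 exprS => h.
  have {h} -> : \sum_(m < d) x ^+ m * cos (m%:R * th j) =
     (1 - x * cos (th j)) * (1 + x ^+ d) / polarden (th j) x.
    by apply: (mulIf (lt0r_neq0 p0)); rewrite divfK ?gt_eqF// h; ring.
  by field; rewrite !gt_eqF.
under eq_bigr do rewrite E.
rewrite -mulr_sumr exchange_big /=.
have -> : \sum_(m < d) \sum_(j < d) x ^+ m * cos (m%:R * th j) = d%:R.
  rewrite (bigD1 (Ordinal (ltnW d_gt1)))//= [X in _ + X]big1 ?addr0.
    transitivity (\sum_(j < d) (1 : R)); last by rewrite sumr_const card_ord.
    by apply: eq_bigr => j _; rewrite expr0 [X in cos X](_ : _ = 0) ?cos0 ?mulr1// mul0r.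
  move=> m m0; rewrite -mulr_sumr sum_cos_th ?mulr0// ltn_ord andbT lt0n.
  by apply: contra m0 => /eqP m0; apply/eqP/val_inj.
by field; rewrite !gt_eqF.
Qed.

(** An antiderivative of 1 / (1 + x^d). *)
Definition reflF x : R := d%:R^-1 * (\sum_(j < d) polarprim (th j) x).

Lemma is_derive_reflF x : 0 <= x -> is_derive x 1 reflF (1 + x ^+ d)^-1.
Proof.
move=> x0; rewrite -partial_fractions//.
have hs : is_derive x 1 (\sum_(j < d) polarprim (th j))
    (\sum_(j < d) (1 - x * cos (th j)) / polarden (th j) x).
  apply: is_derive_sum => j; exact: is_derive_polarprim (th_ok (ltn_ord j)) x0.
have -> : reflF = d%:R^-1 *: (\sum_(j < d) polarprim (th j)).
  by apply/funext => y; rewrite /reflF fct_sumE.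
by apply: is_derive_eq.
Qed.

Lemma cvg_reflF : reflF x @[x --> +oo] --> reflc + reflF 0.
Proof.
have sc : \sum_(j < d) cos (th j) = 0.
  transitivity (\sum_(j < d) cos (1%:R * th j)); last exact: sum_cos_th.
  by apply: eq_bigr => j _; rewrite mul1r.
have -> : reflF = fun x => d%:R^-1 * (\sum_(j < d) (polarprim (th j) x + cos (th j) * ln x)).
  apply/funext => x; by rewrite big_split /= -mulr_suml sc mul0r addr0.
have -> : reflc + d%:R^-1 * (\sum_(j < d) (polarprim (th j) 0 + cos (th j) * ln 0)) =
   d%:R^-1 * (\sum_(j < d) (sin (th j) * (pi - th j) + polarprim (th j) 0)).
  rewrite [in LHS]big_split [in RHS]big_split/= -mulr_suml sc mul0r addr0.
  by rewrite [RHS]mulrDr sum_value.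
apply: cvgMr.
have -> : (fun x => \sum_(j < d) (polarprim (th j) x + cos (th j) * ln x)) =
  \sum_(j < d) (fun x => polarprim (th j) x + cos (th j) * ln x).
  by apply/funext => y; rewrite fct_sumE.
rewrite fct_sumE; apply: cvg_big => [|j _]; first exact: add_continuous.
exact: cvg_polarprim (th_ok (ltn_ord j)) (th_itv (ltn_ord j)).
Qed.

Let reflF_incr a b : 0 <= a < b ->
  exists2 c, a < c < b & reflF b - reflF a = (1 + c ^+ d)^-1 * (b - a).
Proof.
move=> /andP[a0 ab]; apply: mvt_from => // x ax.
by apply: is_derive_reflF; exact: le_trans ax.
Qed.

Lemma reflF_diff_le x : 0 < x -> 0 <= reflF x - reflF 0 <= x.
Proof.
move=> x0; have [|c /andP[c0 cx] ->] := @reflF_incr 0 x; first by rewrite lexx x0.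
have h : 1 <= 1 + c ^+ d by rewrite lerDl exprn_ge0// ltW.
rewrite subr0; have p0 : 0 < 1 + c ^+ d by lra.
rewrite mulr_ge0 ?invr_ge0 ?(ltW p0) ?(ltW x0)//=.
by rewrite ler_piMl// ?invf_le1// ltW.
Qed.

Lemma reflF_le x : 0 <= x -> reflF x - reflF 0 <= reflc.
Proof.
move=> x0; rewrite lerBlDr; apply: (cvgr_to_ge cvg_reflF).
near=> t; have xt : x < t by near: t; apply: nbhs_pinfty_gt; exact: num_real.
have [|c /andP[c0 cx] e] := @reflF_incr x t; first by apply/andP.
have c1 : 0 <= c := le_trans x0 (ltW c0).
have tx : 0 <= t - x by rewrite subr_ge0 ltW.
by rewrite -subr_ge0 e; nneg.
Unshelve. all: by end_near. Qed.

(** The tail of the integral beyond x is at most x^-(d-1), since 1 / (1 + y^d)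
    is at most y^-d. *)
Lemma reflF_ge x : 0 < x -> reflc - x ^- d.-1 <= reflF x - reflF 0.
Proof.
move=> x0; rewrite lerBlDr addrAC lerBrDr; apply: (cvgr_to_le cvg_reflF).
near=> t; have xt : x < t by near: t; apply: nbhs_pinfty_gt; exact: num_real.
have D1 : (0 < d.-1)%N by case: d d_gt1 => [|[]].
pose G y := reflF y + (y ^+ d.-1)^-1.
have dG y : x <= y -> is_derive y 1 G
    ((1 + y ^+ d)^-1 - (y ^+ d.-1) ^- 2 * (d.-1%:R * y ^+ d.-2)).
  move=> xy; have y0 : 0 < y by exact: lt_le_trans xy.
  have h1 := is_derive_reflF (ltW y0).
  have h2 : is_derive y 1 (fun y => y ^+ d.-1) (d.-1%:R * y ^+ d.-2).
    exact: is_derive_pow.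
  have h3 := @is_deriveV R (fun y => y ^+ d.-1) y _ 1 (lt0r_neq0 (exprn_gt0 _ y0)) h2.
  rewrite /G; apply: is_derive_eq; rewrite /GRing.scale /=; ring.
have [c /andP[xc ct] e] := mvt_from dG xt.
have c0 : 0 < c by exact: lt_trans xc.
suff : G t <= G x.
  rewrite /G; have : 0 <= (t ^+ d.-1)^-1 by rewrite invr_ge0 exprn_ge0// ltW// (lt_trans x0).
  lra.
rewrite -subr_ge0 -opprB oppr_ge0 e mulr_le0_ge0 ?subr_ge0 ?(ltW xt)// subr_le0.
have -> : (c ^+ d.-1) ^- 2 * (d.-1%:R * c ^+ d.-2) = d.-1%:R * (c ^+ d)^-1.
  have -> : c ^+ d.-1 = c ^+ d.-2 * c by rewrite -exprSr prednK.
  have -> : c ^+ d = c ^+ d.-2 * c * c by rewrite -!exprSr prednK// prednK// ltnW.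
  by field; rewrite !gt_eqF// exprn_gt0.
have cd : 0 < c ^+ d by rewrite exprn_gt0.
apply: (@le_trans _ _ (c ^+ d)^-1).
  by rewrite lef_pV2 ?posrE//; lra.
by rewrite ler_peMl ?invr_ge0 ?(ltW cd)// ler1n.
Unshelve. all: by end_near. Qed.

Lemma reflc_ge0 : 0 <= reflc.
Proof. by rewrite /reflc divr_ge0 ?pi_ge0// mulr_ge0// ltW. Qed.

(** Riemann sums of C / (y^d + C), which decreases in y and has integral reflc
    C^(1/d) over the half-line; the error terms come from the steps of the
    sum, the part below z and the part above K. *)
Lemma sum_fluid_rate C (z K : nat) : 0 <= C -> (z <= K)%N -> (0 < K)%N ->
  `|\sum_(z <= j < K) C / (j.+1%:R ^+ d + C) - reflc * C `^ d%:R^-1| <=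
  z%:R + 1 + C / K%:R ^+ d.-1.
Proof.
move=> C0 zK K0; have dn0 : d%:R != 0 :> R by rewrite gt_eqF.
have [->|Cn0] := eqVneq C 0.
  rewrite big1; last by move=> *; rewrite mul0r.
  rewrite powR0 ?invr_neq0// mulr0 subr0 normr0 mul0r addr0; have := ler0n R z; lra.
have {C0 Cn0} C0 : 0 < C by rewrite lt0r Cn0.
set c := C `^ d%:R^-1.
have c0 : 0 < c by rewrite powR_gt0.
have cd : c ^+ d = C by rewrite -powR_mulrn ?ltW// -powRrM mulVf// powRr1// ltW.
pose f (j : nat) := (1 + (j%:R / c) ^+ d)^-1.
have fE j : C / (j.+1%:R ^+ d + C) = f j.+1.
  have j0 : 0 < j.+1%:R ^+ d :> R by rewrite exprn_gt0.
  rewrite /f expr_div_n cd; field; rewrite !gt_eqF//; lra.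
under eq_bigr do rewrite fE.
pose Phi (j : nat) := c * reflF (j%:R / c).
have dPhi (j : nat) : f j.+1 <= Phi j.+1 - Phi j <= f j.
  have jc : 0 <= j%:R / c by rewrite divr_ge0// ltW.
  have jc1 : j%:R / c < j.+1%:R / c by rewrite ltr_pM2r ?invr_gt0// ltr_nat.
  have [|x /andP[x1 x2] e] := @reflF_incr (j%:R / c) (j.+1%:R / c); first by apply/andP.
  have -> : Phi j.+1 - Phi j = (1 + x ^+ d)^-1.
    by rewrite /Phi -mulrBr e -mulrBl -natrB// subSnn; field; rewrite !gt_eqF// ltr_pwDl// exprn_ge0// (le_trans jc)// ltW.
  have x0 := le_lt_trans jc x1.
  have h1 : (j%:R / c) ^+ d <= x ^+ d by apply: lerXn2r; rewrite ?nnegrE// ltW.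
  have h2 : x ^+ d <= (j.+1%:R / c) ^+ d.
    by apply: lerXn2r; rewrite ?nnegrE ?ltW// (lt_trans x0).
  have h3 : 0 <= (j%:R / c) ^+ d by rewrite exprn_ge0.
  by rewrite /f !lef_pV2 ?posrE ?lerD2l ?h1 ?h2//; lra.
have up : \sum_(z <= j < K) f j.+1 <= c * reflc.
  apply: (@le_trans _ _ (\sum_(z <= j < K) (Phi j.+1 - Phi j))).
    by apply: ler_sum => j _; case/andP: (dPhi j).
  rewrite telescope_sumr// /Phi -mulrBr ler_pM2l//.
  have K0' : 0 <= K%:R / c by rewrite divr_ge0// ltW.
  apply: le_trans (reflF_le K0'); rewrite lerD2l lerN2 -subr_ge0.
  case: (z) => [|z']; first by rewrite mul0r subrr.
  by case/andP: (@reflF_diff_le (z'.+1%:R / c) (divr_gt0 (ltr0Sn _ _) c0)).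
have lo : c * reflc - C / K%:R ^+ d.-1 - (z%:R + 1) <= \sum_(z <= j < K) f j.+1.
  apply: (@le_trans _ _ (\sum_(z <= j < K) (Phi j.+2 - Phi j.+1))); last first.
    by apply: ler_sum => j _; case/andP: (dPhi j.+1).
  rewrite (telescope_sumr (fun j => Phi j.+1))// /Phi.
  have p1 : 0 < K.+1%:R / c by rewrite divr_gt0.
  have p2 : 0 < z.+1%:R / c by rewrite divr_gt0.
  have q1 := ler_wpM2l (ltW c0) (reflF_ge p1).
  have /andP[_ q2] := reflF_diff_le p2.
  have {}q2 := ler_wpM2l (ltW c0) q2.
  have e2 : c * (z.+1%:R / c) = z%:R + 1 by rewrite -natr1; field; rewrite gt_eqF.
  have e1 : c * (K.+1%:R / c) ^- d.-1 = C / K.+1%:R ^+ d.-1.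
    rewrite -cd expr_div_n invf_div -[in RHS](prednK (ltnW d_gt1)) exprS.
    by rewrite mulrA.
  have h : C / K.+1%:R ^+ d.-1 <= C / K%:R ^+ d.-1.
    rewrite ler_pM2l// lef_pV2 ?posrE ?exprn_gt0 ?ltr0n//.
    by apply: lerXn2r; rewrite ?nnegrE// ler_nat.
  rewrite e2 in q2; rewrite mulrBr e1 in q1; lra.
have t0 : 0 <= C / K%:R ^+ d.-1 by rewrite divr_ge0 ?exprn_ge0// ltW.
rewrite [reflc * _]mulrC ler_norml; apply/andP; split; have := ler0n R z; lra.
Qed.

End Degree.
End Reflection.

(** * The number of descendants found in the fluid phase *)

Section Window.
Variables (R : realType) (d : nat).
Hypothesis d_gt1 : (1 < d)%N.
Let d_gt0 : (0 < d)%N := ltnW d_gt1.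
Local Notation chain := (@chain R d).
Local Notation D := d.-1.

Definition errc : R := 8 * expR 1 * momc R d 4.

Definition errcw (A b : nat) : R :=
  expR 1 * (8 * (A * b)%:R ^+ (2 * d + 3) * noisec R d * (1 + momc R d 2 * b%:R ^+ (2 * d)) +
    2 * (A * b)%:R ^+ 2 * (momc R d 2 * b%:R ^+ (2 * d)) + (A * b)%:R).

Lemma errcw_ge0 A b : 0 <= errcw A b.
Proof.
have := momc_ge0 R d 2; have := noisec_ge0 R d; have := expR_ge0 (1 : R).
by rewrite /errcw; nneg.
Qed.

Let cerr_expand (e a z q M4 M2 nc : R) : z != 0 ->
  e * (a * z) * (2 * (a * z) * (q * (M4 + 4 * nc * (1 + M2) / z)) +
    (2 * (a * z) / z ^+ 2 * M2 + 1)) =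
  2 * e * (a ^+ 2 * q * M4) * z ^+ 2 +
  e * (8 * (a ^+ 2 * q) * nc * (1 + M2) * z + 2 * a ^+ 2 * M2 + a * z).
Proof. by move=> z0; field. Qed.

Let leading_expand (e m b B A nu : R) : b != 0 -> A != 0 ->
  2 * e * (m * (b ^+ 2 * B) / A) * (4 * nu ^+ 2 / b ^+ 2) =
  8 * e * m * B / A * nu ^+ 2.
Proof. by move=> b0 A0; field; rewrite A0 b0. Qed.

Let window_expand (r m A b nu eta E W : R) : A != 0 -> b != 0 -> nu != 0 -> eta != 0 ->
  nu * ((r + m) / A + 2 / b + nu^-1 + eta + (E / A) / eta + (2 * W / nu) / eta) =
  r * (nu / A) + m * (nu / A) + (2 * nu / b + 1 + eta * nu) +
  (eta * nu)^-1 * (E / A * nu ^+ 2 + 2 * W * nu).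
Proof. by move=> A0 b0 n0 e0; field; rewrite A0 b0 n0 e0. Qed.

Section Fixed.
Variables (A b z N : nat) (nu : R).
Hypotheses (A0 : (0 < A)%N) (b0 : (0 < b)%N) (z0 : (0 < z)%N).
Let K := (A * b * z)%N.
Hypothesis KN : (K <= N)%N.
Hypotheses (nu0 : 0 < nu) (nuE : nu ^+ d = N.+1%:R ^+ D).
Hypotheses (nu_le : nu <= (b * z)%:R) (nu_ge : (b * z)%:R <= 2 * nu).

Let K0 : (0 < K)%N. Proof. by rewrite !muln_gt0 A0 b0. Qed.
Let zK : (z <= K)%N.
Proof. by rewrite /K -[leqLHS]mul1n leq_mul2r muln_gt0 A0 b0 orbT. Qed.
Let A0' : 0 < A%:R :> R. Proof. by rewrite ltr0n. Qed.
Let b0' : 0 < b%:R :> R. Proof. by rewrite ltr0n. Qed.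
Let z0' : 0 < z%:R :> R. Proof. by rewrite ltr0n. Qed.
Let K0' : 0 < K%:R :> R. Proof. by rewrite ltr0n. Qed.

Lemma nuK : A%:R * nu <= K%:R.
Proof. by rewrite /K -mulnA natrM ler_pM2l. Qed.

Lemma ratio_z : N.+1%:R ^+ D / z%:R ^+ d <= b%:R ^+ d :> R.
Proof.
rewrite -nuE -expr_div_n; apply: lerXn2r; rewrite ?nnegrE; [nneg|nneg|].
by rewrite ler_pdivrMr// -natrM.
Qed.

Lemma ratio_K : N.+1%:R ^+ D / K%:R ^+ d <= A%:R ^- d :> R.
Proof.
rewrite -nuE -expr_div_n -exprVn; apply: lerXn2r; rewrite ?nnegrE; [nneg|nneg|].
rewrite ler_pdivrMr// mulrC ler_pdivlMr// mulrC; exact: nuK.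
Qed.

Lemma ratio_KD : (N.+1%:R / K%:R) ^+ D <= nu / A%:R.
Proof.
rewrite expr_div_n -nuE -[in nu ^+ d](prednK d_gt0) exprSr.
rewrite ler_pdivrMr ?exprn_gt0//.
have h : nu ^+ D * nu <= (K%:R / A%:R) ^+ D * nu.
  apply: ler_wpM2r; first exact: ltW.
  apply: lerXn2r; rewrite ?nnegrE; [nneg|nneg|].
  by rewrite ler_pdivlMr// mulrC; exact: nuK.
have -> : nu / A%:R * K%:R ^+ D = K%:R ^+ D * nu * A%:R^-1 by ring.
apply: (le_trans h); rewrite expr_div_n mulrAC; apply: ler_wpM2l; first nneg.
rewrite lef_pV2 ?posrE ?exprn_gt0//.
have D1 : (0 < D)%N by case: d d_gt1 => [|[]].
by rewrite ler_eXnr// ler1n.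
Qed.

Lemma cerr_bound : cerr R d N K z <=
  errc * b%:R ^+ (2 * d + 1) / A%:R * nu ^+ 2 + 2 * errcw A b * nu.
Proof.
have m2 := momc_ge0 R d 2; have m4 := momc_ge0 R d 4; have nc := noisec_ge0 R d.
have e0 := expR_ge0 (1 : R).
apply: (le_trans (@cerr_le R d d_gt1 N K z z0 zK KN)).
rewrite /gapc; set M2 := momc R d 2 * _; set M4 := momc R d 4 * _.
set a := (A * b)%:R : R.
have a0 : 0 < a by rewrite /a natrM mulr_gt0.
have Kz : K%:R = a * z%:R by rewrite /K natrM.
have M2_le : M2 <= momc R d 2 * b%:R ^+ (2 * d).
  rewrite /M2 mulnC exprM; apply: ler_wpM2l => //.
  by apply: lerXn2r; rewrite ?nnegrE; [nneg|nneg|exact: ratio_z].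
set M2' := momc R d 2 * b%:R ^+ (2 * d) in M2_le.
have M2'0 : 0 <= M2' by rewrite /M2'; nneg.
have M4_le : a ^+ (2 * d + 3) * M4 <= momc R d 4 * b%:R ^+ (2 * d + 3) / A%:R.
  apply: (@le_trans _ _ (a ^+ (2 * d + 3) * (momc R d 4 * (A%:R ^- d) ^+ 4))).
    apply: ler_wpM2l; first nneg.
    apply: ler_wpM2l => //.
    by apply: lerXn2r; rewrite ?nnegrE; [nneg|nneg|exact: ratio_K].
  rewrite /a natrM exprMn exprVn -exprM.
  have hA : A%:R * A%:R ^+ (2 * d + 3) <= A%:R ^+ (d * 4) :> R.
    rewrite -exprS; apply: ler_weXn2l; first by rewrite ler1n.
    by move: d_gt1; clear; lia.
  have q0 : 0 < A%:R ^+ (d * 4) :> R by rewrite exprn_gt0.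
  have B0 : 0 <= b%:R ^+ (2 * d + 3) :> R by nneg.
  move: (A%:R ^+ (2 * d + 3)) (A%:R ^+ (d * 4)) (b%:R ^+ (2 * d + 3)) hA q0 B0 => p q B hA q0 B0.
  have -> : p * B * (momc R d 4 / q) = momc R d 4 * B * (p / q) by ring.
  apply: ler_wpM2l; first nneg.
  by rewrite ler_pdivrMr// mulrC ler_pdivlMr// mulrC.
rewrite Kz mulfK ?gt_eqF//.
have iz : z%:R^-1 <= 1 :> R by rewrite invf_le1// ler1n.
have z1 : 1 <= z%:R :> R by rewrite ler1n.
have ad3 : a ^+ (2 * d + 3) = a ^+ 2 * a ^+ (2 * d + 1).
  by rewrite -exprD; congr (_ ^+ _); clear; lia.
rewrite cerr_expand ?gt_eqF// -ad3.
have zz : z%:R <= 2 * nu / b%:R.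
  by rewrite ler_pdivlMr// mulrC -natrM.
have z2 : z%:R ^+ 2 <= 4 * nu ^+ 2 / b%:R ^+ 2.
  have -> : 4 * nu ^+ 2 / b%:R ^+ 2 = (2 * nu / b%:R) ^+ 2.
    by rewrite expr_div_n exprMn; congr (_ * _ / _); ring.
  by apply: lerXn2r; rewrite ?nnegrE; [nneg|nneg|].
have zn : z%:R <= 2 * nu.
  by apply: le_trans nu_ge; rewrite ler_nat leq_pmull.
apply: lerD.
  apply: (@le_trans _ _ (2 * expR 1 * (momc R d 4 * b%:R ^+ (2 * d + 3) / A%:R) *
     (4 * nu ^+ 2 / b%:R ^+ 2))).
    apply: ler_pM; [|nneg| |exact: z2].
      by rewrite /M4; nneg.
    by apply: ler_wpM2l => //; nneg.
  have -> : b%:R ^+ (2 * d + 3) = b%:R ^+ 2 * b%:R ^+ (2 * d + 1) :> R.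
    by rewrite -exprD; congr (_ ^+ _); clear; lia.
  by rewrite leading_expand ?gt_eqF// /errc.
apply: (@le_trans _ _ (errcw A b * z%:R)).
  rewrite /errcw -/a -/M2' -[leRHS]mulrA; apply: ler_wpM2l => //.
  rewrite [leRHS]mulrDl [X in _ <= X + _]mulrDl; apply: lerD => //; apply: lerD.
    apply: ler_wpM2r => //; apply: ler_wpM2l; first nneg.
    by rewrite lerD2l.
  apply: (@le_trans _ _ (2 * a ^+ 2 * M2')).
    by apply: ler_wpM2l => //; nneg.
  by rewrite ler_peMr//; nneg.
rewrite -mulrA mulrCA; apply: ler_wpM2l => //; exact: errcw_ge0.
Qed.

Definition winc : R := rising R 1 1 + momc R d 1.

(** Here nu is about N^((d-1)/d), z about nu / b and K about A nu. The number
    of vertices found between z and K is close to its fluid prediction by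
    cerr_bound; this prediction is the Riemann sum of sum_fluid_rate; and the
    vertices found above K contribute at most of order nu / A. The bound is
    small relative to nu if b is large and eta small, then A large, then nu
    large. *)
Lemma window_approx eta : 0 < eta ->
  chain2 d N K z (fun x0 y0 x y =>
    `|x%:R - reflc R d * (charge R d K y0) `^ d%:R^-1|) <=
  nu * (winc / A%:R + 2 / b%:R + nu^-1 + eta +
        (errc * b%:R ^+ (2 * d + 1) / A%:R) / eta + (2 * errcw A b / nu) / eta).
Proof.
move=> eta0.
have en0 : 0 < eta * nu by rewrite mulr_gt0.
apply: (@le_trans _ _ (chain2 d N K z (fun x0 y0 x y =>
    (((x0 + 1)%:R ^+ 1 + y0%:R ^+ 1) + (z%:R + 1 + eta * nu)) +
    (eta * nu)^-1 * count_error R d K z x0 y0 x y ^+ 2))).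
  apply: le_chain2 => // x0 y0 x y _ _.
  have c0 := charge_ge0 R d K y0.
  have hs := sum_fluid_rate d_gt1 c0 zK K0.
  have -> : x%:R - reflc R d * (charge R d K y0) `^ d%:R^-1 =
    x0%:R + count_error R d K z x0 y0 x y +
    (\sum_(z <= j < K) charge R d K y0 / (j.+1%:R ^+ d + charge R d K y0) -
     reflc R d * (charge R d K y0) `^ d%:R^-1).
    by rewrite /count_error /fluid_rate; ring.
  apply: (le_trans (ler_normD _ _)).
  have ey : charge R d K y0 / K%:R ^+ D = y0%:R.
    by rewrite /charge mulrAC divff ?mul1r// gt_eqF// exprn_gt0.
  rewrite ey in hs; rewrite !expr1.
  have {hs} := lerD (ler_normD x0%:R (count_error R d K z x0 y0 x y)) hs.
  move=> /le_trans; apply; rewrite ger0_norm//.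
  set g := count_error _ _ _ _ _ _ _ _.
  have : `|g| <= eta * nu + (eta * nu)^-1 * g ^+ 2.
    rewrite -real_normK ?num_real//; move: `|g| (normr_ge0 g) => h h0.
    rewrite -(ler_pM2l en0) mulrDr mulVKf ?gt_eqF//.
    have := sqr_ge0 (eta * nu - h); have := ltW en0; nra.
  rewrite natrD; lra.
rewrite 2!chain2D chain2_cst chain2Z -/(cerr _ _ _ _ _).
have Kl : (K <= N)%N := KN.
have e12 : chain2 d N K z (fun x0 y0 _ _ => (x0 + 1)%:R ^+ 1 + y0%:R ^+ 1) =
    chain N K (fun x _ => (x + 1)%:R ^+ 1) 1 d + chain N K (fun _ y => y%:R ^+ 1) 1 d.
  by rewrite -chainD; apply: eq_chain => x y; rewrite chain_cst.
rewrite e12.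
have NK : (N.+1%:R / K.+1%:R) ^+ (1 * D) <= nu / A%:R :> R.
  rewrite mul1n; apply: le_trans ratio_KD; apply: lerXn2r; rewrite ?nnegrE; [nneg|nneg|].
  by rewrite ler_pM2l ?ltr0n// lef_pV2 ?posrE ?ltr0n// ler_nat.
have h1 : chain N K (fun x _ => (x + 1)%:R ^+ 1) 1 d <= rising R 1 1 * (nu / A%:R).
  apply: (le_trans (moment_found R d_gt1 1 KN)).
  by apply: ler_wpM2l => //; exact/ltW/rising_gt0.
have h2 : chain N K (fun _ y => y%:R ^+ 1) 1 d <= momc R d 1 * (nu / A%:R).
  apply: (le_trans (moment_pending R d_gt1 1 KN)).
  by apply: ler_wpM2l => //; exact: momc_ge0.
have zz : z%:R <= 2 * nu / b%:R.
  by rewrite ler_pdivlMr// mulrC -natrM.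
have ie : 0 <= (eta * nu)^-1 by rewrite invr_ge0 ltW.
have h3 := ler_wpM2l ie cerr_bound.
rewrite /winc window_expand ?gt_eqF//.
by apply: lerD => //; apply: lerD; [exact: lerD|]; rewrite !lerD2r.
Qed.

End Fixed.
End Window.

(** * Convergence of the Laplace transform *)

Section LaplaceLimit.
Variables (R : realType) (d : nat).
Hypothesis d_gt1 : (1 < d)%N.
Let d_gt0 : (0 < d)%N := ltnW d_gt1.
Local Notation chain := (@chain R d).
Local Notation D := d.-1.

Let D_gt0 : (0 < D)%N. Proof. by case: d d_gt1 => [|[]]. Qed.

(** All that matters about the final stage of the exploration is that it
    averages f over numbers of descendants exceeding x by at most m. *)
Definition averaging m (tm : (nat -> R) -> nat -> nat -> R) :=
  forall f x y a c, (forall i, (i <= m)%N -> a <= f (x + i)%N <= c) ->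
    a <= tm f x y <= c.

(** Each vertex treated is at most one more descendant. *)
Lemma chain_averaging m l tm : averaging m tm -> (m <= l)%N ->
  averaging l (fun f => chain l m (tm f)).
Proof.
move=> htm; elim: l => [|l IH].
  by rewrite leqn0 => /eqP m0 f x y a c; rewrite -m0 chain_id; exact: htm.
rewrite leq_eqVlt => /predU1P[<-|]; first by move=> f x y a c; rewrite chain_id; exact: htm.
rewrite ltnS => ml f x y a c h; rewrite chainS//.
have H z : (z <= y)%N -> a <= chain l m (tm f) (x + (0 < z)%N) (y - z + d * (0 < z)%N) <= c.
  move=> zy; apply: IH => // i il; rewrite -addnA; apply: h.
  by case: (0 < z)%N; rewrite ?add1n ?ltnS// add0n (leq_trans il).
apply/andP; split.
  rewrite -(binexp_cst l.+1%:R^-1 y a); apply: le_binexp; first exact: pinv_itv.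
  by move=> z /H /andP[].
rewrite -(binexp_cst l.+1%:R^-1 y c); apply: le_binexp; first exact: pinv_itv.
by move=> z /H /andP[].
Qed.

Lemma chain_lipschitz m l tm f L x y : averaging m tm -> (m <= l)%N ->
  (forall i, (i <= l)%N -> `|f (x + i)%N - f x| <= L) ->
  `|chain l m (tm f) x y - f x| <= L.
Proof.
move=> htm ml h.
have := @chain_averaging m l tm htm ml f x y (f x - L) (f x + L).
rewrite ler_norml => H.
have /H /andP[? ?] : forall i, (i <= l)%N -> f x - L <= f (x + i)%N <= f x + L.
  move=> i il; have := h i il.
  by rewrite ler_norml => /andP[? ?]; apply/andP; split; lra.
by apply/andP; split; lra.
Qed.

Lemma stretched_exp_lip t (u v : R) : 0 <= t -> 0 <= u -> 0 <= v ->
  `|expR (- (t * u ^+ d)) - expR (- (t * v ^+ d))| <= d%:R * (t + 1) * `|u - v|.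
Proof.
move=> t0; wlog uv : u v / u < v => [H u0 v0|u0 v0].
  have [uv|vu|->] := ltgtP u v; first exact: H.
    by rewrite distrC [`|u - v|]distrC; apply: H.
  by rewrite !subrr normr0 mulr0.
pose g y := expR (- (t * y ^+ d)).
have dg y : u <= y -> is_derive y 1 g (g y * (- (t * (d%:R * y ^+ D)))).
  move=> uy; have h1 := @is_derive_pow R d y.
  have h2 : is_derive y 1 (fun y => - (t * y ^+ d)) (- (t * (d%:R * y ^+ D))).
    exact: is_deriveN.
  exact: is_derive1_comp.
have [c /andP[uc cv] e] := mvt_from dg uv.
rewrite distrC [`|u - v|]distrC -/(g u) -/(g v) e normrM.
apply: ler_wpM2r; first exact: normr_ge0.
have c0 : 0 <= c by exact: le_trans (ltW uc).
have g0 : 0 < g c by exact: expR_gt0.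
have g1 : g c <= 1 by rewrite expR_le1 oppr_le0 mulr_ge0// exprn_ge0.
rewrite mulrN normrN ger0_norm; last by apply: mulr_ge0; [exact: ltW|nneg].
have -> : g c * (t * (d%:R * c ^+ D)) = d%:R * (t * c ^+ D * g c) by ring.
apply: ler_wpM2l => //.
have cD0 : 0 <= c ^+ D by rewrite exprn_ge0.
have [c1|c1] := leP c 1.
  have cD1 : c ^+ D <= 1 by rewrite exprn_ile1.
  have : t * c ^+ D * g c <= t * c ^+ D by rewrite ler_piMr// mulr_ge0.
  have : t * c ^+ D <= t by rewrite ler_piMr.
  lra.
have cDd : c ^+ D <= c ^+ d by rewrite ler_weXn2l ?leq_pred// ltW.
apply: (@le_trans _ _ (t * c ^+ d * g c)).
  by apply: ler_wpM2r; [exact: ltW|apply: ler_wpM2l].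
have := expR_ge1Dx (t * c ^+ d); rewrite /g expRN => h.
rewrite ler_pdivrMr ?expR_gt0//.
have : expR (t * c ^+ d) <= (t + 1) * expR (t * c ^+ d).
  by rewrite ler_peMl ?expR_ge0// lerDr.
have := ler0n R 1; lra.
Qed.

Definition scale n : R := n%:R `^ ((d%:R - 1) / d%:R).

Let dR0 : d%:R != 0 :> R. Proof. by rewrite pnatr_eq0 -lt0n. Qed.
Let DE : d%:R - 1 = D%:R :> R.
Proof. by rewrite -[in d%:R](prednK d_gt0) -natr1 addrK. Qed.

Lemma scale_gt0 n : (0 < n)%N -> 0 < scale n.
Proof. by move=> n0; rewrite powR_gt0// ltr0n. Qed.

Lemma scaleE n : scale n ^+ d = n%:R ^+ D.
Proof.
rewrite -powR_mulrn; last exact: powR_ge0.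
by rewrite -powRrM divfK// DE powR_mulrn.
Qed.

Lemma scale_unbounded (M : R) : \forall n \near \oo, M <= scale n.
Proof.
have [M0|M0] := leP M 0; first by near=> n; exact: le_trans (powR_ge0 _ _).
near=> n.
have n0 : (0 < n)%N by near: n; exact: nbhs_infty_gt.
have nM : M ^+ d <= n%:R by near: n; exact: nbhs_infty_ger.
have h : M ^+ d <= scale n ^+ d.
  by rewrite scaleE; apply: (le_trans nM); rewrite ler_eXnr// ler1n.
by move: h; rewrite ler_pXn2r// nnegrE ltW// scale_gt0.
Unshelve. all: by end_near. Qed.

Lemma scale_small (e : R) : 0 < e -> \forall n \near \oo, scale n <= e * n%:R.
Proof.
move=> e0; near=> n.
have n0 : (0 < n)%N by near: n; exact: nbhs_infty_gt.
have n0' : 0 < n%:R :> R by rewrite ltr0n.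
have ne : e ^- d <= n%:R by near: n; exact: nbhs_infty_ger.
have h : scale n ^+ d <= (e * n%:R) ^+ d.
  rewrite scaleE exprMn -[in n%:R ^+ d](prednK d_gt0) exprS mulrA.
  rewrite ler_peMl ?exprn_ge0//.
  by rewrite -(ler_pM2l (_ : 0 < e ^- d)) ?invr_gt0 ?exprn_gt0// mulr1 mulKf// expf_neq0// gt_eqF.
by move: h; rewrite ler_pXn2r// nnegrE ?mulr_ge0 ?ltW// scale_gt0.
Unshelve. all: by end_near. Qed.

Variables (m : nat -> nat) (tm : nat -> (nat -> R) -> nat -> nat -> R).
Hypothesis htm : forall n, averaging (m n) (tm n).
Hypothesis hm : forall e : R, 0 < e -> \forall n \near \oo, (m n)%:R <= e * scale n.

Definition law n f := chain n.-1 (m n) (tm n f) 1 d.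

(** The Laplace transform at t of reflc^d (d - 1) gamma, for gamma with the
    Gamma law of parameter d / (d - 1). *)
Definition limit_laplace t : R := (1 + D%:R * (t * reflc R d ^+ d)) `^ (- (d%:R / D%:R)).

Section Step.
Variables (A b : nat).
Hypotheses (A0 : (0 < A)%N) (b0 : (0 < b)%N).

Let zf n : nat := (Num.truncn (scale n / b%:R)).+1.
Let Kf n : nat := (A * b * zf n)%N.

Lemma near_sizes : \forall n \near \oo, [/\ (1 < n)%N, scale n <= (b * zf n)%:R,
   (b * zf n)%:R <= 2 * scale n, (m n <= zf n)%N & (Kf n <= n.-1)%N].
Proof.
near=> n.
have n1 : (1 < n)%N by near: n; exact: nbhs_infty_gt.
have s0 := scale_gt0 (ltnW n1).
have b0' : 0 < b%:R :> R by rewrite ltr0n.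
have sb0 : 0 <= scale n / b%:R by rewrite divr_ge0// ltW.
have h1 : scale n <= (b * zf n)%:R.
  have := truncnS_gt (scale n / b%:R); rewrite ltr_pdivrMr// natrM mulrC => h.
  exact: ltW.
have bs : b%:R <= scale n by near: n; exact: scale_unbounded.
have h2 : (b * zf n)%:R <= 2 * scale n.
  have := @truncn_le R (scale n / b%:R); rewrite sb0 ler_pdivlMr// => h.
  by rewrite natrM /zf -natr1 mulrDr mulr1 mulrC; lra.
split => //.
  have hmn : (m n)%:R <= b%:R^-1 * scale n.
    by near: n; apply: hm; rewrite invr_gt0 ltr0n.
  rewrite -ltnS /zf ltnS -(ler_nat R); apply: le_trans hmn _.
  by rewrite mulrC; have := truncnS_gt (scale n / b%:R) => /ltW.
have hs : scale n <= (4 * A%:R)^-1 * n%:R.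
  by near: n; apply: scale_small; rewrite invr_gt0 mulr_gt0// ltr0n.
have KA : (Kf n)%:R <= 2 * A%:R * scale n.
  by rewrite /Kf -mulnA natrM -mulrA mulrCA; apply: ler_wpM2l.
have : (Kf n)%:R <= n.-1%:R :> R; last by rewrite ler_nat.
apply: (le_trans KA).
have -> : n.-1%:R = n%:R - 1 :> R by rewrite -[in RHS](prednK (ltnW n1)) -natr1 addrK.
have A0' : 0 < A%:R :> R by rewrite ltr0n.
apply: (@le_trans _ _ (n%:R / 2)).
  have -> : n%:R / 2 = 2 * A%:R * ((4 * A%:R)^-1 * n%:R) :> R.
    by field; rewrite gt_eqF.
  by apply: ler_wpM2l => //; nneg.
have : 2 <= n%:R :> R by rewrite (ler_nat R 2).
lra.
Unshelve. all: by end_near. Qed.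

Definition bracket eta : R := winc R d / A%:R + 2 / b%:R + eta +
  (errc R d * b%:R ^+ (2 * d + 1) / A%:R) / eta.

Variables (t eta : R).
Hypotheses (t0 : 0 < t) (eta0 : 0 < eta).

Let th := t * reflc R d ^+ d.
Let th_ge0 : 0 <= th.
Proof. by rewrite /th; have := reflc_ge0 R d_gt1; nneg. Qed.
Let sf n := expR (- (th * ((Kf n)%:R / n%:R) ^+ D)).
Let L : R := d%:R * (t + 1).
Let L0 : 0 <= L. Proof. by rewrite /L; nneg. Qed.

(** The number of descendants may be replaced by the fluid prediction reflc
    (K^(d-1) y)^(1/d). In the function exp (- t (x / scale)^d) this turns the
    d-th power into a multiple of y, so that a power s ^+ y is left to average
    over the branching phase. *)
Lemma law_window : \forall n \near \oo,
  `|law n (fun x => expR (- (t * (x%:R / scale n) ^+ d))) -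
    chain n.-1 (Kf n) (fun _ y => sf n ^+ y) 1 d| <=
  L * (2 / b%:R + bracket eta + ((1 + 2 * errcw R d A b / eta) / scale n)).
Proof.
near=> n.
have [n1 h1 h2 mz KN] : [/\ (1 < n)%N, scale n <= (b * zf n)%:R,
   (b * zf n)%:R <= 2 * scale n, (m n <= zf n)%N & (Kf n <= n.-1)%N].
  by near: n; exact: near_sizes.
have s0 := scale_gt0 (ltnW n1).
have b0' : 0 < b%:R :> R by rewrite ltr0n.
have nS : n.-1.+1 = n by rewrite prednK// ltnW.
have z0 : (0 < zf n)%N by [].
have zK : (zf n <= Kf n)%N.
  by rewrite /Kf -[leqLHS]mul1n leq_mul2r muln_gt0 A0 b0 orbT.
pose f (x : nat) := expR (- (t * (x%:R / scale n) ^+ d)).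
have flip (u v : R) : 0 <= u -> 0 <= v ->
   `|expR (- (t * (u / scale n) ^+ d)) - expR (- (t * (v / scale n) ^+ d))| <=
   L * (`|u - v| / scale n).
  move=> u0 v0; have := @stretched_exp_lip t (u / scale n) (v / scale n) (ltW t0).
  rewrite -mulrBl normrM [`|(scale n)^-1|]ger0_norm ?invr_ge0 ?(ltW s0)//.
  by apply; rewrite divr_ge0// ltW.
have E1 : `|law n f - chain n.-1 (zf n) (fun x _ => f x) 1 d| <= L * (2 / b%:R).
  rewrite /law (@chain_comp _ _ n.-1 (zf n) (m n)) ?mz ?(leq_trans zK)//.
  rewrite -[leRHS](chain_cst d n.-1 (zf n) _ 1 d).
  apply: chain_dist => //; first exact: reachable_start.
  move=> x y _; apply: chain_lipschitz => // i iz.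
  apply: (le_trans (flip _ _ (ler0n _ _) (ler0n _ _))); apply: ler_wpM2l => //.
  rewrite natrD addrAC subrr add0r ger0_norm// ler_pdivrMr// mulrAC ler_pdivlMr//.
  by apply: le_trans h2; rewrite -natrM ler_nat mulnC leq_mul2l iz orbT.
have E2 : `|chain n.-1 (zf n) (fun x _ => f x) 1 d -
    chain n.-1 (Kf n) (fun _ y => sf n ^+ y) 1 d| <=
    L * (bracket eta + ((1 + 2 * errcw R d A b / eta) / scale n)).
  rewrite -(@chain2_marg R d n.-1 (Kf n) (zf n) (fun x _ => f x)) ?zK//.
  have -> : chain n.-1 (Kf n) (fun _ y => sf n ^+ y) 1 d =
     chain2 d n.-1 (Kf n) (zf n) (fun _ y0 _ _ => expR (- (t * ((reflc R d * charge R d (Kf n) y0 `^ d%:R^-1) / scale n) ^+ d))).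
    apply: eq_chain => x y; rewrite chain_cst /sf -expRM_natr; congr expR.
    rewrite mulNr; congr (- _).
    rewrite [in RHS]expr_div_n scaleE [in RHS]exprMn /th.
    have -> : (charge R d (Kf n) y `^ d%:R^-1) ^+ d = charge R d (Kf n) y.
      rewrite -powR_mulrn ?powR_ge0// -powRrM mulVf// powRr1//; exact: charge_ge0.
    rewrite /charge; move: (reflc R d ^+ d) => u.
    by rewrite expr_div_n; ring.
  apply: (@le_trans _ _ (chain2 d n.-1 (Kf n) (zf n) (fun x0 y0 x y =>
     (L / scale n) * `|x%:R - reflc R d * (charge R d (Kf n) y0) `^ d%:R^-1|))).
    apply: chain_dist => //; first exact: reachable_start.
    move=> x0 y0 xy0; apply: chain_dist => // x y _.
    apply: le_trans (flip _ _ (ler0n _ _) _) _.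
      by rewrite mulr_ge0 ?powR_ge0// reflc_ge0.
    by rewrite mulrCA mulrC.
  rewrite chain2Z.
  have nuE : scale n ^+ d = n.-1.+1%:R ^+ D by rewrite nS scaleE.
  have hw := @window_approx R d d_gt1 A b (zf n) n.-1 (scale n) A0 b0 z0 KN s0 nuE h1 h2 eta eta0.
  have Ls0 : 0 <= L / scale n by rewrite divr_ge0// ltW.
  apply: (le_trans (ler_wpM2l Ls0 hw)).
  have A0' : 0 < A%:R :> R by rewrite ltr0n.
  rewrite le_eqVlt; apply/orP; left; apply/eqP; rewrite /bracket.
  by move: (b%:R ^+ (2 * d + 1)) => q; field; rewrite !gt_eqF.
set c0 := chain _ _ (fun x _ => f x) _ _ in E1 E2.
have := lerD E1 E2; have := ler_distD c0 (law n f) (chain n.-1 (Kf n) (fun _ y => sf n ^+ y) 1 d).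
move=> /le_trans h /h{h} /le_trans; apply.
by rewrite -mulrDr addrA.
Unshelve. all: by end_near. Qed.

Let sf_itv n : 0 < sf n <= 1.
Proof. by rewrite /sf expR_gt0/= expR_le1 oppr_le0; nneg. Qed.

Let xf n : R := D%:R * th * ((Kf n)%:R / n%:R) ^+ D.

Let odds_sf n : odds d (sf n) = expR (xf n) - 1.
Proof.
rewrite /odds /sf -expRM_natr -expRN; congr (expR _ - 1).
by rewrite /xf; ring.
Qed.

Let expR_small (x : R) : 0 <= x <= 2^-1 -> x <= expR x - 1 <= x * (1 + 2 * x).
Proof.
move=> /andP[x0 x1]; have h1 := expR_ge1Dx x; have h2 := expR_ge1Dx (- x).
have e : expR x * expR (- x) = 1 by rewrite -expRD subrr expR0.
have e0 := expR_gt0 x.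
apply/andP; split; first lra.
have := ler_wpM2l (ltW e0) h2; rewrite e.
move: (expR x) e0 => y y0 h.
have : (y - 1 - x * (1 + 2 * x)) * (1 - x) <= 0.
  have : 0 <= x ^+ 2 * (1 - 2 * x) by rewrite mulr_ge0 ?sqr_ge0//; lra.
  lra.
have : 0 < 1 - x by lra.
nra.
Qed.

Let xf_small (e : R) : 0 < e -> \forall n \near \oo, 0 <= xf n <= e.
Proof.
move=> e0; set c := D%:R * th; have Dth0 : 0 <= c by rewrite /c; nneg.
have A0' : 0 < A%:R :> R by rewrite ltr0n.
have E0 : 0 < e / (2 * A%:R * (c + 1)).
  by rewrite divr_gt0// mulr_gt0//; [exact: mulr_gt0|lra].
near=> n.
have [n1 h1 h2 mz KN] : [/\ (1 < n)%N, scale n <= (b * zf n)%:R,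
   (b * zf n)%:R <= 2 * scale n, (m n <= zf n)%N & (Kf n <= n.-1)%N].
  by near: n; exact: near_sizes.
have n0 : 0 < n%:R :> R by rewrite ltr0n ltnW.
apply/andP; split; first by rewrite /xf; nneg.
have r0 : 0 <= (Kf n)%:R / n%:R :> R by nneg.
have r1 : (Kf n)%:R / n%:R <= 1 :> R.
  by rewrite ler_pdivrMr// mul1r ler_nat (leq_trans KN)// leq_pred.
have hs : scale n <= (e / (2 * A%:R * (c + 1))) * n%:R.
  by near: n; exact: scale_small.
apply: (@le_trans _ _ (c * ((Kf n)%:R / n%:R))).
  rewrite /xf -/c; apply: ler_wpM2l => //.
  by rewrite -(prednK D_gt0) exprS ler_piMr// exprn_ile1.
have KA : (Kf n)%:R <= 2 * A%:R * scale n.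
  by rewrite /Kf -mulnA natrM -mulrA mulrCA; apply: ler_wpM2l.
rewrite mulrA ler_pdivrMr//.
apply: (@le_trans _ _ (c * (2 * A%:R * (e / (2 * A%:R * (c + 1)) * n%:R)))).
  apply: ler_wpM2l => //; apply: (le_trans KA); apply: ler_wpM2l => //; nneg.
have -> : c * (2 * A%:R * (e / (2 * A%:R * (c + 1)) * n%:R)) = (e * n%:R) * (c / (c + 1)).
  by field; rewrite !gt_eqF//; lra.
rewrite ler_piMr//; first by nneg.
by rewrite ler_pdivrMr; lra.
Unshelve. all: by end_near. Qed.

Definition powc : R := 4 * d%:R * momc R d 2 * D%:R.

Let wf n := wt d (Kf n) (sf n) (n.-1 - Kf n).

Lemma law_pow : \forall n \near \oo,
  `|chain n.-1 (Kf n) (fun _ y => sf n ^+ y) 1 d - wf n ^+ d| <= powc * th / A%:R.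
Proof.
near=> n.
have [n1 h1 h2 mz KN] : [/\ (1 < n)%N, scale n <= (b * zf n)%:R,
   (b * zf n)%:R <= 2 * scale n, (m n <= zf n)%N & (Kf n <= n.-1)%N].
  by near: n; exact: near_sizes.
have A0' : 0 < A%:R :> R by rewrite ltr0n.
have n0 : 0 < n%:R :> R by rewrite ltr0n ltnW.
have nS : n.-1.+1 = n by rewrite prednK// ltnW.
have s0 := scale_gt0 (ltnW n1).
have K0 : (0 < Kf n)%N by rewrite /Kf !muln_gt0 A0 b0.
have K0' : 0 < (Kf n)%:R :> R by rewrite ltr0n.
have KK : (0 < Kf n <= n.-1)%N by rewrite K0.
apply: (le_trans (chain_pow d_gt1 KK (sf_itv n))).
have /andP[x0 x1] : 0 <= xf n <= 2^-1 by near: n; apply: xf_small; rewrite invr_gt0.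
have ho : odds d (sf n) <= 2 * xf n.
  rewrite odds_sf; have /expR_small/andP[_ h] : 0 <= xf n <= 2^-1 by rewrite x0.
  apply: (le_trans h); nra.
have m2 := momc_ge0 R d 2.
rewrite nS.
apply: (@le_trans _ _ (2 * d%:R * momc R d 2 * (2 * xf n) * n%:R ^+ (2 * D) /
    (Kf n)%:R ^+ (2 * D).+1)).
  apply: ler_wpM2r; first nneg.
  apply: ler_wpM2r; first nneg.
  by apply: ler_wpM2l => //; nneg.
have nuE : scale n ^+ d = n.-1.+1%:R ^+ D by rewrite nS scaleE.
have rK := @ratio_K R d A b (zf n) n.-1 (scale n) A0 b0 isT s0 nuE h1.
rewrite nS in rK.
have -> : 2 * d%:R * momc R d 2 * (2 * xf n) * n%:R ^+ (2 * D) / (Kf n)%:R ^+ (2 * D).+1 =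
   powc * th * (n%:R ^+ D / (Kf n)%:R ^+ d).
  rewrite -[in X in _ = _ * (_ / _ ^+ X)](prednK d_gt0).
  rewrite /xf /powc !exprS mul2n -addnn !exprD expr_div_n.
  have := lt0r_neq0 (exprn_gt0 D K0'); have := lt0r_neq0 (exprn_gt0 D n0).
  move: (n%:R ^+ D) ((Kf n)%:R ^+ D) (lt0r_neq0 K0') => u v w u0 v0.
  by field; rewrite u0 v0 w.
apply: ler_wpM2l; first by rewrite /powc; nneg.
apply: (le_trans rK); rewrite lef_pV2 ?posrE ?exprn_gt0// ler_eXnr// ler1n//.
Unshelve. all: by end_near. Qed.

Let odds_near (e : R) : 0 < e -> \forall n \near \oo, `|odds d (wf n) - D%:R * th| <= e.
Proof.
move=> e0; set c := D%:R * th; have c0 : 0 <= c by rewrite /c; nneg.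
have E0 : 0 < e / (2 * c + 1) by rewrite divr_gt0//; lra.
near=> n.
have [n1 h1 h2 mz KN] : [/\ (1 < n)%N, scale n <= (b * zf n)%:R,
   (b * zf n)%:R <= 2 * scale n, (m n <= zf n)%N & (Kf n <= n.-1)%N].
  by near: n; exact: near_sizes.
have n0 : 0 < n%:R :> R by rewrite ltr0n ltnW.
have nS : n.-1.+1 = n by rewrite prednK// ltnW.
have K0 : (0 < Kf n)%N by rewrite /Kf !muln_gt0 A0 b0.
have K0' : 0 < (Kf n)%:R :> R by rewrite ltr0n.
have D0 : 0 <= D%:R :> R by [].
have /andP[x0 x1] : 0 <= xf n <= 2^-1 by near: n; apply: xf_small; rewrite invr_gt0.
have /andP[_ x2] : 0 <= xf n <= e / (2 * c + 1).
  by near: n; exact: xf_small.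
have /expR_small/andP[ho1 ho2] : 0 <= xf n <= 2^-1 by rewrite x0.
rewrite -odds_sf in ho1 ho2.
have up := odds_wt_le d (n.-1 - Kf n) K0 (sf_itv n).
have lo := odds_wt_ge d_gt1 (n.-1 - Kf n) K0 (sf_itv n).
rewrite subnKC// in up lo; rewrite -/(wf n) in up lo.
have up2 : odds d (wf n) <= c * (1 + 2 * xf n).
  apply: (le_trans up).
  apply: (@le_trans _ _ ((n%:R / (Kf n)%:R) ^+ D * (xf n * (1 + 2 * xf n)))).
    have o0 : 0 <= odds d (sf n) by exact: le_trans ho1.
    apply: ler_pM => //; first nneg.
    apply: lerXn2r; rewrite ?nnegrE; [nneg|nneg|].
    by rewrite ler_pM2r ?invr_gt0// ler_nat leq_pred.
  rewrite {1}/xf -/c mulrA [_ * (c * _)]mulrCA -exprMn.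
  by rewrite mulrA divfK ?gt_eqF// divff ?gt_eqF// expr1n mulr1.
have K1 : 0 < (Kf n + D)%:R :> R by rewrite ltr0n addn_gt0 K0.
have lo2 : c * (1 - D%:R ^+ 2 / (Kf n)%:R) <= odds d (wf n).
  apply: le_trans lo.
  apply: (@le_trans _ _ ((n%:R / (Kf n + D)%:R) ^+ D * xf n)); last first.
    apply: ler_pM => //; first nneg.
    apply: lerXn2r; rewrite ?nnegrE; [nneg|nneg|].
    by rewrite ler_pM2r ?invr_gt0// ler_nat; move: D_gt0 n1; clear; lia.
  rewrite {1}/xf -/c mulrCA -exprMn; apply: ler_wpM2l => //.
  have -> : n%:R / (Kf n + D)%:R * ((Kf n)%:R / n%:R) = 1 - D%:R / (Kf n + D)%:R :> R.
    by rewrite natrD; field; rewrite !gt_eqF//; lra.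
  have p01 : 0 <= (D%:R / (Kf n + D)%:R : R) <= 1.
    by rewrite divr_ge0//= ler_pdivrMr// mul1r ler_nat leq_addl.
  apply: le_trans (bernoulli_le D p01); rewrite lerD2l lerN2.
  rewrite mulrAC -expr2 ler_wpM2l ?sqr_ge0// lef_pV2 ?posrE// ler_nat leq_addr//.
have hK : c * D%:R ^+ 2 / e <= (Kf n)%:R.
  apply: (@le_trans _ _ (scale n)); first by near: n; exact: scale_unbounded.
  apply: (le_trans h1); rewrite ler_nat /Kf -mulnA leq_pmull//.
have l3 : c * (D%:R ^+ 2 / (Kf n)%:R) <= e.
  by rewrite ler_pdivrMr// in hK; rewrite mulrA ler_pdivrMr// [e * _]mulrC.
have l4 : c * (2 * xf n) <= e.
  apply: (@le_trans _ _ (c * (2 * (e / (2 * c + 1))))).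
    by apply: ler_wpM2l => //; lra.
  have -> : c * (2 * (e / (2 * c + 1))) = e * (2 * c / (2 * c + 1)).
    by field; rewrite gt_eqF//; lra.
  by rewrite ler_piMr ?(ltW e0)// ler_pdivrMr; lra.
by rewrite ler_norml; apply/andP; split; lra.
Unshelve. all: by end_near. Qed.

Let powR_odds (w : R) : 0 < w <= 1 -> w ^+ d = (1 + odds d w) `^ (- (d%:R / D%:R)).
Proof.
move=> /andP[w0 _]; rewrite /odds addrC subrK -powR_mulrn ?ltW//.
rewrite -powR_invn ?ltW// -powRrM; congr (_ `^ _).
by field; rewrite pnatr_eq0 -lt0n.
Qed.

(** In the branching phase odds multiplies by about (n / K)^(d-1), while at
    the start it is about (d - 1) th (K / n)^(d-1), so K disappears from the
    limit. *)
Lemma law_laplace_near (e : R) : 0 < e -> \forall n \near \oo,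
  `|wf n ^+ d - limit_laplace t| <= e.
Proof.
move=> e0; pose h (o : R) := (1 + o) `^ (- (d%:R / D%:R)).
have c0 : 0 <= D%:R * th by nneg.
have ch : {for D%:R * th, continuous h}.
  apply: (@continuous_comp _ _ _ (fun o : R => 1 + o) (fun x => x `^ (- (d%:R / D%:R)))).
    by apply: cvgD; [exact: cvg_cst|exact: cvg_id].
  apply: differentiable_continuous; apply/derivable1_diffP.
  by apply: derivable_powR; rewrite in_itv/= andbT; lra.
have [dl /= dl0 hdl] : \forall o \near D%:R * th, `|h (D%:R * th) - h o| <= e.
  by move/cvgrPdist_le : ch; apply.
near=> n.
have on : `|odds d (wf n) - D%:R * th| <= dl / 2.
  by near: n; apply: odds_near; rewrite divr_gt0.
rewrite powR_odds; last exact: wt_itv.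
rewrite -/(h _) /limit_laplace -/th -/(h (D%:R * th)) distrC; apply: hdl => /=.
by rewrite distrC; apply: (le_lt_trans on); lra.
Unshelve. all: by end_near. Qed.

End Step.

(** The triangle inequality through law_window, law_pow and law_laplace_near.
    *)
Theorem law_laplace t : 0 < t ->
  law n (fun x => expR (- (t * (x%:R / scale n) ^+ d))) @[n --> \oo] --> limit_laplace t.
Proof.
move=> t0; apply/cvgrPdist_le => e e0.
pose L : R := d%:R * (t + 1).
have L0 : 0 <= L by rewrite /L; nneg.
pose th := t * reflc R d ^+ d.
(* The order b, eta, A, n of the choices is imposed by the factor b ^+ (2 * d
   + 1) / (A * eta) in the error of the fluid phase. *)
pose b := (Num.truncn (32 * L / e)).+1.
have b0 : 0 < b%:R :> R by rewrite ltr0n.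
have hb : L * (4 / b%:R) <= e / 8.
  have h : 32 * L / e <= b%:R by exact/ltW/truncnS_gt.
  rewrite mulrA ler_pdivrMr//; move: h; rewrite ler_pdivrMr//; lra.
pose eta : R := e / (8 * (L + 1)).
have eta0 : 0 < eta by rewrite divr_gt0// mulr_gt0//; lra.
have he : L * eta <= e / 8.
  have -> : L * eta = e / 8 * (L / (L + 1)) by rewrite /eta; field; rewrite gt_eqF//; lra.
  by rewrite ler_piMr ?divr_ge0 ?(ltW e0)// ler_pdivrMr; lra.
pose q := L * (winc R d + errc R d * b%:R ^+ (2 * d + 1) / eta) + powc * th.
pose A := (Num.truncn (8 * q / e)).+1.
have A0 : 0 < A%:R :> R by rewrite ltr0n.
have hA : q / A%:R <= e / 8.
  have h : 8 * q / e <= A%:R by exact/ltW/truncnS_gt.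
  rewrite ler_pdivrMr//; move: h; rewrite ler_pdivrMr//; lra.
pose r := L * (1 + 2 * errcw R d A b / eta).
have A1 : (0 < A)%N by []. have b1 : (0 < b)%N by [].
have e8 : 0 < e / 8 by rewrite divr_gt0.
have H1 := law_window A1 b1 t0 eta0.
have H2 := law_pow A1 b1 t0.
have H3 := law_laplace_near A1 b1 t0 e8.
have H4 := scale_unbounded (r / (e / 8)).
have H5 : \forall n \near \oo, (0 < n)%N by exact: nbhs_infty_gt.
move: H1; apply: filter_app; move: H2; apply: filter_app.
move: H3; apply: filter_app; move: H4; apply: filter_app.
move: H5; apply: filter_app; near=> n; move=> n0 h4 h3 h2 h1.
have s0 := scale_gt0 n0.
have h5 : r / scale n <= e / 8.
  by move: h4; rewrite ler_pdivrMr// mulrC ler_pdivrMr// mulrC.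
set c0 := chain _ _ _ _ _ in h1 h2; set c1 := _ ^+ d in h2 h3.
rewrite distrC.
have t1 := ler_distD c0 (law n (fun x => expR (- (t * (x%:R / scale n) ^+ d)))) c1.
have t2 := ler_distD c1 (law n (fun x => expR (- (t * (x%:R / scale n) ^+ d)))) (limit_laplace t).
have e1 : L * (2 / b%:R + bracket A b eta + ((1 + 2 * errcw R d A b / eta) / scale n)) +
    powc * (t * reflc R d ^+ d) / A%:R =
    L * (4 / b%:R) + L * eta + q / A%:R + r / scale n.
  rewrite /bracket /q /r -/th; move: (errc R d * _) => u.
  by field; rewrite !gt_eqF.
rewrite -/L in h1; lra.
Unshelve. all: by end_near. Qed.

End LaplaceLimit.

(** * From Laplace transforms to convergence in distribution *)

Section UniformContinuity.
Variable R : realType.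

Lemma continuous_unif_segment (f : R -> R) (a b e : R) : continuous f -> 0 < e ->
  exists2 dl, 0 < dl & forall x y, a <= x <= b -> `|x - y| <= dl -> `|f x - f y| <= e.
Proof.
move=> cf e0.
have /compact_near_coveringP cov := @segment_compact R a b.
have H := cov R 0^'+ (fun dl x => forall y, `|x - y| <= dl -> `|f x - f y| <= e) _.
have {H} : \forall dl \near 0^'+, `[a, b] `<=` (fun x => forall y, `|x - y| <= dl -> `|f x - f y| <= e).
  apply: H => x _.
  have /cvgrPdist_le/(_ (e / 2)) := cf x; rewrite divr_gt0// => /(_ isT) [r /= r0 hr].
  have r2 : 0 < r / 2 by rewrite divr_gt0.
  exists (ball x (r / 2), [set dl | 0 < dl < r / 2]) => /=.
    split; first exact: nbhsx_ballx.
    near=> dl; apply/andP; split; first by near: dl; exact: nbhs_right_gt.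
    by near: dl; exact: nbhs_right_lt.
  move=> [x' dl] /= [xx' /andP[dl0 dlr]] y xy.
  have h1 : `|f x - f x'| <= e / 2 by apply: hr => /=; apply: (lt_trans xx'); lra.
  have h2 : `|f x - f y| <= e / 2.
    apply: hr => /=; apply: (le_lt_trans (ler_distD x' _ _)).
    have : `|x - x'| < r / 2 by exact: xx'.
    lra.
  by apply: (le_trans (ler_distD (f x) _ _)); rewrite distrC in h1; lra.
move=> H; have [dl [dl0 hdl]] : exists dl, 0 < dl /\ (`[a, b] `<=` (fun x => forall y, `|x - y| <= dl -> `|f x - f y| <= e)).
  have [dl [h1 h2]] := filter_ex (filterI H (nbhs_right_gt (0 : R))).
  by exists dl.
by exists dl => // x y xab; apply: hdl; rewrite /= in_itv.
Unshelve. all: by end_near. Qed.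

End UniformContinuity.

Section WeakConvergence.
Variables (R : realType) (d : nat).
Hypothesis d_gt0 : (0 < d)%N.
Implicit Types f g h : R -> R.

(** The powers of lap are the functions exp (- j x^d), whose averages are
    Laplace transforms at integers. *)
Definition lap (x : R) : R := expR (- (`|x| ^+ d)).

Definition cb f := continuous f /\ exists B, forall x, `|f x| <= B.

Lemma cbD f g : cb f -> cb g -> cb (fun x => f x + g x).
Proof.
move=> [cf [B hB]] [cg [B' hB']]; split; first by move=> x; apply: cvgD; [exact: cf|exact: cg].
by exists (B + B') => x; apply: (le_trans (ler_normD _ _)); apply: lerD.
Qed.

Lemma cbM f g : cb f -> cb g -> cb (fun x => f x * g x).
Proof.
move=> [cf [B hB]] [cg [B' hB']]; split; first by move=> x; apply: cvgM; [exact: cf|exact: cg].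
by exists (B * B') => x; rewrite normrM; apply: ler_pM.
Qed.

Lemma cb_cst (c : R) : cb (fun=> c).
Proof. by split; [move=> x; exact: cvg_cst|exists `|c|]. Qed.

Lemma cbZ (c : R) f : cb f -> cb (fun x => c * f x).
Proof. by move=> cf; apply: cbM => //; exact: cb_cst. Qed.

Lemma lap_itv x : 0 < lap x <= 1.
Proof. by rewrite /lap expR_gt0 expR_le1 oppr_le0 exprn_ge0. Qed.

Lemma cb_lap : cb lap.
Proof.
split; last first.
  by exists 1 => x; have /andP[h0 h1] := lap_itv x; rewrite ger0_norm// ltW.
move=> x; apply: (@continuous_comp _ _ _ (fun x : R => - (`|x| ^+ d)) expR).
  apply: continuousN; apply: (@continuous_comp _ _ _ (fun x : R => `|x|) (fun y => y ^+ d)).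
    exact: norm_continuous.
  exact: exprn_continuous.
exact: continuous_expR.
Qed.

Lemma cb_lapX j : cb (fun x => lap x ^+ j).
Proof.
elim: j => [|j IH]; first by under eq_fun do rewrite expr0; exact: cb_cst.
by under eq_fun do rewrite exprS; exact: cbM cb_lap IH.
Qed.

(** A continuous cutoff, equal to 1 on [-M, M] and to 0 outside [-M-1, M+1].
    *)
Definition cut (M x : R) : R := Num.max 0 (Num.min 1 (M + 1 - `|x|)).

Lemma cb_cut M : cb (cut M).
Proof.
split.
  move=> x; apply: (@continuous_max R R (fun=> 0) (fun x => Num.min 1 (M + 1 - `|x|)) x).
    exact: cvg_cst.
  apply: (@continuous_min R R (fun=> 1) (fun x => M + 1 - `|x|) x); first exact: cvg_cst.
  apply: cvgB; [exact: cvg_cst|exact: norm_continuous].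
exists 1 => x; rewrite ger0_norm; last by rewrite /cut le_max lexx.
by rewrite /cut ge_max ler01 ge_min lexx.
Qed.

Lemma cut_itv M x : 0 <= cut M x <= 1.
Proof. by rewrite /cut le_max lexx ge_max ler01 ge_min lexx. Qed.

Lemma cut_eq1 M x : `|x| <= M -> cut M x = 1.
Proof.
move=> xM; rewrite /cut min_l; first by rewrite max_r.
by rewrite lerBrDr addrC lerD2r.
Qed.

Lemma cut_eq0 M x : M + 1 <= `|x| -> cut M x = 0.
Proof.
move=> xM; rewrite /cut max_l// ge_min; apply/orP; right.
by rewrite subr_le0.
Qed.

(** This polynomial is the Bernstein polynomial of phi. *)
Lemma binexp_poly N (phi : nat -> R) :
  exists p : {poly R}, forall w, binexp w N phi = p.[w].
Proof.
elim: N phi => [|N IH] phi; first by exists (phi 0%N)%:P => w; rewrite hornerC.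
have [p1 h1] := IH (fun z => phi z.+1); have [p2 h2] := IH phi.
exists ('X * p1 + (1 - 'X) * p2) => w.
by rewrite /= h1 h2 !hornerE.
Qed.

Variables (L : nat -> (R -> R) -> R) (LZ : (R -> R) -> R).
Hypothesis L_le : forall n f g, (forall x, 0 <= x -> f x <= g x) -> L n f <= L n g.
Hypothesis L_D : forall n f g, L n (fun x => f x + g x) = L n f + L n g.
Hypothesis L_Z : forall n (a : R) f, L n (fun x => a * f x) = a * L n f.
Hypothesis L_1 : forall n, L n (fun=> 1) = 1.
Hypothesis LZ_le : forall f g, cb f -> cb g -> (forall x, 0 <= x -> f x <= g x) -> LZ f <= LZ g.
Hypothesis LZ_D : forall f g, cb f -> cb g -> LZ (fun x => f x + g x) = LZ f + LZ g.
Hypothesis LZ_Z : forall (a : R) f, cb f -> LZ (fun x => a * f x) = a * LZ f.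
Hypothesis LZ_1 : LZ (fun=> 1) = 1.
Hypothesis lap_cvg : forall j, L n (fun x => lap x ^+ j) @[n --> \oo] --> LZ (fun x => lap x ^+ j).
Hypothesis L_tight : exists C, \forall n \near \oo, L n (fun x => `|x|) <= C.

Lemma L_cst n a : L n (fun=> a) = a.
Proof.
transitivity (L n (fun=> a * 1)); first by rewrite mulr1.
by rewrite (L_Z n a (fun=> 1)) L_1 mulr1.
Qed.

Lemma LZ_cst a : LZ (fun=> a) = a.
Proof.
transitivity (LZ (fun=> a * 1)); first by rewrite mulr1.
by rewrite (LZ_Z a (cb_cst 1)) LZ_1 mulr1.
Qed.

Lemma L_dist n f g e : (forall x, 0 <= x -> `|f x - g x| <= e x) ->
  `|L n f - L n g| <= L n e.
Proof.
move=> h; have -> : L n f - L n g = L n (fun x => f x + -1 * g x).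
  by rewrite L_D L_Z mulN1r.
rewrite ler_norml; apply/andP; split.
  rewrite -[- L n e]mulN1r -L_Z; apply: L_le => x /h; rewrite ler_norml => /andP[+ _].
  by rewrite !mulN1r.
by apply: L_le => x /h; rewrite ler_norml => /andP[_ +]; rewrite mulN1r.
Qed.

Lemma LZ_dist f g e : cb f -> cb g -> cb e -> (forall x, 0 <= x -> `|f x - g x| <= e x) ->
  `|LZ f - LZ g| <= LZ e.
Proof.
move=> cf cg ce h; have -> : LZ f - LZ g = LZ (fun x => f x + -1 * g x).
  by rewrite LZ_D ?LZ_Z ?mulN1r//; exact: cbZ.
have cfg : cb (fun x => f x + -1 * g x) by apply: cbD => //; exact: cbZ.
rewrite ler_norml; apply/andP; split.
  rewrite -[- LZ e]mulN1r -LZ_Z//; apply: LZ_le => //; first exact: cbZ.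
  by move=> x /h; rewrite ler_norml => /andP[+ _]; rewrite !mulN1r.
by apply: LZ_le => // x /h; rewrite ler_norml => /andP[_ +]; rewrite mulN1r.
Qed.

Lemma poly_lap_cvg (p : {poly R}) :
  cb (fun x => p.[lap x]) /\ L n (fun x => p.[lap x]) @[n --> \oo] --> LZ (fun x => p.[lap x]).
Proof.
suff H j : cb (fun x => p.[lap x] * lap x ^+ j) /\
    L n (fun x => p.[lap x] * lap x ^+ j) @[n --> \oo] --> LZ (fun x => p.[lap x] * lap x ^+ j).
  by have := H 0%N; under eq_fun do rewrite expr0 mulr1.
elim/poly_ind: p j => [|p c IH] j.
  under eq_fun do rewrite horner0 mul0r.
  split; first exact: cb_cst.
  by rewrite LZ_cst; under eq_cvg do rewrite L_cst; exact: cvg_cst.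
have [c1 h1] := IH j.+1.
have -> : (fun x => (p * 'X + c%:P).[lap x] * lap x ^+ j) =
    (fun x => p.[lap x] * lap x ^+ j.+1 + c * lap x ^+ j).
  by apply/funext => x; rewrite !hornerE exprS; ring.
have c2 := cb_lapX j.
split; first by apply: cbD => //; exact: cbZ.
rewrite LZ_D ?LZ_Z//; last exact: cbZ.
under eq_cvg do rewrite L_D L_Z.
by apply: cvgD => //; apply: cvgMr; exact: lap_cvg.
Qed.

Lemma approx_cvg h : cb h ->
  (forall e, 0 < e -> exists p : {poly R}, forall x, 0 <= x -> `|h x - p.[lap x]| <= e) ->
  L n h @[n --> \oo] --> LZ h.
Proof.
move=> ch H; apply/cvgrPdist_le => e e0.
have e3 : 0 < e / 3 by rewrite divr_gt0.
have [p hp] := H _ e3; have [cp /cvgrPdist_le/(_ _ e3) hcvg] := poly_lap_cvg p.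
have hz : `|LZ h - LZ (fun x => p.[lap x])| <= e / 3.
  by rewrite -(LZ_cst (e / 3)); apply: LZ_dist => //; exact: cb_cst.
near=> n.
have hn : `|L n h - L n (fun x => p.[lap x])| <= e / 3.
  by rewrite -(L_cst n (e / 3)); exact: L_dist.
have hc : `|LZ (fun x => p.[lap x]) - L n (fun x => p.[lap x])| <= e / 3 by near: n.
have := ler_distD (LZ (fun x => p.[lap x])) (LZ h) (L n h).
have := ler_distD (L n (fun x => p.[lap x])) (LZ (fun x => p.[lap x])) (L n h).
rewrite [`|L n _ - L n h|]distrC; lra.
Unshelve. all: by end_near. Qed.

Let root (v : R) : R := (- ln v) `^ d%:R^-1.

Let root_ge0 v : 0 <= root v. Proof. exact: powR_ge0. Qed.

Let rootK v : 0 < v <= 1 -> lap (root v) = v.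
Proof.
move=> /andP[v0 v1]; rewrite /lap /root ger0_norm ?powR_ge0//.
rewrite -powR_mulrn ?powR_ge0// -powRrM mulVf ?pnatr_eq0 -?lt0n// powRr1.
  by rewrite opprK lnK.
by rewrite oppr_ge0 ln_le0.
Qed.

(** Bernstein's proof of the Weierstrass theorem for h as a function of the
    variable lap x in [0, 1]: if z of N trials with success probability lap x
    succeed, then z / N is close to lap x by Chebyshev's inequality, the
    variance being binexp_var. *)
Lemma bernstein_approx h B M : 0 <= M -> (forall x, `|h x| <= B) ->
  (forall x, M <= x -> h x = 0) ->
  (forall e, 0 < e -> exists2 dl, 0 < dl & forall x y, 0 <= x -> 0 <= y ->
     `|lap x - lap y| <= dl -> `|h x - h y| <= e) ->
  forall e, 0 < e -> exists p : {poly R}, forall x, 0 <= x -> `|h x - p.[lap x]| <= e.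
Proof.
move=> M0 hB hM hu e e0.
have B0 : 0 <= B by exact: le_trans (hB 0).
have [dl dl0 hdl] := hu (e / 2) (divr_gt0 e0 (ltr0Sn _ _)).
(* The value v = 0 corresponds to x at infinity, where h vanishes. *)
pose G v := if v == 0 then 0 else h (root v).
pose N := (Num.truncn (4 * B / (dl ^+ 2 * e))).+1.
have N0 : 0 < N%:R :> R by rewrite ltr0n.
have dl2 : 0 < dl ^+ 2 by rewrite exprn_gt0.
have hN : 2 * B / (dl ^+ 2 * N%:R) <= e / 2.
  have : 4 * B / (dl ^+ 2 * e) <= N%:R by exact/ltW/truncnS_gt.
  rewrite ler_pdivrMr ?mulr_gt0// => h1.
  by rewrite ler_pdivrMr ?mulr_gt0//; lra.
have [p hp] := binexp_poly N (fun z => G (z%:R / N%:R)).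
exists p => x x0; rewrite -hp.
have /andP[w0 w1] := lap_itv x; have lw := ltW w0.
have w01 : 0 <= lap x <= 1 by rewrite lw.
rewrite -[X in `|X - _|](binexp_cst (lap x) N).
have pw z : (z <= N)%N -> `|h x - G (z%:R / N%:R)| <=
    e / 2 + 2 * B / (dl ^+ 2 * N%:R ^+ 2) * (z%:R - lap x * N%:R) ^+ 2.
  move=> zN.
  have v1 : z%:R / N%:R <= 1 :> R by rewrite ler_pdivrMr// mul1r ler_nat.
  have GB : `|G (z%:R / N%:R)| <= B by rewrite /G; case: ifP => _; rewrite ?normr0.
  have [near|far] := leP `|lap x - z%:R / N%:R| dl.
    have : `|h x - G (z%:R / N%:R)| <= e / 2.
      rewrite /G; have [v0|vn0] := eqVneq (z%:R / N%:R : R) 0.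
        have [xM|Mx] := leP M x; first by rewrite hM// subrr normr0 ltW// divr_gt0.
        rewrite -(hM M (lexx M)); apply: hdl => //.
        apply: le_trans near; rewrite v0 subr0 [leRHS]ger0_norm// ler_norml.
        have /andP[m0 m1] := lap_itv M.
        have : lap M <= lap x.
          rewrite /lap ler_expR lerN2; apply: lerXn2r; rewrite ?nnegrE//.
          by rewrite !ger0_norm// ltW.
        by move=> ?; apply/andP; split; lra.
      have v0 : 0 < z%:R / N%:R :> R by rewrite lt0r vn0 divr_ge0.
      by apply: hdl => //; rewrite rootK// v0 v1.
    move=> /le_trans; apply; rewrite lerDl; nneg.
  have far2 : dl ^+ 2 <= (z%:R - lap x * N%:R) ^+ 2 / N%:R ^+ 2.
    rewrite -expr_div_n mulrBl mulfK ?gt_eqF// -[leRHS]real_normK ?num_real//.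
    by rewrite distrC; apply: lerXn2r; rewrite ?nnegrE// ltW.
  apply: (@le_trans _ _ (2 * B)).
    by apply: (le_trans (ler_normB _ _)); have := hB x; lra.
  have -> : 2 * B / (dl ^+ 2 * N%:R ^+ 2) * (z%:R - lap x * N%:R) ^+ 2 =
     (2 * B) * (((z%:R - lap x * N%:R) ^+ 2 / N%:R ^+ 2) / dl ^+ 2).
    by field; rewrite !gt_eqF.
  have : 1 <= ((z%:R - lap x * N%:R) ^+ 2 / N%:R ^+ 2) / dl ^+ 2.
    by rewrite ler_pdivlMr// mul1r.
  move: (_ / dl ^+ 2) => q q1; nra.
apply: (le_trans (binexp_dist w01 pw)).
rewrite binexpD binexp_cst binexpZ binexp_var subrr expr0n addr0.
apply: (@le_trans _ _ (e / 2 + e / 2)); last lra.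
rewrite lerD2l; apply: le_trans hN.
have -> : 2 * B / (dl ^+ 2 * N%:R) = 2 * B / (dl ^+ 2 * N%:R ^+ 2) * N%:R.
  by field; rewrite !gt_eqF.
apply: ler_wpM2l; first by nneg.
rewrite ler_piMl//; nra.
Qed.

Lemma compact_support_cvg h M : 0 <= M -> cb h -> (forall x, M <= x -> h x = 0) ->
  L n h @[n --> \oo] --> LZ h.
Proof.
move=> M0 ch hM; apply: approx_cvg => //.
have [cnt [B hB]] := ch.
apply: (bernstein_approx M0 hB hM) => e e0.
have [r r0 hr] := continuous_unif_segment 0 M cnt e0.
have rd0 : 0 < r ^+ d by rewrite exprn_gt0.
exists (lap M * r ^+ d / 2).
  by rewrite divr_gt0// mulr_gt0//; have /andP[] := lap_itv M.
(* it suffices to treat x < y <= M *)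
have key x y : 0 <= x -> x < y -> y <= M -> `|lap x - lap y| <= lap M * r ^+ d / 2 -> `|h x - h y| <= e.
  move=> x0 xy yM hl.
  have [xyr|xyr] := leP `|x - y| r.
    by apply: hr => //; rewrite x0 (le_trans (ltW xy)).
  exfalso; move: hl; rewrite leNgt => /negP; apply.
  have y0 : 0 <= y by rewrite (le_trans x0)// ltW.
  have dy : 0 <= y - x by rewrite subr_ge0 ltW.
  rewrite ltr0_norm ?subr_lt0// opprB in xyr.
  have pw : r ^+ d <= y ^+ d - x ^+ d.
    apply: (@le_trans _ _ ((y - x) ^+ d)).
      by apply: lerXn2r; rewrite ?nnegrE// ltW.
    rewrite lerBrDr -{2}(subrK x y) -(prednK d_gt0).
    elim: d.-1 => [|n IH]; first by rewrite !expr1.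
    rewrite exprS [x ^+ _]exprS [leRHS]exprS.
    have : 0 <= (y - x) ^+ n.+1 by rewrite exprn_ge0.
    have : 0 <= x ^+ n.+1 by rewrite exprn_ge0.
    move: ((y - x) ^+ n.+1) (x ^+ n.+1) ((_ + _) ^+ n.+1) IH => a b c IH b0 a0; nra.
  have lM : lap M <= lap y.
    rewrite /lap ler_expR lerN2; apply: lerXn2r; rewrite ?nnegrE//.
    by rewrite !ger0_norm.
  have /andP[lM0 _] := lap_itv M.
  have ly : lap y * (1 + (y ^+ d - x ^+ d)) <= lap x.
    have -> : lap x = lap y * expR (y ^+ d - x ^+ d).
      by rewrite /lap -expRD !ger0_norm//; congr expR; ring.
    by apply: ler_wpM2l; [exact: le_trans (ltW lM0) _|exact: expR_ge1Dx].
  have q0 : 0 <= y ^+ d - x ^+ d by apply: le_trans pw; exact: ltW.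
  have : lap M * r ^+ d <= lap y * (y ^+ d - x ^+ d).
    by apply: ler_pM => //; exact: ltW.
  have : 0 < lap M * r ^+ d by rewrite mulr_gt0.
  move=> g1 g2; apply: (@lt_le_trans _ _ (lap x - lap y)); last exact: ler_norm.
  lra.
have key2 x y : 0 <= x -> x <= y -> `|lap x - lap y| <= lap M * r ^+ d / 2 -> `|h x - h y| <= e.
  move=> x0; rewrite le_eqVlt => /predU1P[->|xy hl]; first by move=> _; rewrite subrr normr0 ltW.
  have [yM|My] := leP y M; first exact: key.
  have [xM|Mx] := ltP x M; last first.
    by rewrite (hM x Mx) (hM y (le_trans Mx (ltW xy))) subrr normr0 ltW.
  rewrite (hM y (ltW My)) -(hM M (lexx M)); apply: key => //.
  apply: le_trans hl.
  have mono (u v : R) : 0 <= u -> u <= v -> lap v <= lap u.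
    move=> u0 uv; rewrite /lap ler_expR lerN2; apply: lerXn2r; rewrite ?nnegrE//.
    by rewrite !ger0_norm// (le_trans u0).
  have m1 := mono _ _ x0 (ltW xM); have m2 := mono _ _ M0 (ltW My).
  by rewrite !ger0_norm; lra.
move=> x y x0 y0; have [xy|/ltW yx] := leP x y; first exact: key2.
by rewrite distrC [X in X <= e]distrC; exact: key2.
Qed.

(** Tightness allows to multiply f by a cutoff, and functions that vanish
    outside a segment are uniform limits of polynomials in lap. Only integer
    exponents j are needed. *)
Theorem weak_convergence f : cb f -> L n f @[n --> \oo] --> LZ f.
Proof.
move=> cf; have [_ [B hB]] := cf.
have B0 : 0 <= B by exact: le_trans (hB 0).
have [C0 hC0] := L_tight; pose C := Num.max 1 C0.
have C1 : 1 <= C by rewrite /C le_max lexx.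
have cutcvg M g : 0 <= M -> cb g -> L n (fun x => g x * cut M x) @[n --> \oo] --> LZ (fun x => g x * cut M x).
  move=> M0 cg; apply: (@compact_support_cvg _ (M + 1)); first lra.
    by apply: cbM => //; exact: cb_cut.
  by move=> x Mx; rewrite cut_eq0 ?mulr0//; exact: le_trans Mx (ler_norm x).
have tailL M : 0 < M -> \forall n \near \oo, L n (fun x => 1 + -1 * cut M x) <= C / M.
  move=> M0; near=> n.
  have hn : L n (fun x => `|x|) <= C0 by near: n.
  apply: (@le_trans _ _ (L n (fun x => M^-1 * `|x|))); last first.
    rewrite L_Z mulrC; apply: ler_wpM2r; first by rewrite invr_ge0 ltW.
    by apply: (le_trans hn); rewrite /C le_max lexx orbT.
  apply: L_le => x x0; have /andP[c0 c1] := cut_itv M x.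
  have [xM|Mx] := leP `|x| M.
    by rewrite cut_eq1// mulr1 subrr mulr_ge0// invr_ge0 ltW.
  apply: (@le_trans _ _ 1); first lra.
  by rewrite mulrC ler_pdivlMr// mul1r ltW.
have tailZ M : 0 < M -> LZ (fun x => 1 + -1 * cut M x) <= C / M.
  move=> M0; have h := cutcvg M (fun=> 1) (ltW M0) (cb_cst 1).
  have e1 : (fun x : R => 1 * cut M x) = cut M by apply/funext => x; rewrite mul1r.
  rewrite e1 in h.
  rewrite LZ_D; [|exact: cb_cst|by apply: cbZ; exact: cb_cut].
  rewrite LZ_Z; last exact: cb_cut.
  rewrite LZ_1.
  have h2 : 1 + -1 * L n (cut M) @[n --> \oo] --> 1 + -1 * LZ (cut M).
    by apply: cvgD; [exact: cvg_cst|apply: cvgMr].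
  apply: (cvgr_to_le h2); near=> n.
  have : L n (fun x => 1 + -1 * cut M x) <= C / M by near: n; exact: tailL.
  by rewrite L_D L_Z L_1.
apply/cvgrPdist_le => e e0.
pose M := 3 * (B + 1) * C / e.
have M0 : 0 < M by rewrite /M divr_gt0// !mulr_gt0//; lra.
have BCM : B * (C / M) <= e / 3.
  have -> : B * (C / M) = (e / 3) * (B / (B + 1)).
    by rewrite /M; field; rewrite !gt_eqF//; lra.
  by rewrite ler_piMr ?divr_ge0 ?(ltW e0)// ler_pdivrMr; lra.
have e3 : 0 < e / 3 by rewrite divr_gt0.
have /cvgrPdist_le/(_ _ e3) hc := cutcvg M f (ltW M0) cf.
have ccut := cb_cut M.
have pw x : 0 <= x -> `|f x - f x * cut M x| <= B * (1 + -1 * cut M x).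
  move=> _; have -> : f x - f x * cut M x = f x * (1 + -1 * cut M x) by ring.
  have /andP[c0 c1] := cut_itv M x.
  rewrite normrM [X in _ * X]ger0_norm; last lra.
  by apply: ler_wpM2r => //; lra.
have hz : `|LZ f - LZ (fun x => f x * cut M x)| <= e / 3.
  apply: le_trans BCM; apply: le_trans (ler_wpM2l B0 (tailZ _ M0)).
  rewrite -LZ_Z; last by apply: cbD; [exact: cb_cst|exact: cbZ].
  apply: LZ_dist => //; first exact: cbM.
  by apply: cbZ; apply: cbD; [exact: cb_cst|exact: cbZ].
near=> n.
have hn : `|L n f - L n (fun x => f x * cut M x)| <= e / 3.
  apply: le_trans BCM; apply: le_trans (L_dist _ pw) _.
  by rewrite L_Z; apply: ler_wpM2l => //; near: n; exact: tailL.
have hcn : `|LZ (fun x => f x * cut M x) - L n (fun x => f x * cut M x)| <= e / 3 by near: n.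
have := ler_distD (LZ (fun x => f x * cut M x)) (LZ f) (L n f).
have := ler_distD (L n (fun x => f x * cut M x)) (LZ (fun x => f x * cut M x)) (L n f).
rewrite [`|L n _ - L n f|]distrC; lra.
Unshelve. all: by end_near. Qed.

End WeakConvergence.

(** * Averages over uniform heads *)

Section UniformAverage.
Variable R : realType.
Implicit Types (F : nat -> R) (G : seq nat -> R) (k y : nat).

Definition unif k F : R := k%:R^-1 * \sum_(1 <= i < k.+1) F i.

Fixpoint unifs k y G : R :=
  if y is y'.+1 then unif k (fun i => unifs k y' (fun s => G (i :: s))) else G [::].

Lemma eq_unif k F F' : (forall i, (1 <= i <= k)%N -> F i = F' i) -> unif k F = unif k F'.
Proof. by move=> h; congr (_ * _); apply: eq_big_nat => i ik; exact: h. Qed.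

Lemma eq_unifs k y G G' : (forall s, size s = y -> all (fun i => (1 <= i <= k)%N) s -> G s = G' s) ->
  unifs k y G = unifs k y G'.
Proof.
elim: y G G' => [|y IH] G G' h /=; first exact: h.
apply: eq_unif => i ik; apply: IH => s sy sk; apply: h; first by rewrite /= sy.
by rewrite /= ik.
Qed.

Lemma unifS k F : unif k.+1 F = k.+1%:R^-1 * F k.+1 + (1 - k.+1%:R^-1) * unif k F.
Proof.
rewrite /unif big_nat_recr//= mulrDr addrC; congr (_ + _).
case: k => [|k]; first by rewrite big_geq// !mulr0.
rewrite mulrA; congr (_ * _).
rewrite -[k.+2%:R]natr1; have : 0 < k.+1%:R :> R by rewrite ltr0n.
by move: (k.+1%:R) => u u0; field; rewrite !gt_eqF//; lra.
Qed.

Lemma unifD k F F' : unif k (fun i => F i + F' i) = unif k F + unif k F'.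
Proof. by rewrite /unif big_split mulrDr. Qed.

Lemma unifZ k (a : R) F : unif k (fun i => a * F i) = a * unif k F.
Proof. by rewrite /unif -mulr_sumr mulrCA. Qed.

Lemma unif_cst k (a : R) : (0 < k)%N -> unif k (fun=> a) = a.
Proof.
by move=> k0; rewrite /unif sumr_const_nat subn1 -[a *+ _]mulr_natl mulKf// pnatr_eq0 -lt0n.
Qed.

Lemma le_unif k F F' : (forall i, (1 <= i <= k)%N -> F i <= F' i) -> unif k F <= unif k F'.
Proof.
move=> h; apply: ler_wpM2l; first by rewrite invr_ge0.
by rewrite big_nat [leRHS]big_nat; apply: ler_sum => i; exact: h.
Qed.

Lemma unifsD k y G G' : unifs k y (fun s => G s + G' s) = unifs k y G + unifs k y G'.
Proof.
elim: y G G' => //= y IH G G'; rewrite -unifD; apply: eq_unif => i _; exact: IH.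
Qed.

Lemma unifsZ k y (a : R) G : unifs k y (fun s => a * G s) = a * unifs k y G.
Proof.
elim: y G => //= y IH G; rewrite -unifZ; apply: eq_unif => i _; exact: IH.
Qed.

Lemma unifs_cst k y (a : R) : (0 < k)%N -> unifs k y (fun=> a) = a.
Proof.
move=> k0; elim: y => //= y IH; rewrite -[RHS](unif_cst a k0).
by apply: eq_unif => i _.
Qed.

Lemma le_unifs k y G G' :
  (forall s, size s = y -> all (fun i => (1 <= i <= k)%N) s -> G s <= G' s) ->
  unifs k y G <= unifs k y G'.
Proof.
elim: y G G' => [|y IH] G G' h /=; first exact: h.
apply: le_unif => i ik; apply: IH => s sy sk; apply: h; first by rewrite /= sy.
by rewrite /= ik.
Qed.

Lemma unifs_cat k y y' G :
  unifs k (y + y') G = unifs k y (fun s => unifs k y' (fun s' => G (s ++ s'))).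
Proof. by elim: y G => //= y IH G; apply: eq_unif => i _; rewrite IH. Qed.

Lemma unif_binexp k p y (Q : nat -> nat -> R) :
  unif k (fun i => binexp p y (fun z => Q z i)) = binexp p y (fun z => unif k (Q z)).
Proof.
elim: y Q => [|y IH] Q //=.
by rewrite unifD !unifZ (IH (fun z => Q z.+1)) IH.
Qed.

(** This is why the chain has to remember only the number of pending edges:
    given how many of the heads are equal to k + 1, the other ones are again
    independent and uniform on {1, ..., k}. *)
Lemma unifs_split k y (H : nat -> seq nat -> R) :
  unifs k.+1 y (fun s => H (count_mem k.+1 s) [seq i <- s | i != k.+1]) =
  binexp k.+1%:R^-1 y (fun z => unifs k (y - z) (H z)).
Proof.
elim: y H => [|y IH] H //=.
rewrite unifS; congr (_ * _ + _ * _).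
  by under eq_unifs do rewrite eqxx/= add1n; rewrite (IH (fun z => H z.+1)).
transitivity (unif k (fun i =>
    unifs k.+1 y (fun s => H (count_mem k.+1 s) (i :: [seq j <- s | j != k.+1])))).
  apply: eq_unif => i /andP[_ ik]; apply: eq_unifs => s _ _.
  by rewrite ltn_eqF//= ltnS.
transitivity (unif k (fun i => binexp k.+1%:R^-1 y (fun z => unifs k (y - z) (fun s => H z (i :: s))))).
  by apply: eq_unif => i _; rewrite (IH (fun z s => H z (i :: s))).
transitivity (binexp k.+1%:R^-1 y (fun z => unif k (fun i => unifs k (y - z) (fun s => H z (i :: s))))).
  exact: (unif_binexp _ _ _ (fun z i => unifs k (y - z) (fun s => H z (i :: s)))).
by apply: eq_binexp => z zy; rewrite subSn.
Qed.

End UniformAverage.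

(** * Exploration of the descendants *)

Section Exploration.
Variables (R : realType) (d m : nat).
Hypothesis m_gt0 : (0 < m)%N.
Implicit Types (h : nat * 'I_d -> nat) (f : nat -> R) (s : seq nat).

Definition heads h k := [seq h (k, j) | j <- enum 'I_d].

(** At the roots the exploration ends: all pending heads are roots then, and
    the distinct ones are the last descendants. *)
Definition found x s := (x + size (undup s))%N.

(** Counts the descendants when k is the next vertex to treat, x descendants
    have been found above k, and s lists the heads of the pending edges. *)
Fixpoint explore h k x s : nat :=
  if k is k'.+1 then
    if (k <= m)%N then found x s
    else if k \in s then explore h k' x.+1 ([seq i <- s | i != k] ++ heads h k)
    else explore h k' x s
  else found x s.

(** The exploration in which the heads of the edges leaving a vertex are drawn
    when this vertex is found. *)
Fixpoint avgx f k x s : R :=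
  if k is k'.+1 then
    if (k <= m)%N then f (found x s)
    else if k \in s then
      unifs k' d (fun s' => avgx f k' x.+1 ([seq i <- s | i != k] ++ s'))
    else avgx f k' x s
  else f (found x s).

Definition root_term f x y : R := unifs m y (fun s => f (found x s)).

Lemma avgx_root f k x s : (k <= m)%N -> avgx f k x s = f (found x s).
Proof. by case: k => //= k ->. Qed.

Lemma explore_root h k x s : (k <= m)%N -> explore h k x s = found x s.
Proof. by case: k => //= k ->. Qed.

(** Averaging also over the pending heads turns the exploration into the
    chain, by unifs_split. *)
Lemma unifs_avgx f k x y : (m <= k)%N ->
  unifs k y (avgx f k x) = chain d k m (root_term f) x y.
Proof.
elim: k x y => [|k IH] x y.
  by rewrite leqn0 => /eqP m0; rewrite /root_term m0 chain_id.
rewrite leq_eqVlt => /predU1P[mk|].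
  rewrite -mk chain_id /root_term; apply: eq_unifs => s _ _.
  by rewrite avgx_root.
rewrite ltnS => mk; rewrite chainS//.
have km : (k < m)%N = false by rewrite ltnNge mk.
pose H z s := if (0 < z)%N then unifs k d (fun s' => avgx f k x.+1 (s ++ s')) else avgx f k x s.
transitivity (unifs k.+1 y (fun s => H (count_mem k.+1 s) [seq i <- s | i != k.+1])).
  apply: eq_unifs => s _ _ /=; rewrite km /H -has_count has_pred1.
  case: ifPn => // ks; congr (avgx f k x _); apply/esym/all_filterP/allP => i si.
  by apply: contraNneq ks => <-.
rewrite unifs_split; apply: eq_binexp => z zy.
rewrite /H; case: z zy => [|z] zy /=; first by rewrite muln0 !addn0 IH.
by rewrite muln1 addn1 -IH// unifs_cat.
Qed.

(** Listed by decreasing tail, the order in which the exploration meets the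
    edges. *)
Definition edges_below k : seq (nat * 'I_d) :=
  flatten [seq [seq (v, j) | j <- enum 'I_d] | v <- rev (iota m.+1 (k - m))].

Lemma edges_belowS k : (m <= k)%N ->
  edges_below k.+1 = [seq (k.+1, j) | j <- enum 'I_d] ++ edges_below k.
Proof.
move=> mk; rewrite /edges_below subSn// -[(k - m).+1]addn1 iotaD rev_cat /=.
by congr (_ ++ _); rewrite addSn subnKC.
Qed.

Lemma mem_edges_below k e : (e \in edges_below k) = (m < e.1 <= k)%N.
Proof.
case: e => v j; apply/flatten_mapP/idP => [[w]|/= vk].
  rewrite mem_rev mem_iota => wk /mapP[j' _ [-> _]] /=.
  by move: wk; clear; lia.
exists v; first by rewrite mem_rev mem_iota; move: vk; clear; lia.
by apply/mapP; exists j => //; rewrite mem_enum.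
Qed.

Lemma uniq_edges_below k : uniq (edges_below k).
Proof.
elim: k => [|k IH]; first by rewrite /edges_below sub0n.
have [mk|km] := leqP m k; last first.
  by rewrite /edges_below (_ : (k.+1 - m)%N = 0%N)//; apply/eqP; rewrite subn_eq0.
rewrite edges_belowS// cat_uniq IH andbT map_inj_uniq ?enum_uniq//=; last by move=> ? ? [].
apply/hasPn => e; rewrite mem_edges_below => /andP[_ ek].
by apply/mapP => -[j _ ej]; move: ek; rewrite ej ltnn.
Qed.

Definition upd h (e : nat * 'I_d) i := fun e' => if e' == e then i else h e'.

Fixpoint avg_edges (es : seq (nat * 'I_d)) (F : (nat * 'I_d -> nat) -> R) h : R :=
  if es is e :: es' then unif e.1.-1 (fun i => avg_edges es' F (upd h e i)) else F h.

Lemma eq_avg_edges es F F' h :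
  (forall h', (forall e, e \notin es -> h' e = h e) -> F h' = F' h') ->
  avg_edges es F h = avg_edges es F' h.
Proof.
elim: es h => [|e es IH] h H /=; first exact: H.
apply: eq_unif => i _; apply: IH => h' hh'; apply: H => e'.
rewrite in_cons negb_or => /andP[e'e e'es]; rewrite hh'// /upd.
by rewrite (negPf e'e).
Qed.

Lemma avg_edges_heads k js0 js es (F : (nat * 'I_d -> nat) -> R) (c : seq nat -> R) h :
  uniq (js0 ++ js) ->
  (forall h1, avg_edges es F h1 = c [seq h1 (k, j) | j <- js0 ++ js]) ->
  avg_edges ([seq (k, j) | j <- js] ++ es) F h =
  unifs k.-1 (size js) (fun l => c ([seq h (k, j) | j <- js0] ++ l)).
Proof.
elim: js js0 h => [|j js IH] js0 h u H /=.
  by rewrite H !cats0.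
apply: eq_unif => i _.
rewrite (IH (rcons js0 j)); first last.
- by move=> h1; rewrite H cat_rcons.
- by rewrite cat_rcons.
apply: eq_unifs => l _ _; congr c; rewrite map_rcons cat_rcons.
have jj0 : j \notin js0.
  by move: u; rewrite cat_uniq /= negb_or => /and3P[_ /andP[]].
congr (_ ++ _).
  apply/eq_in_map => j' j'0; rewrite /upd; case: eqP => // -[] jj'.
  by move: jj0; rewrite -jj' j'0.
by rewrite /upd eqxx.
Qed.

(** Averaging over the edges of a vertex that is not a descendant has no
    effect, so the heads may be drawn only when needed. *)
Lemma avg_edges_explore f k x s h :
  avg_edges (edges_below k) (fun h => f (explore h k x s)) h = avgx f k x s.
Proof.
elim: k x s h => [|k IH] x s h; first by rewrite /edges_below sub0n.
have [km|mk] := leqP k.+1 m.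
  rewrite /edges_below (_ : (k.+1 - m)%N = 0%N) /= ?km//.
  by apply/eqP; rewrite subn_eq0.
rewrite edges_belowS//.
have km : (k < m)%N = false by rewrite ltnNge -ltnS mk.
have [ks|ks] := boolP (k.+1 \in s).
  rewrite (@avg_edges_heads k.+1 [::] (enum 'I_d) (edges_below k) _
    (fun l => avgx f k x.+1 ([seq i <- s | i != k.+1] ++ l)))/=.
  - by rewrite km ks -cardE card_ord.
  - exact: enum_uniq.
  move=> h1; rewrite -(IH _ _ h1); apply: eq_avg_edges => h' hh'.
  rewrite km ks; congr (f (explore _ _ _ (_ ++ _))).
  apply: eq_map => j; rewrite hh'// mem_edges_below /= ltnn andbF//.
rewrite (@avg_edges_heads k.+1 [::] (enum 'I_d) (edges_below k) _
    (fun l => avgx f k x s))/=.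
- by rewrite km (negPf ks) unifs_cst// (leq_trans m_gt0).
- exact: enum_uniq.
move=> h1; rewrite -(IH _ _ h1); apply: eq_avg_edges => h' hh'.
by rewrite km (negPf ks).
Qed.

Lemma root_term_averaging : averaging m root_term.
Proof.
have m0 := m_gt0; move=> f x y a c H.
have hs s : all (fun i => (1 <= i <= m)%N) s -> (size (undup s) <= m)%N.
  move=> /allP hs; rewrite -[leqRHS](size_iota 1 m); apply: uniq_leq_size.
    exact: undup_uniq.
  by move=> i; rewrite mem_undup mem_iota add1n ltnS; exact: hs.
apply/andP; split.
  rewrite -(unifs_cst y a m0); apply: le_unifs => s _ /hs /H.
  by rewrite /found => /andP[].
rewrite -(unifs_cst y c m0); apply: le_unifs => s _ /hs /H.
by rewrite /found => /andP[].
Qed.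

Variable n : nat.

Definition valid_heads h := forall k j, (m < k <= n)%N -> (1 <= h (k, j) < k)%N.

Section Correctness.
Variable h : nat * 'I_d -> nat.
Hypothesis hv : valid_heads h.
Local Notation adj := (@ddag_adj d n m h).

Lemma adj_lt (a b : 'I_n.+1) : adj a b -> [/\ (m < a)%N, (0 < b)%N & (b < a)%N].
Proof.
rewrite /ddag_adj => /andP[ma /existsP[j /eqP jb]].
have /andP[h1 h2] : (1 <= h (val a, j) < a)%N by apply: hv; rewrite ma -ltnS /=.
by rewrite -jb.
Qed.

Lemma connect_le (a b : 'I_n.+1) : connect adj a b -> (b <= a)%N /\ ((0 < a)%N -> (0 < b)%N).
Proof.
move=> /connectP[p]; elim: p a b => [|c p IH] a b /=; first by move=> _ ->.
move=> /andP[/adj_lt[_ c0 ca] /IH{}IH] /IH[bc hb].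
by split => [|_]; [exact: leq_trans bc (ltnW ca)|exact: hb].
Qed.

Lemma connect_root (a b : 'I_n.+1) : (a <= m)%N -> connect adj a b -> b = a.
Proof.
move=> am /connectP[[|c p] //= /andP[/adj_lt[ma _ _] _]].
by move: am; rewrite leqNgt ma.
Qed.

Lemma connect_step (a b : 'I_n.+1) : (m < a)%N ->
  connect adj a b = (b == a) || has (fun u => connect adj (inord u) b) (heads h a).
Proof.
move=> ma; apply/idP/orP => [/connectP[[|c p] /=]|].
- by move=> _ ->; left.
- move=> /andP[ac cp] bl; right.
  move: ac; rewrite /ddag_adj => /andP[_ /existsP[j /eqP jc]].
  apply/hasP; exists (h (val a, j)); first by apply: map_f; rewrite mem_enum.
  by rewrite jc inord_val; apply/connectP; exists p.
- move=> [/eqP ->|]; first exact: connect0.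
  move=> /hasP[u /mapP[j _ ->] hb].
  apply: connect_trans hb; apply: connect1; rewrite /ddag_adj ma; apply/existsP; exists j.
  have /andP[_ h2] : (1 <= h (val a, j) < a)%N by apply: hv; rewrite ma -ltnS /=.
  by rewrite inordK// (leq_trans h2)// ltnW.
Qed.

Definition reach_from s : {set 'I_n.+1} :=
  [set v | has (fun u => connect adj (inord u) v) s].

(** Invariant of the exploration: the descendants still to be counted are the
    vertices that can be reached from a pending head. *)
Lemma explore_card k x s : (k <= n)%N -> all (fun i => (1 <= i <= k)%N) s ->
  explore h k x s = (x + #|reach_from s|)%N.
Proof.
elim: k x s => [|k IH] x s kn hs.
  have -> : s = [::].
    by case: s hs => // i s /= /andP[+ _]; case: i => //.
  rewrite /explore /found /= (_ : reach_from [::] = finset.set0) ?cards0//.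
have inordE i : i \in s -> (inord i : 'I_n.+1) = i :> nat.
  by move=> /(allP hs)/andP[_ ik]; rewrite inordK// ltnS (leq_trans ik).
have [km|mk] := leqP k.+1 m.
  rewrite explore_root// /found; congr (_ + _)%N.
  have -> : reach_from s = [set v in [seq (inord i : 'I_n.+1) | i <- s]].
    apply/finset.setP => v; rewrite !inE; apply/hasP/mapP => -[u us uv]; exists u => //.
      apply: connect_root uv; rewrite inordE//.
      by have /andP[_ uk] := allP hs u us; exact: leq_trans km.
    by rewrite uv connect0.
  have U : uniq [seq (inord i : 'I_n.+1) | i <- undup s].
    rewrite map_inj_in_uniq ?undup_uniq// => i j; rewrite !mem_undup => is' js ij.
    by have := congr1 (@nat_of_ord _) ij; rewrite !inordE.
  rewrite cardsE -(size_map (inord : nat -> 'I_n.+1)) -(card_uniqP U).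
  by apply: eq_card => v; rewrite (eq_mem_map _ (mem_undup s)).
rewrite /= (ltnNge k m) -ltnS mk /=; case: ifPn => ks; last first.
  rewrite IH//; first exact: ltnW.
  apply/allP => i si; have /andP[-> /=] := allP hs i si.
  by rewrite leq_eqVlt => /predU1P[ik|//]; move: ks; rewrite -ik si.
set s' := _ ++ _.
have hs' : all (fun i => (1 <= i <= k)%N) s'.
  rewrite all_cat; apply/andP; split; apply/allP => i.
    rewrite mem_filter => /andP[ik /(allP hs)/andP[-> /=]].
    by rewrite leq_eqVlt (negPf ik).
  move=> /mapP[j _ ->]; have := @hv k.+1 j; rewrite mk kn => /(_ isT) /andP[-> /=].
  by rewrite ltnS.
rewrite IH//; last exact: ltnW.
have kE : (inord k.+1 : 'I_n.+1) = k.+1 :> nat by exact: inordE.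
have -> : reach_from s = (inord k.+1 : 'I_n.+1) |: reach_from s'.
  apply/finset.setP => v; rewrite !inE.
  have step_k := @connect_step (inord k.+1) v; rewrite kE in step_k.
  rewrite has_cat; apply/hasP/orP => [[u us uv]|].
    have [uk|uk] := eqVneq u k.+1; last first.
      by right; apply/orP; left; apply/hasP; exists u; rewrite // mem_filter uk.
    move: uv; rewrite uk step_k// => /orP[->|->]; [by left|by right; rewrite orbT].
  move=> [/eqP ->|/orP[/hasP[u]|hh]].
  - by exists k.+1; rewrite // connect0.
  - by rewrite mem_filter => /andP[_ us] uv; exists u.
  - by exists k.+1; rewrite // step_k// hh orbT.
rewrite cardsU1; have -> : (inord k.+1 : 'I_n.+1) \notin reach_from s'.
  rewrite inE; apply/negP => /hasP[u us' /connect_le[+ _]].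
  have /andP[_ uk] := allP hs' u us'.
  by rewrite kE inordK ?ltnS ?(leq_trans uk)//; [rewrite leqNgt ltnS uk|exact: ltnW].
by rewrite add1n addnS addSn.
Qed.

Lemma explore_descendants : (0 < n)%N ->
  #|descendants n m h| = explore h n 0 [:: n].
Proof.
move=> n0; rewrite explore_card//; last by rewrite /= n0 leqnn.
rewrite add0n; apply: eq_card => v; rewrite !inE /= orbF.
have -> : (inord n : 'I_n.+1) = ord_max by apply: val_inj; rewrite /= inordK.
apply/andP/idP => [[]//|nv]; split => //.
by have [_] := connect_le nv; apply.
Qed.

End Correctness.
End Exploration.

(** * Expectations over the random dag *)

Section EdgeExpectation.
Variables (d n m : nat) (disp : measure_display) (T : measurableType disp)
  (R : realType) (P : probability T R) (head : nat * 'I_d -> {RV P >-> nat}).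
Hypothesis hD : random_ddag n m head.
Hypothesis m_gt0 : (0 < m)%N.
Implicit Types (F : (nat * 'I_d -> nat) -> R) (es : seq (nat * 'I_d)) (a : nat * 'I_d -> nat).

Let hd t : nat * 'I_d -> nat := fun e => head e t.

Definition depends_on es F := forall h h', (forall e, e \in es -> h e = h' e) -> F h = F h'.

Lemma measurable_head e i : measurable (head e @^-1` [set i]).
Proof.
rewrite -[X in measurable X]setTI.
have mh : measurable_fun setT (head e) by exact: measurable_funPT.
exact: mh.
Qed.

(** F takes countably many cases according to the head of one edge, and
    depends on fewer edges in each case. *)
Lemma measurable_depends es F : depends_on es F ->
  measurable_fun setT (fun t => F (hd t)).
Proof.
elim: es F => [|e es IH] F hF.
  rewrite (_ : (fun t => F (hd t)) = cst (F (fun=> 0%N))); first exact: measurable_cst.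
  by apply/funext => t; apply: hF.
move=> _ B mB; rewrite setTI.
have -> : (fun t => F (hd t)) @^-1` B =
   \bigcup_i (head e @^-1` [set i] `&` (fun t => F (upd (hd t) e i)) @^-1` B).
  have E t i : head e t = i -> F (upd (hd t) e i) = F (hd t).
    by move=> ei; apply: hF => e' _; rewrite /upd; case: eqP => // ->.
  apply/seteqP; split => t /=.
    by move=> Bt; exists (head e t) => //; split => //=; rewrite E.
  by move=> [i _ [/= ei]]; rewrite E.
apply: bigcupT_measurable => i; apply: measurableI; first exact: measurable_head.
rewrite -[X in measurable X]setTI; apply: (IH (fun h => F (upd h e i))) => //.
move=> h h' hh'; apply: hF => e'; rewrite in_cons /upd; case: eqP => // _ /=.
exact: hh'.
Qed.

Definition cylinder es a : set T := \bigcap_(e in [set` es]) (head e @^-1` [set a e]).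

Lemma measurable_cylinder es a : measurable (cylinder es a).
Proof.
rewrite /cylinder; apply: fin_bigcap_measurable; first exact: finite_seq.
by move=> e _; exact: measurable_head.
Qed.

Lemma cylinder_cons e es a : cylinder (e :: es) a = head e @^-1` [set a e] `&` cylinder es a.
Proof.
apply/seteqP; split => t /=.
  move=> H; split; first by apply: H; rewrite /= in_cons eqxx.
  by move=> e' /= es'; apply: H; rewrite /= in_cons es' orbT.
move=> [h1 h2] e' /=; rewrite in_cons => /orP[/eqP ->//|]; exact: h2.
Qed.

Definition edge_ok (e : nat * 'I_d) := (m < e.1 <= n)%N.

Lemma prob_cylinder es a : uniq es -> all edge_ok es ->
  (forall e, e \in es -> (1 <= a e < e.1)%N) ->
  P (cylinder es a) = (\prod_(e <- es) e.1.-1%:R^-1 : R)%:E.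
Proof.
move=> ues ok ha; have [hu hi] := hD.
rewrite /cylinder (hi es (fun e => [set a e]))//; last by move=> e /(allP ok).
elim: es {ues} ok ha => [|e es IH] /=; first by move=> _ _; rewrite !big_nil.
move=> /andP[eok ok] ha; rewrite !big_cons IH//; last first.
  by move=> e' e's; apply: ha; rewrite in_cons e's orbT.
rewrite EFinM; congr (_ * _)%E.
by case: e eok ha => v j /= vok ha; apply: hu => //; apply: (ha (v, j)); rewrite in_cons eqxx.
Qed.

(** Independence is used only at the end of an induction on es2 that splits
    the cylinder according to the head of the next edge. The induction needs
    the cylinder over es1; the expectation is the case where es1 is empty. *)
Lemma expect_edges es2 es1 a F : (forall h, 0 <= F h) -> depends_on (es1 ++ es2) F ->
  uniq (es1 ++ es2) -> all edge_ok (es1 ++ es2) ->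
  (forall e, e \in es1 -> (1 <= a e < e.1)%N) ->
  (\int[P]_(t in cylinder es1 a) (F (hd t))%:E =
   ((\prod_(e <- es1) e.1.-1%:R^-1) * avg_edges es2 F a)%:E)%E.
Proof.
elim: es2 es1 a F => [|e es2 IH] es1 a F F0 hF u ok ha.
  rewrite cats0 in hF u ok; rewrite /= mulrC EFinM -(prob_cylinder u ok ha).
  rewrite -integral_cst; last exact: measurable_cylinder.
  apply: eq_integral => t; rewrite inE => tc; congr EFin; apply: hF => e /tc.
  by [].
have mF := measurable_depends hF.
have eok : edge_ok e by apply: (allP ok); rewrite mem_cat in_cons eqxx orbT.
have v1 : (0 < e.1.-1)%N by case/andP: eok => me _; move: m_gt0 me; clear; lia.
have ees1 : e \notin es1.
  by move: u; rewrite cat_uniq /= negb_or => /and3P[_ /andP[]].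
have perm_e : perm_eq ((e :: es1) ++ es2) (es1 ++ e :: es2) by rewrite perm_sym perm_catC /= perm_cons perm_catC.
have IHi i : (1 <= i < e.1)%N ->
   (\int[P]_(t in cylinder (e :: es1) (upd a e i)) (F (hd t))%:E =
   ((e.1.-1%:R^-1 * \prod_(e <- es1) e.1.-1%:R^-1) * avg_edges es2 F (upd a e i))%:E)%E.
  move=> ie; rewrite IH ?big_cons//.
  - by move=> h h' hh'; apply: hF => e'; rewrite -(perm_mem perm_e); exact: hh'.
  - by rewrite (perm_uniq perm_e).
  - by rewrite (perm_all _ perm_e).
  - move=> e'; rewrite in_cons /upd; case: eqP => [-> //|_ /=]; exact: ha.
have cylE i : cylinder (e :: es1) (upd a e i) = head e @^-1` [set i] `&` cylinder es1 a.
  rewrite cylinder_cons {1}/upd eqxx; congr (_ `&` _).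
  by apply: eq_bigcapr => e' /= e'1; rewrite /upd; case: eqP e'1 ees1 => // -> ->.
pose Ci i := cylinder (e :: es1) (upd a e i).
have mCi i : measurable (Ci i) by exact: measurable_cylinder.
have tr (D : set nat) : trivIset D Ci.
  by move=> i j _ _ [t]; rewrite /Ci !cylE => -[[/= <- _] [/= <- _]].
pose V := \big[setU/set0]_(i <- index_iota 1 e.1) Ci i.
have mV : measurable V by apply: bigsetU_measurable => i _.
have VE : V `<=` cylinder es1 a.
  by move=> t; rewrite /V -bigcup_seq => -[i _]; rewrite /Ci cylE => -[].
have sumV (g : T -> R) : measurable_fun [set: T] g -> (forall t, 0 <= g t) ->
   (\int[P]_(t in V) (g t)%:E = \sum_(1 <= i < e.1) \int[P]_(t in Ci i) (g t)%:E)%E.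
  move=> mg g0; rewrite /V ge0_integral_bigsetU//.
  - exact: iota_uniq.
  - by apply: measurable_funTS; exact/measurable_EFinP.
  - by move=> t _; rewrite lee_fin.
have e1S : e.1 = e.1.-1.+1 by rewrite prednK//; case/andP: eok => /(leq_ltn_trans (leq0n _)).
have PV : P V = P (cylinder es1 a).
  have P1 A : measurable A -> (\int[P]_(t in A) (cst (1 : R) t)%:E)%E = P A.
    by move=> mA; rewrite -[RHS]mul1e -integral_cst.
  rewrite -(P1 _ mV).
  rewrite (sumV (cst 1))//.
  rewrite (eq_big_nat _ _ (F2 := fun i => (e.1.-1%:R^-1 * \prod_(e <- es1) e.1.-1%:R^-1)%:E)); last first.
    move=> i ie; rewrite P1// /Ci prob_cylinder ?big_cons//.
    - by move: u; rewrite -(perm_uniq perm_e) cat_uniq => /and3P[].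
    - by move: ok; rewrite -(perm_all _ perm_e) all_cat => /andP[].
    - by move=> e'; rewrite in_cons /upd; case: eqP => [-> //|_ /=]; exact: ha.
  rewrite prob_cylinder//; [|by move: u; rewrite cat_uniq => /and3P[]|by move: ok; rewrite all_cat => /andP[]].
  rewrite sumEFin; congr EFin; rewrite sumr_const_nat subn1 -[X in X = _]mulr_natl mulrA divff ?mul1r//.
  by rewrite pnatr_eq0 -lt0n.
have CV : cylinder es1 a `&` V = V by apply/setIidPr.
have PN : P (cylinder es1 a `\` V) = 0%E.
  rewrite measureD//; [|exact: measurable_cylinder|by rewrite (le_lt_trans (probability_le1 _ _))// ?ltry//; exact: measurable_cylinder].
  rewrite CV; transitivity (P (cylinder es1 a) - P (cylinder es1 a))%E.
    by congr (_ - _)%E; exact: PV.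
  by rewrite subee// fin_num_measure//; exact: measurable_cylinder.
rewrite (ge0_negligible_integral _ _ _ _ PN); first last.
- by move=> t _; rewrite lee_fin.
- by apply: measurable_funTS; exact/measurable_EFinP.
- exact: measurable_cylinder.
- by apply: measurableD => //; exact: measurable_cylinder.
rewrite setDD CV sumV//.
rewrite (eq_big_nat _ _ (F2 := fun i => ((e.1.-1%:R^-1 * \prod_(e <- es1) e.1.-1%:R^-1) * avg_edges es2 F (upd a e i))%:E)); last first.
  by move=> i ie; exact: IHi.
rewrite sumEFin; congr EFin; rewrite -mulr_sumr /= /unif -e1S.
by rewrite mulrCA mulrA.
Qed.

End EdgeExpectation.

(** * The law of the number of descendants *)

Section LawOfDescendants.
Variables (d n m : nat) (disp : measure_display) (T : measurableType disp)
  (R : realType) (P : probability T R) (head : nat * 'I_d -> {RV P >-> nat}).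

Lemma eq_avg_edges_valid es (F F' : (nat * 'I_d -> nat) -> R) h :
  (forall h', (forall e, e \in es -> (1 <= h' e <= e.1.-1)%N) -> F h' = F' h') ->
  avg_edges es F h = avg_edges es F' h.
Proof.
suff H es0 h0 : (forall h', (forall e, e \notin es -> h' e = h0 e) ->
    (forall e, e \in es -> (1 <= h' e <= e.1.-1)%N) -> F h' = F' h') ->
    es0 = es -> avg_edges es F h0 = avg_edges es F' h0.
  by move=> Hv; apply: (H es) => // h' _; exact: Hv.
move=> + _; elim: es h0 => [|e es IH] h0 H /=; first exact: H.
apply: eq_unif => i ie; apply: IH => h' hh' hv; apply: H => [e'|e'].
  rewrite in_cons negb_or => /andP[e'e e'es]; rewrite hh'// /upd.
  by rewrite (negPf e'e).
rewrite in_cons; have [e'es _|e'es] := boolP (e' \in es); first exact: hv.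
by rewrite orbF => /eqP ee; rewrite hh'// /upd ee eqxx.
Qed.

Lemma descendants_depends (f : nat -> R) :
  depends_on (edges_below d m n) (fun h => f #|descendants n m h|).
Proof.
move=> h h' hh'; congr (f #|_|); rewrite /descendants.
suff -> : @ddag_adj d n m h = @ddag_adj d n m h' by [].
apply/funext => k; apply/funext => l; rewrite /ddag_adj.
have [mk|//] := boolP (m < k)%N; congr (_ && _); apply: eq_existsb => j.
by rewrite hh'// mem_edges_below /= mk -ltnS ltn_ord.
Qed.

Lemma measurable_descendants (f : nat -> R) :
  measurable_fun [set: T] (fun t => f #|descendants n m (fun e => head e t)|).
Proof. exact: measurable_depends (@descendants_depends f). Qed.

Hypothesis hD : random_ddag n m head.
Hypotheses (m_gt0 : (0 < m)%N) (mn : (m < n)%N).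

Lemma integral_law (f : nat -> R) : (forall x, 0 <= f x) ->
  (\int[P]_t (f #|descendants n m (fun e => head e t)|)%:E =
   (chain d n.-1 m (root_term m f) 1 d)%:E)%E.
Proof.
move=> f0; have n0 := leq_ltn_trans (leq0n _) mn.
have := @expect_edges d n m disp T R P head hD m_gt0 (edges_below d m n) [::]
  (fun=> 0%N) (fun h => f #|descendants n m h|).
rewrite /cylinder (_ : [set` [::]] = set0); last by apply/seteqP; split.
rewrite bigcap_set0 big_nil mul1r => ->//; last 3 first.
- exact: descendants_depends.
- exact: uniq_edges_below.
- by apply/allP => e; rewrite mem_edges_below.
congr EFin.
transitivity (avg_edges (edges_below d m n) (fun h => f (explore m h n 0 [:: n])) (fun=> 0%N)).
  apply: eq_avg_edges_valid => h hv; rewrite explore_descendants// => k j kn.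
  have /andP[h1 h2] : (1 <= h (k, j) <= k.-1)%N by apply: (hv (k, j)); rewrite mem_edges_below.
  by rewrite h1 /=; move: h1 h2; clear; lia.
rewrite avg_edges_explore//.
case: n n0 mn => // n' _ mn' /=; rewrite leqNgt mn' /= in_cons eqxx /= .
by rewrite unifs_avgx.
Qed.

Lemma integrable_descendants (f : nat -> R) :
  P.-integrable [set: T] (fun t => (f #|descendants n m (fun e => head e t)|)%:E).
Proof.
apply/integrableP; split; first by apply/measurable_EFinP; exact: measurable_descendants.
under eq_integral do rewrite abse_EFin.
by rewrite (integral_law (f := fun x => `|f x|))// ltry.
Qed.

Lemma root_termB (f g : nat -> R) x y :
  root_term m (fun x => f x - g x) x y = root_term m f x y - root_term m g x y.
Proof. by rewrite /root_term -mulN1r -unifsZ -unifsD; apply: eq_unifs => s _ _; rewrite mulN1r. Qed.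

(** A function f of any sign is the difference of two nonnegative ones. *)
Lemma expectation_law (f : nat -> R) :
  ('E_P[fun t => f #|descendants n m (fun e => head e t)|] =
   (chain d n.-1 m (root_term m f) 1 d)%:E)%E.
Proof.
rewrite unlock; pose fp x := (`|f x| + f x) / 2; pose fn x := (`|f x| - f x) / 2.
have fE x : f x = fp x - fn x by rewrite /fp /fn; field.
have fp0 x : 0 <= fp x.
  by have := lerNnormlW (lexx `|f x|); rewrite /fp; lra.
have fn0 x : 0 <= fn x by have := ler_norm (f x); rewrite /fn; lra.
transitivity (\int[P]_t ((fp #|descendants n m (fun e => head e t)|)%:E -
    (fn #|descendants n m (fun e => head e t)|)%:E))%E.
  by apply: eq_integral => t _; rewrite fE EFinB.
rewrite integralB//; [|exact: integrable_descendants|exact: integrable_descendants].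
rewrite !integral_law//.
rewrite -EFinB; congr EFin; rewrite -chainB; apply: eq_chain => x y.
by rewrite -root_termB /root_term; apply: eq_unifs => s _ _.
Qed.

End LawOfDescendants.

Section LawMoments.
Variables (R : realType) (d : nat).
Hypothesis d_gt1 : (1 < d)%N.
Let d_gt0 : (0 < d)%N := ltnW d_gt1.
Local Notation D := d.-1.
Variable m : nat -> nat.
Hypothesis m_gt0 : forall n, (0 < n)%N -> (0 < m n)%N.
Hypothesis hm : forall e : R, 0 < e -> \forall n \near \oo, (m n)%:R <= e * scale R d n.

Definition dlaw n (f : nat -> R) := law d m (fun n => root_term (m n)) n f.

Lemma le_dlaw n f g : (0 < n)%N -> (forall x, f x <= g x) -> dlaw n f <= dlaw n g.
Proof.
move=> n0 h; apply: le_chain => //; first exact: reachable_start.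
by move=> x y _; apply: le_unifs => s _ _; exact: h.
Qed.

Lemma dlawD n f g : dlaw n (fun x => f x + g x) = dlaw n f + dlaw n g.
Proof. by rewrite /dlaw /law -chainD; apply: eq_chain => x y; rewrite /root_term unifsD. Qed.

Lemma dlawZ n a f : dlaw n (fun x => a * f x) = a * dlaw n f.
Proof. by rewrite /dlaw /law -chainZ; apply: eq_chain => x y; rewrite /root_term unifsZ. Qed.

Lemma dlaw1 n : (0 < n)%N -> dlaw n (fun=> 1) = 1.
Proof.
move=> n0; rewrite /dlaw /law -[RHS](chain_cst d n.-1 (m n) 1 1 d).
by apply: eq_chain => x y; rewrite /root_term unifs_cst// m_gt0.
Qed.

Lemma near_m_lt : \forall n \near \oo, (m n < n)%N.
Proof.
have H := near_sizes d_gt1 hm (isT : (0 < 1)%N) (isT : (0 < 1)%N).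
move: H; apply: filter_app; near=> n; move=> [n1 _ _ mz Kn].
apply: (leq_ltn_trans mz); apply: (@leq_ltn_trans n.-1); last by rewrite prednK// ltnW.
by apply: leq_trans Kn; exact: leq_pmull.
Unshelve. all: by end_near. Qed.

(** Down to a level z of the order of the scale, moment_found bounds the
    number found by a power of (n / z)^(d-1), which is again of the order of
    the scale; below z at most z more descendants remain. *)
Lemma dlaw_moment r : exists C : R, \forall n \near \oo,
  dlaw n (fun x => (x%:R / scale R d n) ^+ r) <= C.
Proof.
exists (2 ^+ r * (rising R r 1 + 2 ^+ r)).
have H := near_sizes d_gt1 hm (isT : (0 < 1)%N) (isT : (0 < 1)%N).
move: H; apply: filter_app; near=> n; move=> [n1 h1 h2 mz Kn].
have s0 : 0 < scale R d n by apply: scale_gt0; exact: ltnW.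
move: h1 h2 mz Kn; rewrite divr1 !mul1n; set z := (Num.truncn _).+1 => h1 h2 mz Kn.
have sr0 : 0 <= (scale R d n) ^- r by rewrite invr_ge0 exprn_ge0// ltW.
have nS : n.-1.+1 = n by rewrite prednK// ltnW.
rewrite /dlaw /law (@chain_comp _ _ n.-1 z (m n)) ?mz//.
pose g x := (scale R d n) ^- r * (2 ^+ r * ((x + 1)%:R ^+ r + z%:R ^+ r)).
apply: (@le_trans _ _ (chain d n.-1 z (fun x _ => g x) 1 d)).
  apply: le_chain => //; first exact: reachable_start.
  move=> x y _.
  have av := @root_term_averaging R (m n) (m_gt0 (ltnW n1)).
  have := @chain_averaging R d (m n) z _ av mz (fun x => (x%:R / scale R d n) ^+ r) x y 0 (g x).
  move=> /(_ _)/andP; case=> //; move=> i iz.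
  rewrite exprn_ge0 ?divr_ge0 ?(ltW s0)//= /g expr_div_n mulrC; apply: ler_wpM2l => //.
  have p0 : 0 <= (x + 1)%:R :> R by [].
  have z0 : 0 <= z%:R :> R by [].
  apply: (@le_trans _ _ (((x + 1)%:R + z%:R) ^+ r)).
    apply: lerXn2r; rewrite ?nnegrE ?addr_ge0// -natrD ler_nat.
    by move: iz; clear; lia.
  have [xz|/ltW xz] := leP ((x + 1)%:R : R) z%:R.
    apply: (@le_trans _ _ ((2 * z%:R) ^+ r)).
      by apply: lerXn2r; rewrite ?nnegrE ?addr_ge0 ?mulr_ge0//; lra.
    by rewrite exprMn; apply: ler_wpM2l; [nneg|rewrite lerDr; nneg].
  apply: (@le_trans _ _ ((2 * (x + 1)%:R) ^+ r)).
    by apply: lerXn2r; rewrite ?nnegrE ?addr_ge0 ?mulr_ge0//; lra.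
  by rewrite exprMn; apply: ler_wpM2l; [nneg|rewrite lerDl; nneg].
rewrite /g chainZ chainZ chainD chain_cst.
have mf := moment_found R d_gt1 r Kn; rewrite nS in mf.
have hz : (n%:R / z.+1%:R) ^+ (r * D) <= scale R d n ^+ r.
  rewrite mulnC exprM; apply: lerXn2r; rewrite ?nnegrE; [nneg|exact: ltW|].
  rewrite expr_div_n -(scaleE R d_gt1) -[X in _ ^+ X / _](prednK d_gt0) exprSr.
  rewrite ler_pdivrMr ?exprn_gt0// mulrC ler_pM2l//.
  apply: lerXn2r; rewrite ?nnegrE ?(ltW s0)//.
  by apply: (le_trans h1); rewrite ler_nat.
rewrite mulrC ler_pdivrMr ?exprn_gt0// -mulrA; apply: ler_wpM2l; first nneg.
rewrite mulrDl; apply: lerD.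
  by apply: (le_trans mf); apply: ler_wpM2l => //; exact/ltW/rising_gt0.
rewrite -exprMn; apply: lerXn2r; rewrite ?nnegrE//.
by rewrite mulr_ge0// ltW.
Unshelve. all: by end_near. Qed.

End LawMoments.

(** * Laws determined by indicators *)

Lemma measurable_EFin (R : realType) (disp : measure_display)
    (T : measurableType disp) (f : T -> R) :
  measurable_fun [set: T] f -> measurable_fun [set: T] (fun t => (f t)%:E).
Proof. by move=> mf; exact/measurable_EFinP. Qed.

Section WeightedLaws.
Import HBNNSimple.
Variables (R : realType).

Section Expansion.
Variables (disp : measure_display) (T : measurableType disp)
  (mu : {measure set T -> \bar R}) (X w : T -> R) (f : R -> R).
Hypotheses (mX : measurable_fun [set: T] X) (mw : measurable_fun [set: T] w)
  (w0 : forall t, 0 <= w t) (mf : measurable_fun [set: R] f)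
  (f0 : forall x, 0 <= f x).

Let mEf : measurable_fun [set: R] (EFin \o f).
Proof. exact/measurable_EFinP. Qed.

Let approx := nnsfun_approx measurableT mEf.

Lemma measurable_weighted (g : R -> R) : measurable_fun [set: R] g ->
  measurable_fun [set: T] (fun t => g (X t) * w t).
Proof. by move=> mg; apply: measurable_funM => //; exact: measurableT_comp. Qed.

Lemma integral_weighted_simple (h : {nnsfun R >-> R}) :
  (\int[mu]_t (h (X t) * w t)%:E =
   \sum_(y \in range h) y%:E * \int[mu]_t (\1_(h @^-1` [set y]) (X t) * w t)%:E)%E.
Proof.
have m1 y : measurable_fun [set: R] (\1_(h @^-1` [set y]) : R -> R) by [].
have pos y t : (0 <= y%:E * (\1_(h @^-1` [set y]) (X t) * w t)%:E)%E.
  rewrite -EFinM mulrA EFinM mule_ge0 ?lee_fin//.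
  by rewrite -lee_fin EFinM nnfun_muleindic_ge0.
transitivity (\int[mu]_t \sum_(y \in range h)
    (y%:E * (\1_(h @^-1` [set y]) (X t) * w t)%:E))%E.
  apply: eq_integral => t _.
  under eq_fsbigr do rewrite -EFinM.
  rewrite fsumEFin//; congr EFin; rewrite {1}fimfunE mulrC.
  rewrite !fsbig_finite//= big_distrr/=; apply: eq_bigr => y _.
  by rewrite mulrC mulrA.
rewrite ge0_integral_fsum//; last first.
  by move=> y; apply: measurable_funeM; apply: measurable_EFin; exact: measurable_weighted.
apply: eq_fsbigr => y; rewrite inE => -[x _ hx].
rewrite ge0_integralZl//.
- by apply: measurable_EFin; exact: measurable_weighted.
- by move=> t _; rewrite lee_fin mulr_ge0.
- by rewrite lee_fin -hx.
Qed.

Lemma integral_weighted :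
  (\int[mu]_t (approx n (X t) * w t)%:E @[n --> \oo] -->
   \int[mu]_t (f (X t) * w t)%:E)%E.
Proof.
have -> : (\int[mu]_t (f (X t) * w t)%:E =
    \int[mu]_t (limn (fun n => (approx n (X t) * w t)%:E)))%E.
  apply: eq_integral => t _; apply/esym/cvg_lim => //.
  apply: cvg_EFin; first exact: nearW.
  apply: cvgM; last exact: cvg_cst.
  have h := cvg_nnsfun_approx measurableT mEf (fun x _ => f0 x) (I : [set: R] (X t)).
  by move/fine_cvgP : h => [].
apply: cvg_monotone_convergence => //.
- by move=> n; apply: measurable_EFin; exact: measurable_weighted.
- by move=> n t _; rewrite lee_fin mulr_ge0.
- move=> t _ a b ab; rewrite lee_fin ler_wpM2r//; exact/lefP/nd_nnsfun_approx.
Qed.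

End Expansion.

(** The extension from indicators to nonnegative functions through simple
    functions, for two weighted measures at a time. With a density as weight
    it computes expectations; with a function of independent variables as
    weight it gives products of expectations. *)
Lemma integral_eq_indic
  (disp1 : measure_display) (T1 : measurableType disp1) (mu1 : {measure set T1 -> \bar R})
  (disp2 : measure_display) (T2 : measurableType disp2) (mu2 : {measure set T2 -> \bar R})
  (X1 w1 : T1 -> R) (X2 w2 : T2 -> R) (f : R -> R) :
  measurable_fun [set: T1] X1 -> measurable_fun [set: T1] w1 -> (forall t, 0 <= w1 t) ->
  measurable_fun [set: T2] X2 -> measurable_fun [set: T2] w2 -> (forall t, 0 <= w2 t) ->
  measurable_fun [set: R] f -> (forall x, 0 <= f x) ->
  (forall A : set R, measurable A -> \int[mu1]_t (\1_A (X1 t) * w1 t)%:E =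
     \int[mu2]_t (\1_A (X2 t) * w2 t)%:E)%E ->
  (\int[mu1]_t (f (X1 t) * w1 t)%:E = \int[mu2]_t (f (X2 t) * w2 t)%:E)%E.
Proof.
move=> mX1 mw1 w10 mX2 mw2 w20 mf f0 eq1.
have := @integral_weighted _ _ mu1 X1 w1 f mX1 mw1 w10 mf f0.
under eq_fun do rewrite integral_weighted_simple//.
have := @integral_weighted _ _ mu2 X2 w2 f mX2 mw2 w20 mf f0.
under eq_fun do rewrite integral_weighted_simple//.
move=> h2 h1; rewrite -(cvg_lim _ h1)// -(cvg_lim _ h2)//; congr (limn _).
by apply/funext => n; apply: eq_fsbigr => y _; rewrite eq1.
Qed.

End WeightedLaws.

(** * Gamma integrals *)

Section GammaIntegrals.
Variable R : realType.
Local Notation mu := (@lebesgue_measure R).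
Implicit Types (F f g : R -> R) (a c s : R).

Lemma within_powR a : 0 <= a -> {within `[0, +oo[, continuous (fun x : R => x `^ a)}.
Proof.
rewrite le_eqVlt => /predU1P[<-|a0].
  have -> : (fun x : R => x `^ 0) = cst 1 by apply/funext => x; rewrite powRr0.
  by move=> x; exact: cst_continuous.
apply/continuous_within_itvcyP; split.
  move=> x; rewrite in_itv/= andbT => x0.
  apply: differentiable_continuous; apply/derivable1_diffP.
  by have [] := is_derive1_powR a x0.
rewrite powR0 ?gt_eqF//; apply/cvgrPdist_le => e e0; near=> x.
have x0 : 0 < x by near: x; exact: nbhs_right_gt.
rewrite sub0r normrN ger0_norm ?powR_ge0//.
have -> : e = (e `^ a^-1) `^ a by rewrite -powRrM mulVf ?gt_eqF// powRr1// ltW.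
apply: ge0_ler_powR; rewrite ?nnegrE ?powR_ge0 ?(ltW x0) ?(ltW a0)//.
near: x; apply: nbhs_right_le; exact: powR_gt0.
Unshelve. all: by end_near. Qed.

(** The fundamental theorem of calculus on the half-line for the derivative f
    - g. Keeping the integrals of the nonnegative functions f and g on
    different sides gives integration by parts without knowing that they are
    finite. *)
Lemma parts_halfline F f g (l : R) :
  (forall x, 0 <= f x) -> (forall x, 0 <= g x) ->
  measurable_fun [set: R] f -> measurable_fun [set: R] g ->
  {within `[0, +oo[, continuous f} -> {within `[0, +oo[, continuous g} ->
  (forall x : R, 0 < x -> is_derive x (1 : R) F (f x - g x)) ->
  F x @[x --> (0 : R)^'+] --> F 0 -> F n%:R @[n --> \oo] --> l ->
  (\int[mu]_(x in `[0%R, +oo[) (f x)%:E =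
   (l - F 0)%:E + \int[mu]_(x in `[0%R, +oo[) (g x)%:E)%E.
Proof.
move=> f0 g0 mf mg cf cg dF F0 Fl.
have hf := @ge0_cvgn_integral R mu f f0 mf.
have hg := @ge0_cvgn_integral R mu g g0 mg.
rewrite -(cvg_lim _ hf)//; apply/cvg_lim => //.
have hl : ((F n%:R - F 0)%:E + \int[mu]_(x in `[0%R, n%:R]) (g x)%:E @[n --> \oo] -->
   (l - F 0)%:E + \int[mu]_(x in `[0%R, +oo[) (g x)%:E)%E.
  apply: cvgeD => //.
  by apply: cvg_EFin; [exact: nearW|apply: cvgB => //; exact: cvg_cst].
apply: cvg_trans hl; apply: near_eq_cvg; near=> n.
have n0 : 0 < n%:R :> R by rewrite ltr0n; near: n; exact: nbhs_infty_gt.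
have sub : `[0, n%:R]%classic `<=` (`[0, +oo[%classic : set R).
  by move=> x /=; rewrite !in_itv/= => /andP[-> _].
have cf' := continuous_subspaceW sub cf; have cg' := continuous_subspaceW sub cg.
have If := continuous_compact_integrable (@segment_compact R 0 n%:R) cf'.
have Ig := continuous_compact_integrable (@segment_compact R 0 n%:R) cg'.
have -> : (F n%:R - F 0)%:E = (\int[mu]_(x in `[0%R, n%:R]) ((f \- g) x)%:E)%E.
  rewrite EFinB; apply/esym/continuous_FTC2 => //.
  - by move=> x; apply: continuousB; [exact: cf'|exact: cg'].
  - split => //.
      by move=> x; rewrite in_itv/= => /andP[x0 _]; have [] := dF x x0.
    apply: cvg_at_left_filter; apply: differentiable_continuous; apply/derivable1_diffP.
    by have [] := dF _ n0.
  - move=> x; rewrite in_itv/= => /andP[x0 _]; rewrite derive1E.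
    by have [_ ->] := dF x x0.
have -> : (\int[mu]_(x in `[0%R, n%:R]) ((f \- g) x)%:E =
  \int[mu]_(x in `[0%R, n%:R]) (f x)%:E - \int[mu]_(x in `[0%R, n%:R]) (g x)%:E)%E.
  by rewrite -integralB_EFin.
rewrite subeK//.
exact: integrable_fin_num Ig.
Unshelve. all: by end_near. Qed.

Definition gker a c x : R := x `^ a * expR (- (c * x)).

Lemma gker_ge0 a c x : 0 <= gker a c x.
Proof. by rewrite mulr_ge0 ?powR_ge0 ?expR_ge0. Qed.

Lemma measurable_expRN c : measurable_fun [set: R] (fun x : R => expR (- (c * x))).
Proof.
apply: (@measurableT_comp _ _ _ _ _ _ expR) => //.
by apply: measurableT_comp => //; exact: measurable_funM.
Qed.

Lemma measurable_gker a c : measurable_fun [set: R] (gker a c).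
Proof.
apply: measurable_funM; first exact: measurable_powR.
exact: measurable_expRN.
Qed.

Lemma continuous_expRN c : continuous (fun x : R => expR (- (c * x))).
Proof.
move=> x; apply: (@continuous_comp _ _ _ (fun x : R => - (c * x)) expR).
  by apply: cvgN; apply: cvgM; [exact: cvg_cst|exact: cvg_id].
exact: continuous_expR.
Qed.

Lemma within_gker a c : 0 <= a -> {within `[0, +oo[, continuous (gker a c)}.
Proof.
move=> a0 x; apply: cvgM; first exact: within_powR.
by apply: continuous_subspaceT; exact: continuous_expRN.
Qed.

(** From ln v <= v at v = x / (2 a) follows a ln x <= x / 2 + a ln (2 a). *)
Lemma gker_le a : 0 <= a -> exists2 C, 0 <= C & forall x, 0 <= x ->
  gker a 1 x <= C * expR (- (2^-1 * x)).
Proof.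
rewrite le_eqVlt => /predU1P[<-|a0].
  exists 1 => // x x0; rewrite /gker powRr0 ler_pM2l// ler_expR; lra.
exists (expR (a * ln (2 * a))); first exact: expR_ge0.
move=> x; rewrite le_eqVlt => /predU1P[<-|x0].
  by rewrite /gker powR0 ?gt_eqF// mul0r mulr_ge0 ?expR_ge0.
rewrite /gker /powR gt_eqF// -!expRD ler_expR.
have x2 : 0 < x / (2 * a) by rewrite divr_gt0// mulr_gt0.
have -> : ln x = ln (x / (2 * a)) + ln (2 * a).
  rewrite -lnM; [|by rewrite posrE|by rewrite posrE mulr_gt0].
  by congr ln; field; rewrite gt_eqF.
have h : ln (x / (2 * a)) <= x / (2 * a).
  exact: ltW (ln_sublinear x2).
have : a * ln (x / (2 * a)) <= x / 2.
  apply: (le_trans (ler_wpM2l (ltW a0) h)); rewrite le_eqVlt; apply/orP; left.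
  by apply/eqP; field; rewrite gt_eqF.
by rewrite mulrDr; lra.
Qed.

Lemma cvg_scale_nat c : 0 < c -> c * n%:R @[n --> \oo] --> +oo.
Proof.
move=> c0; apply: (cvg_comp (fun n : nat => n%:R : R) (fun x => c * x)); first exact: cvgr_idn.
by apply: gt0_cvgMry => //; exact: cvg_id.
Qed.

Lemma gker_cvg0 a : 0 <= a -> gker a 1 n%:R @[n --> \oo] --> (0 : R).
Proof.
move=> a0; have [C C0 hC] := gker_le a0.
apply: (@squeeze_cvgr _ _ _ _ (fun=> 0) (fun n => C * expR (- (2^-1 * n%:R)))).
- by near=> n; rewrite gker_ge0 hC.
- exact: cvg_cst.
- rewrite -[X in _ --> X](mulr0 C); apply: cvgM; first exact: cvg_cst.
  apply: (cvg_comp (fun n : nat => 2^-1 * n%:R : R) (fun x => expR (- x))); last exact: cvgr_expR.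
  by apply: cvg_scale_nat; rewrite invr_gt0.
Unshelve. all: by end_near. Qed.

Lemma gker_at0 a : 0 <= a -> gker a 1 x @[x --> (0 : R)^'+] --> gker a 1 0.
Proof. by move=> /(@within_gker _ 1) /continuous_within_itvcyP[]. Qed.

Lemma integral_exp c : 0 < c ->
  (\int[mu]_(x in `[0%R, +oo[) (expR (- (c * x)))%:E = (c^-1)%:E)%E.
Proof.
move=> c0; pose F x := - c^-1 * expR (- (c * x)).
have cE := @continuous_expRN c.
have -> : ((c^-1)%:E = (0 - F 0)%:E + \int[mu]_(x in `[0%R, +oo[) (0 : R)%:E)%E.
  by rewrite integral0 adde0 /F mulr0 oppr0 expR0; congr EFin; ring.
apply: parts_halfline => //.
- exact: measurable_expRN.
- exact: continuous_subspaceT.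
- by apply: continuous_subspaceT; exact: cst_continuous.
- move=> x x0; apply: trigger_derive; rewrite /= subr0 /GRing.scale/=.
  by field; rewrite gt_eqF.
- apply: cvg_at_right_filter; apply: cvgM; [exact: cvg_cst|exact: cE].
- rewrite -[X in _ --> X](mulr0 (- c^-1)); apply: cvgM; first exact: cvg_cst.
  apply: (cvg_comp (fun n : nat => c * n%:R : R) (fun x => expR (- x))); last exact: cvgr_expR.
  exact: cvg_scale_nat.
Qed.

Lemma gker_itv_lty a : 0 <= a ->
  (\int[mu]_(x in `[0%R, +oo[) (gker a 1 x)%:E < +oo)%E.
Proof.
move=> a0; have [C C0 hC] := gker_le a0.
apply: (@le_lt_trans _ _ (\int[mu]_(x in `[0%R, +oo[) (C%:E * (expR (- (2^-1 * x)))%:E))%E).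
  apply: ge0_le_integral => //.
  - by move=> x _; rewrite lee_fin gker_ge0.
  - by apply: measurable_funTS; apply: measurable_EFin; exact: measurable_gker.
  - apply: measurable_funTS; apply: measurable_funeM; apply: measurable_EFin; exact: measurable_expRN.
  - by move=> x /=; rewrite in_itv/= andbT => x0; rewrite -EFinM lee_fin hC.
rewrite ge0_integralZl//.
  by rewrite integral_exp ?invr_gt0// -EFinM ltry.
by apply: measurable_funTS; apply: measurable_EFin; exact: measurable_expRN.
Qed.

Lemma gker_itv_gt0 a : 0 <= a ->
  (0 < \int[mu]_(x in `[0%R, +oo[) (gker a 1 x)%:E)%E.
Proof.
move=> a0; apply: (@lt_le_trans _ _ (expR (- 2))%:E); first by rewrite lte_fin expR_gt0.
apply: (@le_trans _ _ (\int[mu]_(x in `[1%R, 2%R]) (expR (- 2))%:E)%E).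
  rewrite integral_cst//= lebesgue_measure_itv/= lte_fin ltr1n.
  by rewrite -EFinB -EFinM (_ : 2 - 1 = 1 :> R) ?mulr1//; ring.
apply: (@le_trans _ _ (\int[mu]_(x in `[1%R, 2%R]) (gker a 1 x)%:E)%E).
  apply: ge0_le_integral => //.
  - by apply: measurable_funTS; apply: measurable_EFin; exact: measurable_gker.
  - move=> x /=; rewrite in_itv/= => /andP[x1 x2]; rewrite lee_fin /gker.
    rewrite -[leLHS]mul1r; apply: ler_pM; rewrite ?expR_ge0//.
      have -> : (1 : R) = 1 `^ a by rewrite powR1.
      by apply: ge0_ler_powR; rewrite ?nnegrE ?ler01// (le_trans ler01).
    by rewrite ler_expR; lra.
apply: ge0_subset_integral => //.
- by apply: measurable_funTS; apply: measurable_EFin; exact: measurable_gker.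
- by move=> x _; rewrite lee_fin gker_ge0.
- by move=> x /=; rewrite !in_itv/= => /andP[x1 _]; rewrite (le_trans ler01).
Qed.

Lemma GammaE s : 1 <= s ->
  ((Gamma s)%:E = \int[mu]_(x in `[0%R, +oo[) (gker (s - 1) 1 x)%:E)%E.
Proof.
move=> s1; have a0 : 0 <= s - 1 by rewrite subr_ge0.
rewrite /Gamma /Rintegral -integral_itv_obnd_cbnd; last first.
  by apply: measurable_funTS; apply: measurable_EFin; exact: measurable_gker.
have -> : (\int[mu]_(x in `]0%R, +oo[) (x `^ (s - 1) * expR (- x))%:E =
    \int[mu]_(x in `]0%R, +oo[) (gker (s - 1) 1 x)%:E)%E.
  by apply: eq_integral => x _; rewrite /gker mul1r.
rewrite fineK//.
rewrite integral_itv_obnd_cbnd; last first.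
  by apply: measurable_funTS; apply: measurable_EFin; exact: measurable_gker.
rewrite ge0_fin_numE ?gker_itv_lty//; apply: integral_ge0 => x _.
by rewrite lee_fin gker_ge0.
Qed.

Lemma Gamma_gt0 s : 1 <= s -> 0 < Gamma s :> R.
Proof. by move=> s1; rewrite -lte_fin GammaE// gker_itv_gt0// subr_ge0. Qed.

(** The change of variables from x to c x. *)
Lemma integral_gker s c : 1 <= s -> 0 < c ->
  (\int[mu]_(x in `[0%R, +oo[) (gker (s - 1) c x)%:E = (c `^ (- s) * Gamma s)%:E)%E.
Proof.
move=> s1 c0; have a0 : 0 <= s - 1 by rewrite subr_ge0.
have dF x : is_derive x (1 : R) (fun y : R => c * y) c.
  by apply: trigger_derive; rewrite /GRing.scale/=; ring.
have F' : derive1 (fun y : R => c * y) = cst c.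
  by apply/funext => x; rewrite derive1E; have [_ ->] := dF x.
have := @increasing_ge0_integration_by_substitutiony R (fun y => c * y) (gker (s - 1) 1) 0.
rewrite mulr0 F' => H; rewrite EFinM GammaE// H; first last.
- by move=> x _; exact: gker_ge0.
- exact: within_gker.
- by apply: gt0_cvgMry => //; exact: cvg_id.
- split; first by move=> x _; have [] := dF x.
  by apply: cvg_at_right_filter; apply: cvgM; [exact: cvg_cst|exact: cvg_id].
- by apply/cvg_ex; exists c; exact: cvg_cst.
- by apply/cvg_ex; exists c; exact: cvg_cst.
- by move=> x _; exact: cst_continuous.
- by move=> x y _ _ xy; rewrite ltr_pM2l.
rewrite -ge0_integralZl//.
- apply: eq_integral => x; rewrite inE/= in_itv/= andbT => x0.
  rewrite -EFinM; congr EFin.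
  rewrite -[RHS]/(c `^ (- s) * (gker (s - 1) 1 (c * x) * c)) /gker mul1r powRM// ?(ltW c0)//.
  have e1 : c `^ (- s) * (c `^ (s - 1)) = c^-1.
    rewrite -powRD; last by rewrite (gt_eqF c0) implybT.
    by rewrite (_ : - s + (s - 1) = -1) ?powR_inv1 ?(ltW c0)//; ring.
  transitivity ((c `^ (- s) * c `^ (s - 1)) * c * (x `^ (s - 1) * expR (- (c * x)))); last by ring.
  by rewrite e1 mulVf ?mul1r// gt_eqF.
- apply: measurable_funTS; apply: measurable_EFin; apply: measurable_funM => //.
  by apply: measurableT_comp; [exact: measurable_gker|exact: measurable_funM].
- by move=> x _; rewrite lee_fin mulr_ge0 ?gker_ge0// ltW.
- by rewrite lee_fin powR_ge0.
Qed.

Lemma Gamma1 : Gamma (1 : R) = 1.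
Proof.
apply: EFin_inj; rewrite GammaE// subrr.
transitivity (\int[mu]_(x in `[0%R, +oo[) (expR (- (1 * x)))%:E)%E; last first.
  by rewrite integral_exp// invr1.
by apply: eq_integral => x _; rewrite /gker powRr0 mul1r.
Qed.

Lemma GammaS s : 1 <= s -> Gamma (s + 1) = s * Gamma s.
Proof.
move=> s1; have s0 : 0 < s := lt_le_trans ltr01 s1.
have a0 : 0 <= s - 1 by rewrite subr_ge0.
apply: EFin_inj; rewrite GammaE; last by rewrite lerDr ltW.
rewrite (addrK 1 s) EFinM GammaE//.
rewrite -ge0_integralZl//; first last.
- by rewrite lee_fin ltW.
- by move=> x _; rewrite lee_fin gker_ge0.
- apply: measurable_funTS; apply: measurable_EFin; exact: measurable_gker.
pose F x := - gker s 1 x.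
have F0 : F 0 = 0 by rewrite /F /gker powR0 ?gt_eqF// mul0r oppr0.
transitivity ((0 - F 0)%:E + \int[mu]_(x in `[0%R, +oo[) (s * gker (s - 1) 1 x)%:E)%E; last first.
  by rewrite F0 subrr add0e; apply: eq_integral => x _; rewrite EFinM.
apply: (@parts_halfline F (gker s 1) (fun x => s * gker (s - 1) 1 x)).
- by move=> x; exact: gker_ge0.
- by move=> x; rewrite mulr_ge0 ?gker_ge0// ltW.
- exact: measurable_gker.
- by apply: measurable_funM => //; exact: measurable_gker.
- by apply: within_gker; exact: ltW.
- by move=> x; apply: cvgM; [exact: cvg_cst|exact: within_gker].
- move=> x x0; have h := is_derive1_powR s x0.
  rewrite /F /gker; apply: trigger_derive; rewrite /GRing.scale/=.
  by ring.
- by apply: cvgN; apply: gker_at0; exact: ltW.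
- by rewrite -oppr0; apply: cvgN; apply: gker_cvg0; exact: ltW.
Qed.

End GammaIntegrals.

(** * Values of the Gamma function *)

Section GammaThreeHalves.
Variable R : realType.
Local Notation mu := (@lebesgue_measure R).

(** Integration by parts: x exp (- x^2) has derivative exp (- x^2) - 2 x^2 exp
    (- x^2). *)
Lemma gauss_second_moment :
  (\int[mu]_(x in `[0%R, +oo[) (2 * x ^+ 2 * gauss_fun x)%:E = (Num.sqrt pi / 2 : R)%:E)%E.
Proof.
pose F (x : R) := - (x * gauss_fun x).
have cg : continuous (@gauss_fun R) by exact: continuous_gauss_fun.
rewrite -integral0y_gauss.
transitivity ((0 - F 0)%:E + \int[mu]_(x in `[0%R, +oo[) (gauss_fun x)%:E)%E; last first.
  by rewrite /F mul0r oppr0 subrr add0e.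
have sq : continuous (fun x : R => 2 * x ^+ 2).
  by move=> x; apply: cvgM; [exact: cvg_cst|exact: exprn_continuous].
apply: parts_halfline.
- by move=> x; rewrite mulr_ge0 ?gauss_fun_ge0// mulr_ge0 ?sqr_ge0.
- exact: gauss_fun_ge0.
- apply: measurable_funM; last exact: measurable_gauss_fun.
  exact: continuous_measurable_fun.
- exact: measurable_gauss_fun.
- by apply: continuous_subspaceT => x; apply: cvgM; [exact: sq|exact: cg].
- exact: continuous_subspaceT.
- move=> x x0; rewrite /F /gauss_fun; apply: trigger_derive; rewrite /GRing.scale/=.
  by ring.
- apply: cvg_at_right_filter; apply: cvgN; apply: cvgM; [exact: cvg_id|exact: cg].
- rewrite -oppr0; apply: cvgN.
  apply: (@squeeze_cvgr _ _ _ _ (fun=> 0) (fun n => gker 1 1 n%:R)).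
  + apply: nearW => n; rewrite mulr_ge0 ?gauss_fun_ge0//= /gker powRr1// ler_wpM2l//.
    by rewrite /gauss_fun ler_expR mul1r lerN2 -natrX ler_nat; case: n => // n; rewrite leq_pmull.
  + exact: cvg_cst.
  + exact: gker_cvg0.
Qed.

(** The change of variables x = u^2 is made on the segments [0, n^2], because
    its derivative has no finite limit at infinity. *)
Lemma Gamma_three_halves : Gamma (3 / 2 : R) = Num.sqrt pi / 2.
Proof.
apply: EFin_inj; rewrite GammaE; last by lra.
rewrite -gauss_second_moment.
have -> : 3 / 2 - 1 = 2^-1 :> R by field.
have h0 : 0 <= 2^-1 :> R by rewrite invr_ge0.
pose k (x : R) := 2 * x ^+ 2 * gauss_fun x.
have ck : continuous k.
  move=> x; apply: cvgM; last exact: continuous_gauss_fun.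
  by apply: cvgM; [exact: cvg_cst|exact: exprn_continuous].
have k0 x : 0 <= k x by rewrite mulr_ge0 ?gauss_fun_ge0// mulr_ge0 ?sqr_ge0.
have hk := @ge0_cvgn_integral R mu k k0 (continuous_measurable_fun ck).
have hg := @ge0_cvgn_integral R mu (gker 2^-1 1) (@gker_ge0 R 2^-1 1) (@measurable_gker R 2^-1 1).
have sqy : (fun n : nat => (n ^ 2)%N) @ \oo --> \oo.
  by apply/cvgnyPge => A; near=> n; apply: (@leq_trans n); [near: n; exact: nbhs_infty_ge|case: (n) => // k'; rewrite leq_pmull].
have hg2 : (\int[mu]_(x in `[0%R, (n ^ 2)%:R]) (gker 2^-1 1 x)%:E @[n --> \oo] -->
    \int[mu]_(x in `[0%R, +oo[) (gker 2^-1 1 x)%:E)%E.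
  exact: (cvg_comp _ _ sqy hg).
have e1 := cvg_lim (@ereal_hausdorff R) hg2; have e2 := cvg_lim (@ereal_hausdorff R) hk.
refine (etrans (esym (e1 _)) _).
refine (etrans _ (e2 _)).
congr (limn _); apply/funext => n; clear hg2 hg hk sqy e1 e2.
have dF x : is_derive x (1 : R) (fun y : R => y ^+ 2) (2 * x).
  by have := @is_derive_pow R 2 x.
have F' : derive1 (fun y : R => y ^+ 2) = (fun x => 2 * x).
  by apply/funext => x; rewrite derive1E; have [_ ->] := dF x.
have cF : continuous (fun y : R => y ^+ 2) by move=> x; exact: exprn_continuous.
have cF' : continuous (fun y : R => 2 * y) by move=> x; apply: cvgM; [exact: cvg_cst|exact: cvg_id].
have := @integration_by_substitution_increasing R (fun y : R => y ^+ 2) (gker 2^-1 1) 0 n%:R (ler0n _ _).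
rewrite expr0n/= F' natrX => ->.
- apply: eq_integral => x; rewrite inE/= in_itv/= => /andP[x0 _]; congr EFin.
  rewrite -[LHS]/(gker 2^-1 1 (x ^+ 2) * (2 * x)) /gker /k /gauss_fun mul1r.
  by rewrite powR12_sqrt ?sqr_ge0// sqrtr_sqr ger0_norm//; ring.
- move=> x y; rewrite !in_itv/= => /andP[x0 _] _ xy.
  by rewrite ltrXn2r// (le_lt_trans x0).
- by move=> x _; exact: cF'.
- by apply/cvg_ex; exists (2 * 0); apply: cvg_at_right_filter; exact: cF'.
- by apply/cvg_ex; exists (2 * n%:R); apply: cvg_at_left_filter; exact: cF'.
- split; first by move=> x _; have [] := dF x.
    by apply: cvg_at_right_filter; exact: cF.
  by apply: cvg_at_left_filter; exact: cF.
- apply: continuous_subspaceW (@within_gker R 2^-1 1 h0) => x /=.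
  by rewrite !in_itv/= => /andP[->].
Unshelve. all: by end_near. Qed.

Lemma Gamma_five_halves : Gamma (5 / 2 : R) = 3 * Num.sqrt pi / 4.
Proof.
have -> : 5 / 2 = 3 / 2 + 1 :> R by field.
by rewrite GammaS ?Gamma_three_halves; [field|lra].
Qed.

Lemma Gamma2 : Gamma (2 : R) = 1.
Proof. by rewrite (_ : 2 = 1 + 1 :> R) ?GammaS// Gamma1 mulr1. Qed.

End GammaThreeHalves.

(** * The Gamma law *)

Section Densities.
Variable R : realType.
Local Notation mu := (@lebesgue_measure R).

Lemma integral_density (disp : measure_display) (T : measurableType disp)
    (Q : probability T R) (Y : {RV Q >-> R}) (p f : R -> R) :
  measurable_fun [set: R] p -> (forall x, 0 <= p x) ->
  (forall A : set R, measurable A -> distribution Q Y A = \int[mu]_(x in A) (p x)%:E)%E ->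
  measurable_fun [set: R] f -> (forall x, 0 <= f x) ->
  (\int[Q]_t (f (Y t))%:E = \int[mu]_x (f x * p x)%:E)%E.
Proof.
move=> mp p0 hY mf f0.
transitivity (\int[Q]_t (f (Y t) * 1)%:E)%E.
  by apply: eq_integral => t _; rewrite mulr1.
apply: (@integral_eq_indic R _ T Q _ _ mu Y (fun=> 1) id p f) => //.
move=> A mA; transitivity (distribution Q Y A).
  transitivity (\int[Q]_t (\1_(Y @^-1` A) t)%:E)%E.
    by apply: eq_integral => t _; rewrite mulr1.
  rewrite integral_indic ?setIT//.
  by rewrite -[X in measurable X]setTI; exact: measurable_funP.
rewrite hY// [LHS]integral_mkcond. apply: eq_integral => x _ /=.
by rewrite patchE indicE; case: ifP => _; rewrite ?mul1r ?mul0r.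
Qed.

Lemma gamma_pdf_ge0 s (x : R) : 1 <= s -> 0 <= gamma_pdf s x.
Proof.
move=> s1; rewrite /gamma_pdf; case: ifP => // _.
by rewrite !mulr_ge0 ?invr_ge0 ?powR_ge0 ?expR_ge0// ltW// Gamma_gt0.
Qed.

Lemma gamma_pdfE s : gamma_pdf s = (fun x : R => (Gamma s)^-1 * gker (s - 1) 1 x) \_ `]0, +oo[.
Proof.
apply/funext => x; rewrite patchE /gamma_pdf mem_setE in_itv/= andbT.
by case: ifP => // _; rewrite /gker mul1r mulrA.
Qed.

Lemma measurable_gamma_pdf s : measurable_fun [set: R] (gamma_pdf s : R -> R).
Proof.
rewrite gamma_pdfE; apply/measurable_restrict => //; apply: measurable_funTS.
by apply: measurable_funM => //; exact: measurable_gker.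
Qed.

Lemma integral_gamma_pdf s (f : R -> R) :
  measurable_fun [set: R] f -> (forall x, 0 <= f x) -> 1 <= s ->
  (\int[mu]_x (f x * gamma_pdf s x)%:E =
   ((Gamma s)^-1)%:E * \int[mu]_(x in `[0%R, +oo[) (f x * gker (s - 1) 1 x)%:E)%E.
Proof.
move=> mf f0 s1.
have mfg : measurable_fun [set: R] (fun x => f x * gker (s - 1) 1 x).
  by apply: measurable_funM => //; exact: measurable_gker.
rewrite -integral_itv_obnd_cbnd; last first.
  by apply: measurable_funTS; exact: measurable_EFin.
rewrite -ge0_integralZl//; first last.
- by rewrite lee_fin invr_ge0 ltW// Gamma_gt0.
- by move=> x _; rewrite lee_fin mulr_ge0 ?gker_ge0.
- by apply: measurable_funTS; exact: measurable_EFin.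
rewrite [RHS]integral_mkcond; apply: eq_integral => x _.
rewrite gamma_pdfE !patchE; case: ifP => _; last by rewrite mulr0.
by rewrite -EFinM mulrCA.
Qed.

Section GammaLaw.
Variables (disp : measure_display) (T : measurableType disp)
  (Q : probability T R) (Y : {RV Q >-> R}) (s : R).
Hypotheses (s1 : 1 <= s) (hY : gamma_distributed s Y).

Lemma integral_gamma (f : R -> R) :
  measurable_fun [set: R] f -> (forall x, 0 <= f x) ->
  (\int[Q]_t (f (Y t))%:E =
   ((Gamma s)^-1)%:E * \int[mu]_(x in `[0%R, +oo[) (f x * gker (s - 1) 1 x)%:E)%E.
Proof.
move=> mf f0; rewrite -integral_gamma_pdf//; apply: integral_density => //.
- exact: measurable_gamma_pdf.
- by move=> x; exact: gamma_pdf_ge0.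
Qed.

(** The function is prescribed on the half-line only, where the law is
    concentrated: it will involve real powers, which have conventional values
    at negative numbers. *)
Lemma gamma_laplace (f : R -> R) t : measurable_fun [set: R] f -> (forall x, 0 <= f x) ->
  (forall x, 0 <= x -> f x = expR (- (t * x))) -> 0 <= t ->
  (\int[Q]_u (f (Y u))%:E = ((1 + t) `^ (- s))%:E)%E.
Proof.
move=> mf f0 fE t0; rewrite integral_gamma//.
have -> : (\int[mu]_(x in `[0%R, +oo[) (f x * gker (s - 1) 1 x)%:E =
    \int[mu]_(x in `[0%R, +oo[) (gker (s - 1) (1 + t) x)%:E)%E.
  apply: eq_integral => x; rewrite inE/= in_itv/= andbT => x0; congr EFin.
  by rewrite fE// /gker mulrCA -expRD; congr (_ * expR _); ring.
rewrite integral_gker//; last by rewrite ltr_pwDl.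
by rewrite -EFinM mulrC mulfK// gt_eqF// Gamma_gt0.
Qed.

Lemma gamma_moment (f : R -> R) a c : measurable_fun [set: R] f -> (forall x, 0 <= f x) ->
  (forall x, 0 <= x -> f x = c * x `^ a) -> 0 <= c -> 0 <= a ->
  (\int[Q]_u (f (Y u))%:E = (c * (Gamma (s + a) / Gamma s))%:E)%E.
Proof.
move=> mf f0 fE c0 a0; rewrite integral_gamma//.
have -> : (\int[mu]_(x in `[0%R, +oo[) (f x * gker (s - 1) 1 x)%:E =
    \int[mu]_(x in `[0%R, +oo[) (c%:E * (gker (s + a - 1) 1 x)%:E))%E.
  rewrite -!integral_itv_obnd_cbnd; first last.
  - apply: measurable_funTS; apply: measurable_EFin; apply: measurable_funM => //.
    exact: measurable_gker.
  - by apply: measurable_funTS; apply: measurable_funeM; apply: measurable_EFin; exact: measurable_gker.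
  apply: eq_integral => x; rewrite inE/= in_itv/= andbT => x0; rewrite -EFinM; congr EFin.
  have e1 : x `^ (s + a - 1) = x `^ a * x `^ (s - 1).
    rewrite -powRD; first by congr (_ `^ _); ring.
    by rewrite (gt_eqF x0) implybT.
  by rewrite fE ?(ltW x0)// /gker e1; ring.
rewrite ge0_integralZl//; first last.
- by move=> x _; rewrite lee_fin gker_ge0.
- by apply: measurable_funTS; apply: measurable_EFin; exact: measurable_gker.
rewrite -GammaE; last by rewrite (le_trans s1)// lerDl.
by rewrite -!EFinM; congr EFin; rewrite mulrCA; congr (_ * _); rewrite mulrC.
Qed.

End GammaLaw.

Section GammaExists.
Variables (s : R).
Hypothesis s1 : 1 <= s.

Let integral_gamma_pdf1 : (\int[mu]_x (gamma_pdf s x)%:E = 1)%E.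
Proof.
transitivity (\int[mu]_x ((1 : R) * gamma_pdf s x)%:E)%E.
  by apply: eq_integral => x _; rewrite mul1r.
rewrite integral_gamma_pdf//.
under eq_integral do rewrite mul1r.
by rewrite -GammaE// -EFinM mulVf// gt_eqF// Gamma_gt0.
Qed.

Let gamma_prob0 : gamma_prob s set0 = 0%E :> \bar R.
Proof. by rewrite /gamma_prob integral_set0. Qed.

Let gamma_prob_ge0 (A : set R) : (0 <= gamma_prob s A)%E.
Proof. by apply: integral_ge0 => x _; rewrite lee_fin gamma_pdf_ge0. Qed.

Let integrable_gamma_pdf : mu.-integrable [set: R] (fun x => (gamma_pdf s x)%:E).
Proof.
apply/integrableP; split; first by apply: measurable_EFin; exact: measurable_gamma_pdf.
under eq_integral do rewrite gee0_abs ?lee_fin ?gamma_pdf_ge0//.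
by rewrite integral_gamma_pdf1 ltry.
Qed.

Let gamma_prob_additive : semi_sigma_additive (gamma_prob s : set R -> \bar R).
Proof.
move=> /= A mA tA mUA; rewrite /gamma_prob/= integral_bigcup//=; last first.
  by apply: (integrableS _ _ (subsetT _)) => //.
apply: is_cvg_ereal_nneg_natsum_cond => n _ _.
by apply: integral_ge0 => /= x ?; rewrite lee_fin gamma_pdf_ge0.
Qed.

HB.instance Definition _ := isMeasure.Build _ _ _
  (gamma_prob s : set R -> \bar R) gamma_prob0 gamma_prob_ge0 gamma_prob_additive.

HB.instance Definition _ :=
  @Measure_isProbability.Build _ _ R (gamma_prob s : set R -> \bar R) integral_gamma_pdf1.

Let gamma_law : probability R R := gamma_prob s.

Let coordinate : R -> R := id.

HB.instance Definition _ :=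
  @isMeasurableFun.Build _ _ R R coordinate (@measurable_id _ _ setT).

(** The asymptotics of the moments mention no Gamma variable, yet their proof
    identifies the limit with the moments of such a variable. *)
Lemma gamma_exists : exists (disp : measure_display) (T : measurableType disp)
  (Q : probability T R) (Y : {RV Q >-> R}), gamma_distributed s Y.
Proof.
exists _, _, gamma_law, (coordinate : {RV gamma_law >-> R}).
by move=> A mA.
Qed.

End GammaExists.
End Densities.

(** * Independent normal variables *)

Section IndependentProducts.
Variables (R : realType) (disp : measure_display) (T : measurableType disp)
  (Q : probability T R) (I : eqType) (D : {pred I}) (X : I -> {RV Q >-> R})
  (f : I -> R -> R) (e : I -> R).
Hypotheses (X_indep : independent_RVs D X)
  (mf : forall i, measurable_fun [set: R] (f i)) (f0 : forall i x, 0 <= f i x)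
  (fe : forall i, (\int[Q]_t (f i (X i t))%:E = (e i)%:E)%E).

Let measurable_product s (g : I -> R -> R) : (forall i, measurable_fun [set: R] (g i)) ->
  measurable_fun [set: T] (fun t => \prod_(i <- s) g i (X i t)).
Proof.
move=> mg; elim: s => [|i s IH].
  by under eq_fun do rewrite big_nil; exact: measurable_cst.
under eq_fun do rewrite big_cons.
by apply: measurable_funM => //; exact: measurableT_comp.
Qed.

Lemma integral_prod_indic s (A : I -> set R) : uniq s -> {subset s <= D} ->
  (forall i, measurable (A i)) ->
  (\int[Q]_t (\prod_(i <- s) \1_(A i) (X i t))%:E =
   (\prod_(i <- s) fine (Q (X i @^-1` A i)))%:E)%E.
Proof.
move=> us sD mA; have mXA i : measurable (X i @^-1` A i).
  by rewrite -[Y in measurable Y]setTI; exact: measurable_funP.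
transitivity (\int[Q]_t (\1_(\bigcap_(i in [set` s]) (X i @^-1` A i)) t)%:E)%E.
  apply: eq_integral => t _; congr EFin; rewrite indicE.
  have [tA|tA] := boolP (t \in _).
    rewrite big_seq big1// => i si; rewrite indicE mem_set//.
    by move: tA; rewrite inE => /(_ i si).
  have [i si ti] : exists2 i, i \in s & ~ A i (X i t).
    apply: contrapT => H; move/negP: tA; apply; rewrite inE => i /= si.
    by apply: contrapT => ti; apply: H; exists i.
  by rewrite (big_rem i)//= indicE memNset ?mul0r.
rewrite integral_indic ?setIT//; last exact: fin_bigcap_measurable.
rewrite -prodEFin; refine (etrans (X_indep us sD mA) _); apply: eq_bigr => i _.
by rewrite fineK// fin_num_measure.
Qed.

(** The indicators of the product rule are replaced by general functions one
    at a time, with the remaining product as a weight in integral_eq_indic. *)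
Lemma integral_prod_indep s : uniq s -> {subset s <= D} ->
  (\int[Q]_t (\prod_(i <- s) f i (X i t))%:E = (\prod_(i <- s) e i)%:E)%E.
Proof.
suff H s1 s2 (A : I -> set R) : uniq (s1 ++ s2) -> {subset s1 ++ s2 <= D} ->
    (forall i, measurable (A i)) ->
    (\int[Q]_t ((\prod_(i <- s1) f i (X i t)) * (\prod_(i <- s2) \1_(A i) (X i t)))%:E =
     ((\prod_(i <- s1) e i) * \prod_(i <- s2) fine (Q (X i @^-1` A i)))%:E)%E.
  move=> us sD; have := H s [::] (fun=> setT); rewrite cats0 big_nil mulr1 => <-//.
  by apply: eq_integral => t _; rewrite big_nil mulr1.
elim: s1 s2 A => [|i s1 IH] s2 A us sD mA.
  rewrite big_nil mul1r -integral_prod_indic//.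
  by apply: eq_integral => t _; rewrite big_nil mul1r.
move: us => /= /andP[is12 us].
have e0 j : 0 <= e j.
  by rewrite -lee_fin -fe; apply: integral_ge0 => t _; rewrite lee_fin.
pose c := (\prod_(j <- s1) e j) * \prod_(j <- s2) fine (Q (X j @^-1` A j)).
have c0 : 0 <= c.
  by rewrite mulr_ge0// prodr_ge0// => j _; exact: fine_ge0.
pose W t := (\prod_(j <- s1) f j (X j t)) * (\prod_(j <- s2) \1_(A j) (X j t)).
transitivity (\int[Q]_t (f i (X i t) * W t)%:E)%E.
  by apply: eq_integral => t _; rewrite big_cons /W mulrA.
transitivity (\int[Q]_t (f i (X i t) * c)%:E)%E; last first.
  under eq_integral do rewrite EFinM.
  rewrite ge0_integralZr//; first by rewrite fe -EFinM big_cons /c mulrA.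
  - by apply: measurable_EFin; exact: measurableT_comp.
  - by move=> t _; rewrite lee_fin.
apply: integral_eq_indic => //.
- apply: measurable_funM; first exact: (@measurable_product s1 f mf).
  by apply: (@measurable_product s2 (fun j => \1_(A j))) => j; exact: measurable_indic.
- by move=> t; rewrite mulr_ge0// prodr_ge0.
move=> B mB; pose A' j := if j == i then B else A j.
have iN : i \notin s2 by apply: contra is12 => i2; rewrite mem_cat i2 orbT.
have A's2 j : j \in s2 -> A' j = A j.
  by move=> js; rewrite /A'; case: eqP => // ji; rewrite -ji js in iN.
have A'i : A' i = B by rewrite /A' eqxx.
have := IH (i :: s2) A'.
rewrite big_cons A'i mulrCA.
have -> : \prod_(j <- s2) fine (Q (X j @^-1` A' j)) = \prod_(j <- s2) fine (Q (X j @^-1` A j)).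
  by rewrite big_seq [RHS]big_seq; apply: eq_bigr => j js; rewrite A's2.
rewrite -/c => H.
transitivity ((fine (Q (X i @^-1` B)) * c)%:E); last first.
  under eq_integral do rewrite EFinM.
  rewrite ge0_integralZr//; last by apply: measurable_EFin; exact: measurableT_comp.
  have := @integral_prod_indic [:: i] (fun=> B).
  rewrite big_seq1 EFinM => <-//; last by move=> j; rewrite inE => /eqP->; apply: sD; rewrite mem_head.
  by congr (_ * _)%E; apply: eq_integral => t _; rewrite big_seq1.
rewrite -H.
- apply: eq_integral => t _; congr EFin; rewrite big_cons A'i mulrCA; congr (_ * _).
  rewrite /W; congr (_ * _); rewrite big_seq [RHS]big_seq; apply: eq_bigr => j js.
  by rewrite A's2.
- by rewrite uniq_catC cat_cons/= uniq_catC us mem_cat orbC -mem_cat is12.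
- move=> j; rewrite mem_cat inE => h; apply: sD; rewrite /= inE mem_cat.
  by move: h => /or3P[->|->|->]; rewrite ?orbT.
- by move=> j; rewrite /A'; case: ifP.
Qed.

End IndependentProducts.

Section NormalLaplace.
Variable R : realType.

(** The product of exp (- t x^2) with the standard normal density is s times
    the centred normal density of variance s^2 = 1 / (1 + 2 t). *)
Lemma normal_laplace (disp : measure_display) (T : measurableType disp)
    (Q : probability T R) (Y : {RV Q >-> R}) (t : R) : 0 <= t ->
  (forall A : set R, measurable A -> distribution Q Y A = normal_prob 0 1 A) ->
  (\int[Q]_u (expR (- (t * Y u ^+ 2)))%:E = ((Num.sqrt (1 + 2 * t))^-1)%:E)%E.
Proof.
move=> t0 hY; set s := (Num.sqrt (1 + 2 * t))^-1.
have t1 : 0 < 1 + 2 * t by rewrite ltr_pwDl// mulr_ge0.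
have s0 : 0 < s by rewrite invr_gt0 sqrtr_gt0.
have s2 : s ^+ 2 = (1 + 2 * t)^-1 by rewrite exprVn sqr_sqrtr// ltW.
have mf : measurable_fun [set: R] (fun x : R => expR (- (t * x ^+ 2))).
  apply: (@measurableT_comp _ _ _ _ _ _ expR) => //; apply: measurableT_comp => //.
  by apply: measurable_funM => //.
rewrite (@integral_density R _ T Q Y (normal_pdf 0 1) (fun x => expR (- (t * x ^+ 2))))//; last 2 first.
- exact: measurable_normal_pdf.
- by move=> x; exact: normal_pdf_ge0.
transitivity (\int[lebesgue_measure]_x (s%:E * (normal_pdf 0 s x)%:E))%E.
  apply: eq_integral => x _; rewrite -EFinM; congr EFin.
  rewrite !normal_pdfE ?gt_eqF// /normal_fun /normal_peak !subr0.
  have -> : Num.sqrt (s ^+ 2 * pi *+ 2) = s * Num.sqrt (1 ^+ 2 * pi *+ 2).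
    by rewrite -mulrnAr sqrtrM ?sqr_ge0// sqrtr_sqr ger0_norm ?(ltW s0)// expr1n mul1r.
  rewrite mulrCA -expRD invfM !mulrA divff ?mul1r ?gt_eqF//.
  rewrite s2; congr (_ * expR _); field.
  by rewrite gt_eqF.
rewrite ge0_integralZl//; first by rewrite integral_normal_pdf mule1.
- by apply: measurable_EFin; exact: measurable_normal_pdf.
- by move=> x _; rewrite lee_fin normal_pdf_ge0.
- by rewrite lee_fin ltW.
Qed.

Lemma normal_vector_laplace (disp : measure_display) (T : measurableType disp)
    (Q : probability T R) (eta : 'I_4 -> {RV Q >-> R}) (t : R) : 0 <= t ->
  standard_normal_vector eta ->
  (\int[Q]_u (expR (- (t * euclidean_norm eta u ^+ 2)))%:E = ((1 + 2 * t) ^- 2)%:E)%E.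
Proof.
move=> t0 [h1 h2].
have mf : measurable_fun [set: R] (fun x : R => expR (- (t * x ^+ 2))).
  apply: (@measurableT_comp _ _ _ _ _ _ expR) => //; apply: measurableT_comp => //.
  by apply: measurable_funM => //.
have := @integral_prod_indep R _ T Q _ predT eta (fun _ x => expR (- (t * x ^+ 2)))
  (fun=> (Num.sqrt (1 + 2 * t))^-1) h2 (fun=> mf) _ _ (enum 'I_4) (enum_uniq _) _.
rewrite big_const_seq count_predT size_enum_ord iter_mulr_1.
have -> : (Num.sqrt (1 + 2 * t))^-1 ^+ 4 = (1 + 2 * t) ^- 2.
  by rewrite exprVn (exprM _ 2 2) sqr_sqrtr// addr_ge0// mulr_ge0.
move=> <-//; last by move=> i; apply: normal_laplace => //; exact: h1.
apply: eq_integral => u _; congr EFin.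
rewrite /euclidean_norm sqr_sqrtr; last by apply: sumr_ge0 => i _; exact: sqr_ge0.
by rewrite mulr_sumr -sumrN expR_sum big_enum.
Qed.

End NormalLaplace.

(** * Convergence of expectations and moments *)

Lemma near_succ (P : nat -> Prop) : (\forall n \near \oo, P n) -> \forall n \near \oo, P n.+1.
Proof. by move=> [N _ hN]; exists N => // n /= Nn; apply: hN => /=; exact: leqW. Qed.

Section BoundedFunctional.
Variables (R : realType) (disp : measure_display) (T : measurableType disp)
  (Q : probability T R) (Z : T -> R).
Hypotheses (mZ : measurable_fun [set: T] Z) (Z0 : forall t, 0 <= Z t).

Definition mean f : R := fine (\int[Q]_t (f (Z t))%:E)%E.

Lemma cb_measurable (f : R -> R) : cb f -> measurable_fun [set: T] (fun t => f (Z t)).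
Proof. by move=> [cf _]; apply: measurableT_comp => //; exact: continuous_measurable_fun. Qed.

Lemma cb_integrable (f : R -> R) : cb f -> Q.-integrable [set: T] (fun t => (f (Z t))%:E).
Proof.
move=> cf; have [_ [B hB]] := cf.
apply: (@le_integrable _ _ _ Q _ measurableT (fun t => (f (Z t))%:E) (fun=> (`|B|)%:E)).
- by apply: measurable_EFin; exact: cb_measurable.
- by move=> t _; rewrite !abse_EFin lee_fin normr_id (le_trans (hB _))// ler_norm.
- by apply: finite_measure_integrable_cst.
Qed.

Lemma meanE (f : R -> R) : cb f -> (\int[Q]_t (f (Z t))%:E = (mean f)%:E)%E.
Proof. by move=> cf; rewrite fineK//; apply: integrable_fin_num => //; exact: cb_integrable. Qed.

Lemma mean_le f g : cb f -> cb g -> (forall x, 0 <= x -> f x <= g x) -> mean f <= mean g.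
Proof.
move=> cf cg h; rewrite -lee_fin -!meanE//; apply: le_integral => //.
- exact: cb_integrable.
- exact: cb_integrable.
- by move=> t _; rewrite lee_fin h.
Qed.

Lemma meanD f g : cb f -> cb g -> mean (fun x => f x + g x) = mean f + mean g.
Proof.
move=> cf cg; apply: EFin_inj; rewrite EFinD -!meanE//; last exact: cbD.
by rewrite -integralD_EFin//; exact: cb_integrable.
Qed.

Lemma meanZ a f : cb f -> mean (fun x => a * f x) = a * mean f.
Proof.
move=> cf; apply: EFin_inj; rewrite EFinM -!meanE//; last exact: cbZ.
under eq_integral do rewrite EFinM.
by rewrite integralZl//; exact: cb_integrable.
Qed.

Lemma mean1 : mean (fun=> 1) = 1.
Proof.
by apply: EFin_inj; rewrite -meanE ?integral_cst//= ?probability_setT ?mul1e//; exact: cb_cst.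
Qed.

End BoundedFunctional.

Lemma continuous_powR_norm (R : realType) (r : R) : 0 < r -> continuous (fun x : R => `|x| `^ r).
Proof.
move=> r0 x; have [->|x0] := eqVneq x 0.
  rewrite /continuous_at normr0 powR0 ?gt_eqF//; apply/cvgrPdist_le => e e0.
  have := @nbhsx_ballx R R 0 (e `^ r^-1) (powR_gt0 _ e0).
  apply: filterS => y; rewrite /ball/= sub0r normrN => /ltW h.
  rewrite sub0r normrN ger0_norm ?powR_ge0//.
  have -> : e = (e `^ r^-1) `^ r by rewrite -powRrM mulVf ?gt_eqF// powRr1// ltW.
  by apply: ge0_ler_powR; rewrite ?nnegrE ?powR_ge0 ?(ltW r0).
apply: (@continuous_comp _ _ _ (fun x : R => `|x|) (fun y => y `^ r)); first exact: norm_continuous.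
apply: differentiable_continuous; apply/derivable1_diffP.
by have x1 : 0 < `|x|; [rewrite normr_gt0|have [] := is_derive1_powR r x1].
Qed.

Section ScalingLimit.
Variables (R : realType) (d : nat).
Hypothesis d_gt1 : (1 < d)%N.
Let d_gt0 : (0 < d)%N := ltnW d_gt1.
Variable m : nat -> nat.
Hypothesis m_gt0 : forall n, (0 < m n)%N.
Hypothesis hm : forall e : R, 0 < e -> \forall n \near \oo, (m n)%:R <= e * scale R d n.

Variables (disp : measure_display) (T : measurableType disp)
  (Q : probability T R) (Z : T -> R).
Hypotheses (mZ : measurable_fun [set: T] Z) (Z0 : forall t, 0 <= Z t).
Hypothesis Z_laplace : forall j : nat, (0 < j)%N ->
  (\int[Q]_t (expR (- (j%:R * Z t ^+ d)))%:E = (limit_laplace d j%:R)%:E)%E.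

(** The law of the number of descendants divided by the scale, as a
    functional. *)
Definition slaw n (f : R -> R) : R := dlaw d m n (fun x => f (x%:R / scale R d n)).

Let scale_ge0 n : 0 <= scale R d n.
Proof. exact: powR_ge0. Qed.

Lemma le_slaw n f g : (0 < n)%N -> (forall x, 0 <= x -> f x <= g x) -> slaw n f <= slaw n g.
Proof. by move=> n0 h; apply: le_dlaw => // x; apply: h; rewrite divr_ge0. Qed.

Lemma slaw_cvg f : cb f -> slaw n f @[n --> \oo] --> mean Q Z f.
Proof.
(* The chain is a probability law only for n > 0, while weak_convergence asks
   for positive functionals at every index. *)
move=> cf; rewrite -cvg_shiftS/=.
apply: (weak_convergence d_gt0 (L := fun n => slaw n.+1)) => //.
- by move=> n g h gh; exact: le_slaw.
- by move=> n g h; rewrite /slaw dlawD.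
- by move=> n a g; rewrite /slaw dlawZ.
- by move=> n; rewrite /slaw dlaw1.
- by move=> g h cg ch; exact: mean_le.
- by move=> g h cg ch; exact: meanD.
- by move=> a g cg; exact: meanZ.
- exact: mean1.
- move=> [|j].
    have -> : (fun x : R => lap d x ^+ 0) = (fun=> 1) by apply/funext => x; rewrite expr0.
    have -> : (fun n => slaw n.+1 (fun=> 1)) = (fun=> 1).
      by apply/funext => n; rewrite /slaw dlaw1.
    by rewrite mean1//; exact: cvg_cst.
  have lapE (x : R) : 0 <= x -> lap d x ^+ j.+1 = expR (- (j.+1%:R * x ^+ d)).
    by move=> x0; rewrite /lap -expRM_natl ger0_norm// mulrN.
  have -> : mean Q Z (fun x => lap d x ^+ j.+1) = limit_laplace d j.+1%:R.
    apply: EFin_inj; rewrite -Z_laplace// -meanE//; last exact: cb_lapX.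
    by apply: eq_integral => t _; rewrite lapE.
  have := @law_laplace R d d_gt1 m (fun n => root_term (m n))
    (fun n => root_term_averaging (m_gt0 n)) hm j.+1%:R (ltr0Sn _ _).
  rewrite -cvg_shiftS/=; apply: cvg_trans; apply: near_eq_cvg; apply: nearW => n.
  congr (law _ _ _ _ _); apply/funext => x.
  by rewrite lapE// divr_ge0.
- have [C hC] := dlaw_moment d_gt1 (fun n _ => m_gt0 n) hm 1.
  exists C; move/near_succ : hC; apply: filterS => n; apply: le_trans.
  by apply: le_dlaw => // x; rewrite expr1 ger0_norm// divr_ge0.
Qed.

Section Moment.
Variable r : R.
Hypothesis r0 : 0 < r.

Let trunc_pow M (x : R) := Num.min (`|x| `^ r) M.

Let cb_trunc M : 0 <= M -> cb (trunc_pow M).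
Proof.
move=> M0; split.
  move=> x; apply: (@continuous_min R R (fun x => `|x| `^ r) (fun=> M) x).
    exact: continuous_powR_norm.
  exact: cvg_cst.
exists M => x; rewrite ger0_norm ?le_min ?powR_ge0// /trunc_pow.
by rewrite ge_min lexx orbT.
Qed.

Let k := (Num.truncn (2 * r)).+1.

Let pow_le (x : R) : 0 <= x -> (x `^ r) ^+ 2 <= 1 + x ^+ k.
Proof.
move=> x0; have -> : (x `^ r) ^+ 2 = x `^ (r * 2) by rewrite -powR_mulrn ?powR_ge0// -powRrM.
have [x1|x1] := leP x 1.
  apply: (@le_trans _ _ 1); last by rewrite lerDl exprn_ge0.
  suff : x `^ (r * 2) <= 1 `^ (r * 2) by rewrite powR1.
  by apply: ge0_ler_powR; rewrite ?nnegrE// mulr_ge0// ltW.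
apply: (@le_trans _ _ (x ^+ k)); last by rewrite lerDr.
rewrite -powR_mulrn//; apply: ler_powR; first exact: ltW.
by rewrite mulrC; apply/ltW/truncnS_gt.
Qed.

Let trunc_gap M (x : R) : 0 < M -> 0 <= x ->
  0 <= `|x| `^ r - trunc_pow M x <= M^-1 * (1 + x ^+ k).
Proof.
move=> M0 x0; rewrite /trunc_pow (ger0_norm x0) subr_ge0 ge_min lexx/=.
have h := pow_le x0; have p0 : 0 <= x `^ r := powR_ge0 _ _.
rewrite -ler_pdivrMl ?invr_gt0// invrK.
have [xM|/ltW xM] := leP (x `^ r) M.
  by rewrite subrr mulr0 addr_ge0// exprn_ge0.
apply: le_trans h; nra.
Qed.

(** The truncated power min (x^r, M) is bounded and continuous, so its means
    converge. The remainder is at most x^(2r) / M, whose means are bounded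
    uniformly by dlaw_moment, and monotone convergence removes the truncation
    in the limit law. *)
Lemma slaw_moment_cvg : exists2 a : R,
  (\int[Q]_t (Z t `^ r)%:E = a%:E)%E & slaw n (fun x => `|x| `^ r) @[n --> \oo] --> a.
Proof.
have [C hC] := dlaw_moment d_gt1 (fun n _ => m_gt0 n) hm k.
have hC' : \forall n \near \oo, (0 < n)%N /\ slaw n (fun x => x ^+ k) <= C.
  by near=> n; split; near: n; [exact: nbhs_infty_gt|exact: hC].
have slawD n f g : slaw n (fun x => f x + g x) = slaw n f + slaw n g by rewrite /slaw dlawD.
have slawZ n a f : slaw n (fun x => a * f x) = a * slaw n f by rewrite /slaw dlawZ.
have slaw1 n : (0 < n)%N -> slaw n (fun=> 1) = 1 by move=> n0; rewrite /slaw dlaw1.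
have meanM M : 0 < M -> mean Q Z (trunc_pow M) <= 2 + C.
  move=> M0; have h := slaw_cvg (cb_trunc (ltW M0)).
  apply: (cvgr_to_le h); move: hC'; apply: filterS => n [n0 hn].
  apply: (@le_trans _ _ (slaw n (fun x => 1 + (1 + x ^+ k)))).
    apply: le_slaw => // x x0; rewrite /trunc_pow ge_min; apply/orP; left.
    have := pow_le x0; rewrite ger0_norm//; have := powR_ge0 x r; nra.
  by rewrite !slawD slaw1//; lra.
have mtr M : measurable_fun [set: T] (fun t => trunc_pow M (Z t)).
  apply: measurable_minr; last exact: measurable_cst.
  by apply: (@measurableT_comp _ _ _ _ _ _ (fun y => y `^ r)) => //; exact: measurableT_comp.
have mono : (\int[Q]_t (trunc_pow n%:R (Z t))%:E @[n --> \oo] --> \int[Q]_t (Z t `^ r)%:E)%E.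
  have -> : (\int[Q]_t (Z t `^ r)%:E =
      \int[Q]_t (limn (fun n => (trunc_pow n%:R (Z t))%:E)))%E.
    apply: eq_integral => t _; apply/esym/cvg_lim => //.
    apply: cvg_near_cst; near=> n; congr EFin; rewrite /trunc_pow ger0_norm//.
    by apply: min_l; near: n; exact: nbhs_infty_ger.
  apply: cvg_monotone_convergence => //.
  - by move=> n; apply: measurable_EFin; exact: mtr.
  - by move=> n t _; rewrite lee_fin /trunc_pow le_min powR_ge0/=.
  - move=> t _ n n' nn'; rewrite lee_fin /trunc_pow le_min !ge_min lexx/=.
    by rewrite ler_nat nn' orbT.
have bnd : (\int[Q]_t (Z t `^ r)%:E <= (2 + C)%:E)%E.
  rewrite -(cvg_lim _ mono)//; apply: lime_le; first by apply/cvg_ex; exists (\int[Q]_t (Z t `^ r)%:E)%E.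
  near=> n; have n0 : 0 < n%:R :> R by rewrite ltr0n; near: n; exact: nbhs_infty_gt.
  by rewrite meanE//; [rewrite lee_fin meanM|exact: cb_trunc].
have fin : (\int[Q]_t (Z t `^ r)%:E)%E \is a fin_num.
  rewrite ge0_fin_numE; first exact: le_lt_trans bnd (ltry _).
  by apply: integral_ge0 => t _; rewrite lee_fin powR_ge0.
exists (fine (\int[Q]_t (Z t `^ r)%:E)%E); first by rewrite fineK.
set a := fine _.
have meancvg : mean Q Z (trunc_pow n%:R) @[n --> \oo] --> a.
  by apply: fine_cvg; rewrite fineK.
apply/cvgrPdist_le => e e0.
have [M [M0 hM1 hM2]] : exists M : nat, [/\ (0 : R) < M%:R,
    `|a - mean Q Z (trunc_pow M%:R)| <= e / 3 & M%:R^-1 * (1 + C) <= e / 3].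
  near \oo => M; exists M; have M0 : 0 < M%:R :> R by rewrite ltr0n; near: M; exact: nbhs_infty_gt.
  split => //.
    by near: M; move/cvgrPdist_le : meancvg; apply; rewrite divr_gt0.
  rewrite ler_pdivrMl// -ler_pdivrMr ?divr_gt0//.
  by near: M; exact: nbhs_infty_ger.
have /cvgrPdist_le /(_ (e / 3)) := slaw_cvg (cb_trunc (ltW M0)).
rewrite divr_gt0// => /(_ isT); move: hC'; apply: filterS2 => n [n0 hn] h.
have h3 : 0 <= slaw n (fun x => `|x| `^ r) - slaw n (trunc_pow M%:R) <= e / 3.
  have -> : slaw n (fun x => `|x| `^ r) - slaw n (trunc_pow M%:R) =
      slaw n (fun x => `|x| `^ r + -1 * trunc_pow M%:R x).
    by rewrite slawD slawZ mulN1r.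
  apply/andP; split.
    rewrite -(mul0r (slaw n (fun=> 1))) -slawZ; apply: le_slaw => // x x0.
    by have /andP[h1 _] := trunc_gap M0 x0; rewrite mul0r mulN1r.
  apply: (@le_trans _ _ (slaw n (fun x => M%:R^-1 * (1 + x ^+ k)))).
    by apply: le_slaw => // x x0; have /andP[_ h1] := trunc_gap M0 x0; rewrite mulN1r.
  rewrite slawZ slawD slaw1//; apply: le_trans hM2.
  by apply: ler_wpM2l; [rewrite invr_ge0|rewrite lerD2l].
move: h hM1 h3; rewrite !ler_norml => /andP[u1 u2] /andP[v1 v2] /andP[w1 w2].
by apply/andP; split; lra.
Unshelve. all: by end_near. Qed.

End Moment.
End ScalingLimit.

(** * The limit of the number of descendants *)

Lemma equiv_cvg (R : realType) (u v a b : nat -> R) (c : R) : c != 0 ->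
  a n @[n --> \oo] --> c -> (\forall n \near \oo, u n = a n * b n) ->
  (forall n, v n = c * b n) -> u ~_\oo v.
Proof.
move=> c0 ac ua vE; apply/eqaddoP => e e0.
have /cvgrPdist_le /(_ (e * `|c|)) := ac.
rewrite mulr_gt0 ?normr_gt0// => /(_ isT) h.
near=> n; have -> : (u - v) n = (a n - c) * b n.
  rewrite -[LHS]/(u n - v n) vE mulrBl; congr (_ - _).
  by near: n; exact: ua.
rewrite vE !normrM mulrA; apply: ler_wpM2r => //; rewrite distrC.
by near: n.
Unshelve. all: by end_near. Qed.

Section Descendants.
Variables (R : realType) (d : nat) (m : nat -> nat)
  (disp : nat -> measure_display) (T : forall n, measurableType (disp n))
  (P : forall n, probability (T n) R)
  (head : forall n, nat * 'I_d -> {RV (P n) >-> nat}).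
Hypothesis d_gt1 : (1 < d)%N.
Hypothesis hm : forall n, (0 < n)%N -> (1 <= m n <= n)%N.
Hypothesis hmo : (fun n => (m n)%:R : R) =o_\oo
           (fun n => n%:R `^ ((d%:R - 1) / d%:R) : R).
Hypothesis hD : forall n, (0 < n)%N -> random_ddag n (m n) (head n).

Let d_gt0 : (0 < d)%N := ltnW d_gt1.
Let dR : 0 < d%:R :> R. Proof. by rewrite ltr0n. Qed.
Let dR1 : 0 < d%:R - 1 :> R. Proof. by rewrite subr_gt0 ltr1n. Qed.
Let DE : d.-1%:R = d%:R - 1 :> R.
Proof. by rewrite -[in RHS](prednK d_gt0) -natr1 addrK. Qed.

Local Notation X := (fun n => num_descendants n (m n) (head n)).
Local Notation X' := (fun n t => num_descendants n (m n) (head n) t / n%:R `^ ((d%:R - 1) / d%:R)).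

(** The number of roots at n = 0 is unconstrained and is replaced by a
    positive one. *)
Let roots n := maxn 1 (m n).

Let roots_gt0 n : (0 < roots n)%N. Proof. by rewrite leq_max. Qed.

Let rootsE n : (0 < n)%N -> roots n = m n.
Proof. by move=> n0; apply/maxn_idPr; have /andP[] := hm n0. Qed.

Let roots_small (e : R) : 0 < e -> \forall n \near \oo, (roots n)%:R <= e * scale R d n.
Proof.
move=> e0; have /eqoP/(_ e e0) h := hmo; near=> n.
have n0 : (0 < n)%N by near: n; exact: nbhs_infty_gt.
rewrite rootsE//; have : `|(m n)%:R : R| <= e * `|n%:R `^ ((d%:R - 1) / d%:R)| by near: n.
by rewrite !ger0_norm// powR_ge0.
Unshelve. all: by end_near. Qed.

Local Notation slaw := (@slaw R d roots).

(** For large n there are fewer roots than vertices, as the chain requires,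
    since m is of smaller order than the scale. *)
Lemma expectation_near : \forall n \near \oo, forall f : nat -> R,
  ('E_(P n)[fun t => f #|descendants n (m n) (fun e => head n e t)|] =
   (dlaw d roots n f)%:E)%E.
Proof.
have h := near_m_lt d_gt1 roots_small; near=> n => f.
have n0 : (0 < n)%N by near: n; exact: nbhs_infty_gt.
have mn : (roots n < n)%N by near: n.
rewrite /dlaw /law; move: mn; rewrite rootsE// => mn.
by apply: expectation_law => //; [exact: hD|have /andP[] := hm n0].
Unshelve. all: by end_near. Qed.

Let measurable_X' n : measurable_fun [set: T n] (X' n).
Proof.
exact: (@measurable_descendants d n (m n) _ (T n) R (P n) (head n)
  (fun x => x%:R / n%:R `^ ((d%:R - 1) / d%:R))).
Qed.

Section Limit.
Variables (disp' : measure_display) (T' : measurableType disp')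
  (Q : probability T' R) (Z : T' -> R).
Hypotheses (mZ : measurable_fun [set: T'] Z) (Z0 : forall t, 0 <= Z t).
Hypothesis Z_laplace : forall j : nat, (0 < j)%N ->
  (\int[Q]_t (expR (- (j%:R * Z t ^+ d)))%:E = (limit_laplace d j%:R)%:E)%E.

Lemma scaled_cvg_distribution : cvg_distribution P X' Q Z.
Proof.
split=> // f cf [B [_ hB]].
have cbf : cb f.
  by split=> //; exists (B + 1) => x; apply: hB => //; rewrite ltrDl.
have h := slaw_cvg d_gt1 roots_gt0 roots_small mZ Z0 Z_laplace cbf.
have -> : ('E_Q[f \o Z] = (mean Q Z f)%:E)%E by rewrite unlock -meanE.
suff : (slaw n f)%:E @[n --> \oo] --> (mean Q Z f)%:E.
  apply: cvg_trans; apply: near_eq_cvg; have := expectation_near.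
  by apply: filterS => n /(_ (fun x => f (x%:R / scale R d n))) <-.
by apply: cvg_EFin => //; exact: nearW.
Qed.

Lemma scaled_cvg_moments : cvg_moments P X' Q Z.
Proof.
move=> r r0.
have [a aE ha] := slaw_moment_cvg d_gt1 roots_gt0 roots_small mZ Z0 Z_laplace r0.
have -> : ('E_Q[fun t => (Z t `^ r)%R] = a%:E)%E by rewrite unlock.
split; first by rewrite ltry.
suff : (slaw n (fun x => `|x| `^ r))%:E @[n --> \oo] --> a%:E.
  apply: cvg_trans; apply: near_eq_cvg; have := expectation_near.
  apply: filterS => n /(_ (fun x => `|x%:R / scale R d n| `^ r)) <-.
  congr expectation; apply/funext => t; rewrite ger0_norm//.
  by rewrite divr_ge0// powR_ge0.
by apply: cvg_EFin => //; exact: nearW.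
Qed.

Lemma moment_equiv r (c : R) : 0 < r -> c != 0 -> (\int[Q]_t (Z t `^ r)%:E = c%:E)%E ->
  (fun n => fine 'E_(P n)[fun t => (X n t `^ r)%R]%E) ~_\oo
  (fun n => c * n%:R `^ (r * (d%:R - 1) / d%:R)).
Proof.
move=> r0 c0 cE.
have [a aE ha] := slaw_moment_cvg d_gt1 roots_gt0 roots_small mZ Z0 Z_laplace r0.
have {aE} aE : a = c by apply: EFin_inj; rewrite -aE -cE.
apply: (equiv_cvg (b := fun n => n%:R `^ (r * (d%:R - 1) / d%:R)) c0 _ _ (fun=> erefl)).
  by rewrite -aE; exact: ha.
have hE := expectation_near; near=> n.
have n0 : (0 < n)%N by near: n; exact: nbhs_infty_gt.
have := (near hE n) _ => /(_ _ (fun x => x%:R `^ r)) -> //=.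
rewrite mulrC /slaw -dlawZ; congr (dlaw _ _ _ _); apply/funext => x.
have s0 : 0 < scale R d n by exact: scale_gt0.
have -> : n%:R `^ (r * (d%:R - 1) / d%:R) = scale R d n `^ r.
  by rewrite /scale -powRrM; congr (_ `^ _); ring.
rewrite ger0_norm ?divr_ge0 ?(ltW s0)// -powRM ?divr_ge0 ?(ltW s0)//.
by rewrite mulrC divfK// gt_eqF.
Unshelve. all: by end_near. Qed.

End Limit.

Let c0 : R := pi * (d%:R - 1) `^ (d%:R^-1) / (d%:R * sin (pi / d%:R)).

Let c0E : c0 = reflc R d * (d%:R - 1) `^ d%:R^-1.
Proof. by rewrite /c0 /reflc; ring. Qed.

Let c0_ge0 : 0 <= c0.
Proof. by rewrite c0E mulr_ge0 ?powR_ge0// reflc_ge0. Qed.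

(** The factor (d - 1) of the limit of the branching phase and the integral of
    the fluid phase combine into the constant of the theorem. *)
Let c0d : c0 ^+ d = d.-1%:R * reflc R d ^+ d.
Proof.
rewrite c0E exprMn -[X in _ * X]powR_mulrn ?powR_ge0// -powRrM mulVf ?gt_eqF// powRr1 ?ltW//.
by rewrite DE mulrC.
Qed.

Let s1 : 1 <= d%:R / (d%:R - 1) :> R.
Proof. by rewrite ler_pdivlMr// mul1r gerBl. Qed.

Section GammaLimit.
Variables (disp' : measure_display) (T' : measurableType disp')
  (Q : probability T' R) (gamma : {RV Q >-> R}).
Hypothesis gammaP : gamma_distributed (d%:R / (d%:R - 1)) gamma.

Let phi (x : R) := c0 * x `^ d%:R^-1.

Let mphi : measurable_fun [set: R] phi.
Proof. by apply: measurable_funM => //; exact: measurable_powR. Qed.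

Let phi0 x : 0 <= phi x.
Proof. by rewrite mulr_ge0 ?powR_ge0. Qed.

Lemma measurable_root_gamma : measurable_fun [set: T'] (fun t => phi (gamma t)).
Proof. exact: measurableT_comp. Qed.

Lemma root_gamma_laplace (j : nat) : (0 < j)%N ->
  (\int[Q]_t (expR (- (j%:R * phi (gamma t) ^+ d)))%:E = (limit_laplace d j%:R)%:E)%E.
Proof.
move=> j0; have t0 : 0 <= j%:R * c0 ^+ d by rewrite mulr_ge0 ?exprn_ge0.
have mf : measurable_fun [set: R] (fun x => expR (- (j%:R * phi x ^+ d))).
  apply: (@measurableT_comp _ _ _ _ _ _ expR) => //; apply: measurableT_comp => //.
  by apply: measurable_funM => //; exact: measurable_funX.
rewrite (@gamma_laplace R _ T' Q gamma _ s1 gammaP (fun x => expR (- (j%:R * phi x ^+ d))) (j%:R * c0 ^+ d))//.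
- congr EFin; rewrite /limit_laplace c0d DE; congr (_ `^ _); congr (1 + _); ring.
- move=> x x0; rewrite /phi exprMn -[X in _ * (_ * X)]powR_mulrn ?powR_ge0// -powRrM.
  by rewrite mulVf ?gt_eqF// powRr1// mulrA.
Qed.

Lemma root_gamma_moment r : 0 < r ->
  (\int[Q]_t (phi (gamma t) `^ r)%:E =
   (c0 `^ r * (Gamma (d%:R / (d%:R - 1) + r / d%:R) / Gamma (d%:R / (d%:R - 1))))%:E)%E.
Proof.
move=> r0.
have mf : measurable_fun [set: R] (fun x => phi x `^ r).
  exact: (@measurableT_comp _ _ _ _ _ _ (fun y => y `^ r)).
rewrite (@gamma_moment R _ T' Q gamma _ s1 gammaP (fun x => phi x `^ r) (r / d%:R) (c0 `^ r))//.
- by move=> x; exact: powR_ge0.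
- move=> x x0; rewrite /phi powRM ?powR_ge0//; congr (_ * _).
  by rewrite -powRrM; congr (_ `^ _); rewrite mulrC.
- exact: powR_ge0.
- by rewrite divr_ge0// ltW.
Qed.

End GammaLimit.

Lemma gamma_limit (disp' : measure_display) (T' : measurableType disp')
    (Q : probability T' R) (gamma : {RV Q >-> R}) :
  gamma_distributed (d%:R / (d%:R - 1)) gamma ->
  cvg_distribution P X' Q (fun t => c0 * gamma t `^ d%:R^-1) /\
  cvg_moments P X' Q (fun t => c0 * gamma t `^ d%:R^-1).
Proof.
move=> h; have hl := root_gamma_laplace h.
have mZ := measurable_root_gamma gamma.
split; [apply: scaled_cvg_distribution|apply: scaled_cvg_moments] => //.
- by move=> t; rewrite mulr_ge0 ?powR_ge0.
- by move=> t; rewrite mulr_ge0 ?powR_ge0.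
Qed.

Lemma moments_asymptotics r : 0 < r ->
  (fun n => fine 'E_(P n)[fun t => (X n t `^ r)%R]%E) ~_\oo
  (fun n => ((d%:R - 1) `^ (d%:R^-1) * pi / (d%:R * sin (pi / d%:R))) `^ r
            * (Gamma (d%:R / (d%:R - 1) + r / d%:R)
               / Gamma (d%:R / (d%:R - 1)))
            * n%:R `^ (r * (d%:R - 1) / d%:R)).
Proof.
move=> r0; have [disp' [T' [Q [gamma h]]]] := gamma_exists s1.
have -> : (d%:R - 1) `^ (d%:R^-1) * pi / (d%:R * sin (pi / d%:R)) = c0.
  by rewrite /c0 [_ * pi]mulrC.
apply: (moment_equiv _ _ (root_gamma_laplace h)) => //.
- exact: measurable_root_gamma.
- by move=> t; rewrite mulr_ge0 ?powR_ge0.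
- have c0_gt0 : 0 < c0.
    rewrite /c0 divr_gt0 ?mulr_gt0 ?pi_gt0 ?powR_gt0//.
    apply: sin_gt0_pi; rewrite divr_gt0 ?pi_gt0//=.
    by rewrite ltr_pdivrMr// ltr_pMr ?pi_gt0// ltr1n.
  rewrite mulf_neq0 ?gt_eqF ?powR_gt0// divr_gt0// Gamma_gt0//.
  by rewrite (le_trans s1)// lerDl divr_ge0// ltW.
- exact: root_gamma_moment.
Qed.

End Descendants.

(** * The case d = 2 and the theorem *)

Lemma scale2 (R : realType) (n : nat) : n%:R `^ ((2%:R - 1) / 2%:R) = Num.sqrt n%:R :> R.
Proof.
by rewrite -powR12_sqrt// (_ : (2%:R - 1) / 2%:R = 2^-1 :> R)//; field.
Qed.

Lemma reflc2 (R : realType) : reflc R 2%N = pi / 2.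
Proof. by rewrite /reflc sin_pihalf mulr1. Qed.

(** Half of the squared norm of a standard normal vector in dimension 4 has
    the Gamma law of parameter 2, which is visible on Laplace transforms: both
    sides are (1 + j pi^2 / 4)^-2. *)
Lemma chi4_laplace (R : realType) (disp : measure_display) (T : measurableType disp)
    (Q : probability T R) (eta : 'I_4 -> {RV Q >-> R}) (j : nat) :
  standard_normal_vector eta ->
  (\int[Q]_u (expR (- (j%:R * (pi / (2 * Num.sqrt 2) * euclidean_norm eta u) ^+ 2)))%:E =
   (limit_laplace 2%N j%:R)%:E)%E.
Proof.
move=> h; pose t : R := j%:R * (pi / (2 * Num.sqrt 2)) ^+ 2.
have t0 : 0 <= t by rewrite mulr_ge0 ?sqr_ge0.
transitivity (\int[Q]_u (expR (- (t * euclidean_norm eta u ^+ 2)))%:E)%E.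
  by apply: eq_integral => u _; rewrite exprMn mulrA.
rewrite normal_vector_laplace//; congr EFin.
have tE : 2 * t = j%:R * (pi / 2) ^+ 2.
  by rewrite /t !exprMn !exprVn exprMn sqr_sqrtr//; field.
rewrite /limit_laplace reflc2 tE mul1r powRN divr1 powR_mulrn//.
by rewrite addr_ge0// mulr_ge0 ?sqr_ge0.
Qed.

Lemma euclidean_norm_ge0 (R : realType) (disp : measure_display) (T : measurableType disp)
    (Q : probability T R) (k : nat) (eta : 'I_k -> {RV Q >-> R}) (t : T) :
  0 <= euclidean_norm eta t.
Proof. exact: sqrtr_ge0. Qed.

Lemma measurable_euclidean_norm (R : realType) (disp : measure_display)
    (T : measurableType disp) (Q : probability T R) (k : nat) (eta : 'I_k -> {RV Q >-> R}) :
  measurable_fun [set: T] (euclidean_norm eta).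
Proof.
apply: (@measurableT_comp _ _ _ _ _ _ (@Num.sqrt R)).
  by apply: continuous_measurable_fun; exact: sqrt_continuous.
by apply: measurable_sum => i; exact: measurable_funX.
Qed.

Theorem theorem10p1 (R : realType) (d : nat) (m : nat -> nat)
    (disp : nat -> measure_display) (T : forall n, measurableType (disp n))
    (P : forall n, probability (T n) R)
    (head : forall n, nat * 'I_d -> {RV (P n) >-> nat})
    (hd : (2 <= d)%N)
    (hm : forall n, (0 < n)%N -> (1 <= m n <= n)%N)
    (hmo : (fun n => (m n)%:R : R) =o_\oo
           (fun n => n%:R `^ ((d%:R - 1) / d%:R) : R))
    (hD : forall n, (0 < n)%N -> random_ddag n (m n) (head n)) :
  let X := fun n => num_descendants n (m n) (head n) in
  [/\ forall (disp' : measure_display) (T' : measurableType disp')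
          (Q : probability T' R) (gamma : {RV Q >-> R}),
        gamma_distributed (d%:R / (d%:R - 1)) gamma ->
        let X' := fun n t => X n t / n%:R `^ ((d%:R - 1) / d%:R) in
        let Z := fun t => pi * (d%:R - 1) `^ (d%:R^-1) / (d%:R * sin (pi / d%:R))
                          * gamma t `^ (d%:R^-1) in
        cvg_distribution P X' Q Z /\ cvg_moments P X' Q Z,
      forall r : R, 0 < r ->
        (fun n => fine 'E_(P n)[fun t => (X n t `^ r)%R]%E) ~_\oo
        (fun n => ((d%:R - 1) `^ (d%:R^-1) * pi / (d%:R * sin (pi / d%:R))) `^ r
                  * (Gamma (d%:R / (d%:R - 1) + r / d%:R)
                     / Gamma (d%:R / (d%:R - 1)))
                  * n%:R `^ (r * (d%:R - 1) / d%:R))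
    & d = 2%N ->
      [/\ forall (disp' : measure_display) (T' : measurableType disp')
              (Q : probability T' R) (eta : 'I_4 -> {RV Q >-> R}),
            standard_normal_vector eta ->
            let X' := fun n t => X n t / Num.sqrt n%:R in
            let Z := fun t => pi / (2 * Num.sqrt 2) * euclidean_norm eta t in
            cvg_distribution P X' Q Z /\ cvg_moments P X' Q Z,
          forall r : R, 0 < r ->
            (fun n => fine 'E_(P n)[fun t => (X n t `^ r)%R]%E) ~_\oo
            (fun n => (pi / 2) `^ r * Gamma (r / 2 + 2) * n%:R `^ (r / 2))
        & (fun n => fine 'E_(P n)[X n]%E) ~_\oo
          (fun n => 3 * pi `^ (3 / 2) / 8 * Num.sqrt n%:R)]].
Proof.
move=> X; split.
- move=> disp' T' Q gamma h X' Z.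
  have [h1 h2] := gamma_limit hd hm hmo hD h.
  have ZE : Z = (fun t => pi * (d%:R - 1) `^ d%:R^-1 / (d%:R * sin (pi / d%:R)) * gamma t `^ d%:R^-1).
    by [].
  by split.
- by move=> r r0; exact: moments_asymptotics.
move=> d2; subst d.
have sqE (n : nat) : n%:R `^ ((2%:R - 1) / 2%:R) = Num.sqrt n%:R :> R := scale2 R n.
have moments (r : R) : 0 < r ->
    (fun n => fine 'E_(P n)[fun t => (X n t `^ r)%R]%E) ~_\oo
    (fun n => (pi / 2) `^ r * Gamma (r / 2 + 2) * n%:R `^ (r / 2)).
  move=> r0; have := moments_asymptotics hd hm hmo hD r0.
  rewrite (_ : (fun n : nat => _ * n%:R `^ (r * (2 - 1) / 2)) =
    (fun n : nat => (pi / 2) `^ r * Gamma (r / 2 + 2) * n%:R `^ (r / 2)))//.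
  apply/funext => n; have -> : 2 - 1 = 1 :> R by ring.
  by rewrite powR1 mul1r sin_pihalf !mulr1 divr1 Gamma2 divr1 [2 + _]addrC.
split=> //.
- move=> disp' T' Q eta h X' Z.
  have -> : X' = (fun n t => num_descendants n (m n) (head n) t / n%:R `^ ((2%:R - 1) / 2%:R)).
    apply: boolp.functional_extensionality_dep => n; apply/funext => t.
    by rewrite /X' sqE.
  have mZ : measurable_fun [set: T'] Z.
    by apply: measurable_funM => //; exact: measurable_euclidean_norm.
  have Z0 t : 0 <= Z t.
    by rewrite mulr_ge0 ?euclidean_norm_ge0// divr_ge0 ?pi_ge0// mulr_ge0 ?sqrtr_ge0.
  have Z_laplace (j : nat) (_ : (0 < j)%N) := chi4_laplace j h.
  split; first exact: (scaled_cvg_distribution hd hm hmo hD mZ Z0 Z_laplace).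
  exact: (scaled_cvg_moments hd hm hmo hD mZ Z0 Z_laplace).
have := moments 1 ltr01.
have -> : (fun n => fine 'E_(P n)[fun t => (X n t `^ 1)%R]%E) = (fun n => fine 'E_(P n)[X n]%E).
  apply/funext => n; congr (fine (expectation _ _)); apply/funext => t.
  by rewrite powRr1// /X /num_descendants ler0n.
have -> : (fun n : nat => (pi / 2) `^ 1 * Gamma (1 / 2 + 2) * n%:R `^ (1 / 2)) =
    (fun n : nat => 3 * pi `^ (3 / 2) / 8 * Num.sqrt n%:R) :> (nat -> R).
  apply/funext => n; rewrite powRr1 ?divr_ge0 ?pi_ge0// mul1r powR12_sqrt//.
  have -> : 2^-1 + 2 = 5 / 2 :> R by field.
  have -> : pi `^ (3 / 2) = pi * Num.sqrt pi :> R.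
    have -> : 3 / 2 = 1 + 2^-1 :> R by field.
    rewrite powRD; last by rewrite (gt_eqF (pi_gt0 R)) implybT.
    by rewrite powRr1 ?pi_ge0// powR12_sqrt// pi_ge0.
  by rewrite Gamma_five_halves; field.
by [].
Qed.
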